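(* Let $b>0$, $r\in(0,1]$, $h\ge 0$ and $c>2\sqrt{1-r}$ be given, and suppose that the system $$\phi''(t)-c\phi'(t)+\phi(t)(1-r-\phi(t)+r\psi(t))=0,\qquad \psi''(t)-c\psi'(t)+b\phi(t-ch)(1-\psi(t))=0$$ has a regular super-solution $(\psi_+,\phi_+)$. Then there exists a monotone wavefront $(u,v)(t,x)=(\phi,\theta)(\nu\cdot x+ct)$, $|\nu|=1$, connecting $(0,1)$ with $(1,0)$, of the system $$u_t(t,x)=\Delta u(t,x)+u(t,x)(1-u(t,x)-rv(t-h,x)),\qquad v_t(t,x)=\Delta v(t,x)-bu(t,x)v(t,x)$$ moving at the velocity $c$ and satisfying the following as $t\to-\infty$. If $r=1$: $$\phi(t)=\frac{2c^2/b}{t^2}-\frac{8c}{3b}\Big(c^2\big(1+h+\tfrac1b\big)-4\Big)\frac{\ln(-t)}{t^3}+O\Big(\frac1{t^3}\Big),$$ $$\theta(t)=1+\frac{2c}{t}-\frac43\Big(c^2\big(1+h+\tfrac1b\big)-4\Big)\frac{\ln(-t)}{t^2}+O\Big(\frac1{t^2}\Big).$$ If $r\in(0,1)$: for some $\varepsilon>0$ and with $\lambda=\frac12\big(c-\sqrt{c^2-4(1-r)}\big)$, $$\phi(t)=e^{\lambda t}+O(e^{(\lambda+\varepsilon)t}),\qquad \theta(t)=1-\frac{b\,e^{\lambda t}}{1-r}+O(e^{(\lambda+\varepsilon)t}).$$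
   Context: A wavefront with speed $c$ connecting $(0,1)$ with $(1,0)$ is a solution $(u,v)(t,x)=(\phi,\theta)(\nu\cdot x+ct)$, $|\nu|=1$, with $\phi,\theta\in C^2(\mathbb{R})$, $(\phi,\theta)(-\infty)=(0,1)$, $(\phi,\theta)(+\infty)=(1,0)$. It is a (positive) monotone wavefront if $\phi,\theta>0$ and both components are monotone. With $\psi(t)=1-\theta(t-ch)$ the profile equations are exactly the system for $(\phi,\psi)$ displayed in the claim. Let $\lambda<\mu$ denote the real roots of $\chi(z,c):=z^2-cz+(1-r)=0$. Regular super-solution: let $t_1,t_2\in\mathbb{R}$ and let $\psi_+,\phi_+$ be continuous and piecewise $C^1$-smooth functions which are positive and have positive derivatives in some neighborhoods $\mathcal{O}_1,\mathcal{O}_2$ of the sets $(-\infty,t_1]$, $(-\infty,t_2]$, respectively. The pair $(\psi_+',\phi_+')$ is allowed to have a finite set $\mathcal{D}=\{d_1<d_2<\dots<d_M\}$, $d_M<\min\{t_1,t_2\}$, of discontinuity points, at which the one-sided derivatives satisfy $\psi_+'(d_j-)>\psi_+'(d_j+)$ and $\phi_+'(d_j-)>\phi_+'(d_j+)$; away from $\mathcal{D}$ the functions are $C^2$ wherever their second derivatives appear below. Suppose that $\psi_+(-\infty)=\phi_+(-\infty)=0$, $\psi_+(t_1)=\phi_+(t_2)=1$, and that $\psi_+,\phi_+$ are $C^2$-smooth in some vicinities of $t_1,t_2$. Moreover $\phi_+$ is supposed to be defined, strictly increasing and smooth on $[t_2,+\infty)$. The pair $(\psi_+,\phi_+)$ is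 called a regular super-solution if the following hold. D1. For some fixed positive $\nu\in(\lambda,\mu)$, some $m\in\{0,1\}$ and some constant $C_1>0$, as $t\to-\infty$, $$\psi_+(t)=O(te^{\nu t}),\qquad (\phi_+(t),\phi_+'(t),\phi_+''(t))=C_1(-t)^me^{\nu t}(1,\nu,\nu^2)(1+o(1)).$$ D2. If $t\le\min\{t_1,t_2\}$, $t\notin\mathcal{D}$, then $$\phi_+''(t)-c\phi_+'(t)+\phi_+(t)(1-r-\phi_+(t)+r\psi_+(t))<0,\qquad \psi_+''(t)-c\psi_+'(t)+b\phi_+(t-ch)(1-\psi_+(t))<0 .$$ D3. If $t_1<t_2$, then $\phi_+''(t)-c\phi_+'(t)+\phi_+(t)(1-\phi_+(t))<0$ for $t\in[t_1,t_2]$. D4. If $t_1>t_2$, then $\psi_+''(t)-c\psi_+'(t)+b\min\{1,\phi_+(t-ch)\}(1-\psi_+(t))<0$ for $t\in[t_2,t_1]$. *)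

(* Defs.v *)
(* Points of R^n are functions 'I_n -> R over the Stdlib reals. *)
From mathcomp Require Import ssreflect ssrfun ssrbool eqtype ssrnat seq fintype bigop.
From Stdlib Require Import Reals Lra List.
From Coquelicot Require Import Coquelicot.

Set Implicit Arguments.
Unset Strict Implicit.
Unset Printing Implicit Defensive.

Open Scope R_scope.

Definition bigO_minf (f g : R -> R) : Prop :=
  exists K : R, Rbar_locally m_infty (fun t => Rabs (f t) <= K * Rabs (g t)).

Definition C1_at (f : R -> R) (t : R) : Prop :=
  ex_derive f t /\ continuous (Derive f) t.

(* [ex_derive_n f 2] alone would not give the existence of the first
   derivative, as [Derive] is total. *)
Definition C2_near (f : R -> R) (t : R) : Prop :=
  locally t (fun s => ex_derive_n f 1 s /\ ex_derive_n f 2 s /\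
                      continuous (Derive_n f 2) s).

Definition monotone (f : R -> R) : Prop :=
  (forall s t : R, s <= t -> f s <= f t) \/
  (forall s t : R, s <= t -> f t <= f s).

Definition dot (n : nat) (x y : 'I_n -> R) : R :=
  \big[Rplus/0]_(i < n) (x i * y i).

Definition enorm (n : nat) (x : 'I_n -> R) : R := sqrt (dot x x).

Definition slice (n : nat) (w : ('I_n -> R) -> R) (x : 'I_n -> R) (i : 'I_n)
  (s : R) : R := w (fun j => if j == i then s else x j).

Definition laplacian (n : nat) (w : ('I_n -> R) -> R) (x : 'I_n -> R) : R :=
  \big[Rplus/0]_(i < n) Derive_n (slice w x i) 2 (x i).

(* Existence of the derivatives occurring in w_t - Laplacian w; without it the
   total operators above would be meaningless. *)
Definition has_heat_derivatives (n : nat) (w : R -> ('I_n -> R) -> R) : Prop :=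
  forall (t : R) (x : 'I_n -> R),
    ex_derive (fun s => w s x) t /\
    forall (i : 'I_n) (s : R),
      ex_derive_n (slice (w t) x i) 1 s /\ ex_derive_n (slice (w t) x i) 2 s.

Definition solves_system (n : nat) (b r h : R) (u v : R -> ('I_n -> R) -> R)
  : Prop :=
  has_heat_derivatives u /\ has_heat_derivatives v /\
  forall (t : R) (x : 'I_n -> R),
    Derive (fun s => u s x) t
      = laplacian (u t) x + u t x * (1 - u t x - r * v (t - h) x) /\
    Derive (fun s => v s x) t = laplacian (v t) x - b * u t x * v t x.

Definition travelling (n : nat) (nu : 'I_n -> R) (c : R) (phi : R -> R)
  (t : R) (x : 'I_n -> R) : R := phi (dot nu x + c * t).

Record wavefront (n : nat) (nu : 'I_n -> R) (b r h c : R) (phi theta : R -> R)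
  : Prop := Wavefront {
  wf_direction : enorm nu = 1;
  wf_phi_C2 : forall t : R, C2_near phi t;
  wf_theta_C2 : forall t : R, C2_near theta t;
  wf_phi_minf : is_lim phi m_infty 0;
  wf_theta_minf : is_lim theta m_infty 1;
  wf_phi_pinf : is_lim phi p_infty 1;
  wf_theta_pinf : is_lim theta p_infty 0;
  wf_solution :
    solves_system b r h (travelling nu c phi) (travelling nu c theta)
}.

Record monotone_wavefront (n : nat) (nu : 'I_n -> R) (b r h c : R)
  (phi theta : R -> R) : Prop := MonotoneWavefront {
  mwf_wavefront : wavefront nu b r h c phi theta;
  mwf_phi_pos : forall t : R, 0 < phi t;
  mwf_theta_pos : forall t : R, 0 < theta t;
  mwf_phi_monotone : monotone phi;
  mwf_theta_monotone : monotone theta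
}.

Definition chi (r z c : R) : R := z ^ 2 - c * z + (1 - r).

Definition chi_lambda (r c : R) : R := (c - sqrt (c ^ 2 - 4 * (1 - r))) / 2.
Definition chi_mu (r c : R) : R := (c + sqrt (c ^ 2 - 4 * (1 - r))) / 2.

Lemma chi_roots (r c : R) : r <= 1 -> 2 * sqrt (1 - r) < c ->
  chi r (chi_lambda r c) c = 0 /\ chi r (chi_mu r c) c = 0 /\
  chi_lambda r c < chi_mu r c.
Proof.
move=> hr hc.
have h0 := sqrt_pos (1 - r).
have h1 : sqrt (1 - r) * sqrt (1 - r) = 1 - r by apply: sqrt_sqrt; lra.
have h2 : 0 < c ^ 2 - 4 * (1 - r) by nra.
have h3 := sqrt_lt_R0 _ h2.
have h4 : sqrt (c ^ 2 - 4 * (1 - r)) * sqrt (c ^ 2 - 4 * (1 - r))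
  = c ^ 2 - 4 * (1 - r) by apply: sqrt_sqrt; lra.
rewrite /chi /chi_lambda /chi_mu; split; [nra | split; [nra | lra]].
Qed.

Definition profile_phi (r c : R) (phi psi : R -> R) (t : R) : R :=
  Derive_n phi 2 t - c * Derive phi t + phi t * (1 - r - phi t + r * psi t).

Definition profile_psi (b h c : R) (phi psi : R -> R) (t : R) : R :=
  Derive_n psi 2 t - c * Derive psi t + b * phi (t - c * h) * (1 - psi t).

Definition concave_kink (f : R -> R) (d : R) : Prop :=
  exists dl dr : R,
    filterlim (Derive f) (at_left d) (locally dl) /\
    filterlim (Derive f) (at_right d) (locally dr) /\ dr < dl.

(* Where this is used D lies strictly to the left of T, so the last clause also
   says that f is C^2 in a vicinity of T. *)
Definition piecewise_increasing (f : R -> R) (D : list R) (T : R) : Prop :=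
  (exists O : R -> Prop,
      open O /\ (forall t : R, t <= T -> O t) /\
      forall t : R, O t ->
        continuous f t /\ 0 < f t /\
        (~ In t D -> C1_at f t /\ 0 < Derive f t)) /\
  (forall d : R, In d D -> concave_kink f d) /\
  (forall t : R, t <= T -> ~ In t D -> C2_near f t).

(* Functions are total, but psi is constrained only near (-oo, t1]. *)
Record regular_super_solution_with (b r h c t1 t2 : R) (D : list R)
  (psi phi : R -> R) : Prop := RegularSuperSolution {
  rs_D : forall d : R, In d D -> d < Rmin t1 t2;
  rs_psi : piecewise_increasing psi D t1;
  rs_phi : piecewise_increasing phi D t2;
  rs_psi_minf : is_lim psi m_infty 0;
  rs_phi_minf : is_lim phi m_infty 0;
  rs_psi_t1 : psi t1 = 1;
  rs_phi_t2 : phi t2 = 1;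
  rs_phi_right_mono : forall s t : R, t2 <= s -> s < t -> phi s < phi t;
  rs_phi_right_smooth : forall t : R, t2 <= t -> C1_at phi t;
  rs_D1 : exists (nu : R) (m : nat) (C1 : R),
    0 < nu /\ chi_lambda r c < nu < chi_mu r c /\
    (m = 0%nat \/ m = 1%nat) /\ 0 < C1 /\
    bigO_minf psi (fun t => t * exp (nu * t)) /\
    forall k : nat, (k <= 2)%coq_nat ->
      is_equiv (Rbar_locally m_infty)
        (fun t => C1 * (- t) ^ m * exp (nu * t) * nu ^ k)
        (Derive_n phi k);
  rs_D2 : forall t : R, t <= Rmin t1 t2 -> ~ In t D ->
    profile_phi r c phi psi t < 0 /\ profile_psi b h c phi psi t < 0;
  rs_D3 : t1 < t2 -> forall t : R, t1 <= t <= t2 ->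
    Derive_n phi 2 t - c * Derive phi t + phi t * (1 - phi t) < 0;
  rs_D4 : t2 < t1 -> forall t : R, t2 <= t <= t1 ->
    Derive_n psi 2 t - c * Derive psi t
      + b * Rmin 1 (phi (t - c * h)) * (1 - psi t) < 0
}.

Definition regular_super_solution (b r h c : R) (psi phi : R -> R) : Prop :=
  exists (t1 t2 : R) (D : list R),
    regular_super_solution_with b r h c t1 t2 D psi phi.

(* Main.v *)
(* Regular super-solutions decay at -oo like exp (nu t) with nu strictly between
   the characteristic roots lambda < mu, i.e. faster than the wave, so no
   sub-solution lies below them on the whole line. The system is therefore solved
   by monotone iteration on [a, B], between a small constant and the
   super-solution, with that constant as datum at a and 1 at B. Translating so
   that psi = 1/2 at the origin and letting a -> -oo, B -> +oo gives an entire
   monotone solution; compactness is obtained by pointwise limits along an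
   ultrafilter.

   At -oo the ratio p = phi'/phi solves p' = - (p - lambda)(p - mu) - o(1), hence
   tends to lambda or to mu. In the second case phi and psi decay faster than the
   super-solution, which can then be slid over the wave to contradict the strong
   maximum principle. So p -> lambda. If r < 1 the convergence is exponential,
   which gives phi ~ C exp (lambda t), and C is normalised by a translation. If
   r = 1 then lambda = 0; expanding in powers of J = c psi - psi', which satisfies
   J' = b phi(t - c h)(1 - psi), one finds
     J' = J^2 / (2 c^2) + kappa J^3 + O(J^4),
     kappa = - (c^2 (1 + h + 1/b) - 4) / (6 c^5),
   and this is integrated to 1/J = - t / (2 c^2) + 2 c^2 kappa ln (- t) + O(1). *)
Require Import Defs.
From HB Require Import structures.
From mathcomp Require Import ssreflect ssrfun ssrbool eqtype ssrnat seq fintype bigop.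
From mathcomp Require filter.
From Stdlib Require Import Reals Lra Lia List Classical ClassicalEpsilon.
From Coquelicot Require Import Coquelicot.

Set Implicit Arguments.
Unset Strict Implicit.
Unset Printing Implicit Defensive.

Open Scope R_scope.

(** * Calculus on the line *)

(** Every [(0, s)] is an equilibrium of the profile system, because [psi] has no source where [phi]
    vanishes; a limit of translated solutions could therefore start from some [s > 0]. The bound by
    the super-solution holds in a fixed frame and is lost once the frame follows the level
    [psi = 1/2]. What survives the translation is an inequality for a combination of fluxes
    ([defect]) between the current point and a base point near [a], where the super-solution makes
    everything small. In the limit it forces [s = 0].

    The estimates at -oo rest on one mechanism: backward in time, [y' = al * y - g] with [al]
    bounded below by a positive constant forgets its data, and [y] inherits the size of [g]. It is
    applied to [psi' = c * psi - J] and to the equation for [p]. For [r = 1] no exponential weight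
    is available. Powers of [J] take its place, because the logarithmic derivative of [J] tends to 0
    and because integrating against [J'] gains one power. Orders in [J] are raised alternately by
    these two devices, and only the final relation for [J'] is converted into powers of [t]. *)

Lemma derive_const (a x : R) : is_derive (fun _ : R => a) x 0.
Proof. exact: is_derive_const. Qed.

Lemma derive_id (x : R) : is_derive (fun t : R => t) x 1.
Proof. exact: is_derive_id. Qed.

Lemma derive_plus (f g : R -> R) (x a b : R) :
  is_derive f x a -> is_derive g x b -> is_derive (fun t => f t + g t) x (a + b).
Proof. exact: is_derive_plus. Qed.

Lemma derive_minus (f g : R -> R) (x a b : R) :
  is_derive f x a -> is_derive g x b -> is_derive (fun t => f t - g t) x (a - b).
Proof. exact: is_derive_minus. Qed.

Lemma derive_opp (f : R -> R) (x a : R) :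
  is_derive f x a -> is_derive (fun t => - f t) x (- a).
Proof. exact: is_derive_opp. Qed.

Lemma derive_mult (f g : R -> R) (x a b : R) :
  is_derive f x a -> is_derive g x b ->
  is_derive (fun t => f t * g t) x (a * g x + f x * b).
Proof. by move=> hf hg; apply: is_derive_mult hf hg _ => u v; apply: Rmult_comm. Qed.

Lemma derive_inv (f : R -> R) (x a : R) :
  is_derive f x a -> f x <> 0 -> is_derive (fun t => / f t) x (- a / f x ^ 2).
Proof. exact: is_derive_inv. Qed.

Lemma derive_div (f g : R -> R) (x a b : R) :
  is_derive f x a -> is_derive g x b -> g x <> 0 ->
  is_derive (fun t => f t / g t) x ((a * g x - f x * b) / g x ^ 2).
Proof. exact: is_derive_div. Qed.

Lemma derive_pow (f : R -> R) (n : nat) (x a : R) :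
  is_derive f x a -> is_derive (fun t => f t ^ n) x (INR n * a * f x ^ Init.Nat.pred n).
Proof. exact: is_derive_pow. Qed.

Lemma derive_comp (f g : R -> R) (x a b : R) :
  is_derive f (g x) a -> is_derive g x b -> is_derive (fun t => f (g t)) x (b * a).
Proof. exact: is_derive_comp. Qed.

Lemma derive_exp (f : R -> R) (x a : R) :
  is_derive f x a -> is_derive (fun t => exp (f t)) x (a * exp (f x)).
Proof. by move=> hf; apply: derive_comp hf; apply: is_derive_exp. Qed.

Lemma derive_ln (f : R -> R) (x a : R) :
  is_derive f x a -> 0 < f x -> is_derive (fun t => ln (f t)) x (a / f x).
Proof. by move=> hf h0; apply: derive_comp hf; apply: is_derive_ln. Qed.

Lemma derive_shift (f : R -> R) (x s a : R) :
  is_derive f (x + s) a -> is_derive (fun t => f (t + s)) x a.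
Proof.
move=> hf; rewrite -(Rmult_1_l a); apply: (derive_comp hf).
by rewrite -(Rplus_0_r 1); apply: derive_plus; [apply: derive_id | apply: derive_const].
Qed.

Lemma derive_shift_sub (f : R -> R) (x s a : R) :
  is_derive f (x - s) a -> is_derive (fun t => f (t - s)) x a.
Proof. exact: derive_shift. Qed.

Lemma derive_eq (f : R -> R) (x a b : R) : is_derive f x a -> a = b -> is_derive f x b.
Proof. by move=> ? <-. Qed.

(** [der] leaves the derivative as an existential variable that is built from the shape of the
    function. What remains is the nonvanishing or positivity conditions and the equality with the
    announced derivative. *)
Ltac der1 :=
  first
  [ eassumption
  | simple apply derive_const | simple apply derive_id
  | simple eapply derive_plus | simple eapply derive_minus | simple eapply derive_opp
  | simple eapply derive_div | simple eapply derive_inv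
  | simple eapply derive_mult | simple eapply derive_pow
  | simple eapply derive_exp | simple eapply derive_ln
  | simple eapply derive_shift_sub | simple eapply derive_shift
  | match goal with H : forall _, _ |- is_derive _ _ _ => simple eapply H end ].
Ltac der := eapply derive_eq; [repeat der1 | cbv beta; simpl INR; simpl Init.Nat.pred].

Lemma derive_continuous (f : R -> R) (x a : R) : is_derive f x a -> continuous f x.
Proof. by move=> h; apply: ex_derive_continuous; exists a. Qed.

Lemma mvt (f df : R -> R) (a b : R) : a < b ->
  (forall t, a < t < b -> is_derive f t (df t)) ->
  (forall t, a <= t <= b -> continuous f t) ->
  exists x, a < x < b /\ f b - f a = df x * (b - a).
Proof.
move=> hab hd hc.
have pr1 : forall x, a < x < b -> derivable_pt f x.
  by move=> x hx; exists (df x); apply/is_derive_Reals; apply: hd.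
have pr2 : forall x, a < x < b -> derivable_pt id x by move=> x _; apply: derivable_pt_id.
case: (MVT f id a b pr1 pr2 hab) => [x hx|x hx|x [hx e]].
- by apply/continuity_pt_filterlim; apply: hc.
- by apply: derivable_continuous_pt; apply: derivable_pt_id.
exists x; split=> //.
have e1 : derive_pt f x (pr1 x hx) = df x.
  by apply: derive_pt_eq_0; apply/is_derive_Reals; apply: hd.
have e2 : derive_pt id x (pr2 x hx) = 1.
  by apply: derive_pt_eq_0; apply: derivable_pt_lim_id.
by move: e; rewrite e1 e2 /id; lra.
Qed.

Lemma mvt_le (f df : R -> R) (a b : R) : a <= b ->
  (forall t, a <= t <= b -> is_derive f t (df t)) ->
  exists x, a <= x <= b /\ f b - f a = df x * (b - a).
Proof.
case=> [hab|->] hd; last by exists b; split; [lra | ring].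
case: (@mvt f df a b hab) => [t ht|t ht|x [hx e]].
- by apply: hd; lra.
- by apply: derive_continuous (hd _ _).
- by exists x; split=> //; lra.
Qed.

Lemma derive_ge0_le (f df : R -> R) (a b : R) : a <= b ->
  (forall t, a <= t <= b -> is_derive f t (df t)) ->
  (forall t, a <= t <= b -> 0 <= df t) -> f a <= f b.
Proof.
move=> hab hd h0; case: (mvt_le hab hd) => x [hx e].
have := h0 _ hx; nra.
Qed.

Lemma derive_le0_ge (f df : R -> R) (a b : R) : a <= b ->
  (forall t, a <= t <= b -> is_derive f t (df t)) ->
  (forall t, a <= t <= b -> df t <= 0) -> f b <= f a.
Proof.
move=> hab hd h0; case: (mvt_le hab hd) => x [hx e].
have := h0 _ hx; nra.
Qed.

Lemma derive_abs_le (f df : R -> R) (a b K : R) : a <= b ->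
  (forall t, a <= t <= b -> is_derive f t (df t)) ->
  (forall t, a <= t <= b -> Rabs (df t) <= K) -> Rabs (f b - f a) <= K * (b - a).
Proof.
move=> hab hd h0; case: (mvt_le hab hd) => x [hx ->].
rewrite Rabs_mult (Rabs_pos_eq (b - a)); last by lra.
by apply: Rmult_le_compat_r; [lra | apply: h0].
Qed.

Lemma continuous_locally_lt (f : R -> R) (x d : R) :
  continuous f x -> f x < d -> locally x (fun t => f t < d).
Proof. by move=> hc h; exact: (hc _ (open_lt d _ h)). Qed.

Lemma continuous_locally_gt (f : R -> R) (x d : R) :
  continuous f x -> d < f x -> locally x (fun t => d < f t).
Proof. by move=> hc h; exact: (hc _ (open_gt d _ h)). Qed.

Lemma locally_ex (x : R) (P : R -> Prop) :
  locally x P <-> exists d, 0 < d /\ forall y, Rabs (y - x) < d -> P y.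
Proof.
split.
- by case=> d hd; exists d; split=> [|y hy]; [apply: cond_pos | apply: hd].
- by case=> d [h0 hd]; exists (mkposreal d h0) => y hy; apply: hd.
Qed.

Lemma exists_small (a b : R) : 0 < a -> 0 < b -> exists s, 0 < s /\ s < a /\ s < b.
Proof.
move=> ha hb; have q1 := Rmin_l a b; have q2 := Rmin_r a b.
by exists (Rmin a b / 2); have := Rmin_pos _ _ ha hb; lra.
Qed.

Lemma last_crossing (g : R -> R) (a b d : R) : a <= b ->
  (forall t, a <= t <= b -> continuous g t) -> g a <= d -> d < g b ->
  exists s, a <= s < b /\ g s = d /\ forall t, s < t <= b -> d < g t.
Proof.
move=> hab hc ha hb.
pose E := fun s => a <= s <= b /\ g s <= d.
have [s [hs1 hs2]] : {s | is_lub E s}.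
  apply: completeness; first by exists b => x [[_ ?] _].
  by exists a; split=> //; lra.
have has : a <= s by apply: hs1; split=> //; lra.
have hsb : s <= b by apply: hs2 => x [[_ ?] _].
have habove : forall t, s < t <= b -> d < g t.
  move=> t ht; apply: Rnot_le_lt => hgt.
  have : t <= s by apply: hs1; split=> //; lra.
  lra.
have hle : g s <= d.
  apply: Rnot_lt_le => hlt.
  have [e [he hloc]] := proj1 (locally_ex _ _)
     (continuous_locally_gt (hc _ (conj has hsb)) hlt).
  have : s <= s - e / 2.
    apply: hs2 => x [hx1 hx2]; apply: Rnot_lt_le => hx.
    have hxs : x <= s by apply: hs1.
    have := hloc x; rewrite Rabs_left1; lra.
  lra.
have hsb' : s < b by case: hsb => // e; move: hle; rewrite e; lra.
have hge : d <= g s.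
  apply: Rnot_lt_le => hlt.
  have [e [he hloc]] := proj1 (locally_ex _ _)
     (continuous_locally_lt (hc _ (conj has hsb)) hlt).
  have [x [hx [hx1 hx2]]] := exists_small he (Rlt_Rminus _ _ hsb').
  have := habove (s + x) ltac:(lra); have := hloc (s + x) ltac:(rewrite Rabs_pos_eq; lra); lra.
by exists s; do 2 (split; first by lra).
Qed.

(** After the last point at which [g] takes the value [Rmax d (g a)] the sign condition applies, so
    [g] cannot climb to a larger [g b]. This form suits differential inequalities that hold only
    while the unknown is large. *)
Lemma nonincr_above (g dg : R -> R) (a b d : R) : a <= b ->
  (forall t, a <= t <= b -> is_derive g t (dg t)) ->
  (forall t, a <= t <= b -> d < g t -> dg t <= 0) ->
  d < g b -> g b <= g a.
Proof.
move=> hab hd h0 hb; apply: Rnot_lt_le => hlt.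
have hc t : a <= t <= b -> continuous g t by move=> ht; apply: derive_continuous (hd _ ht).
have h1 := Rmax_l d (g a); have h2 := Rmax_r d (g a).
have h3 : Rmax d (g a) < g b by apply: Rmax_lub_lt.
case: (last_crossing hab hc h2 h3) => s [hs [e h]].
case: (@mvt g dg s b) => [|t ht|t ht|x [hx e']]; try lra.
- by apply: hd; lra.
- by apply: hc; lra.
have := h0 x; have := h x; nra.
Qed.

Lemma nondecr_above (g dg : R -> R) (a b d : R) : a <= b ->
  (forall t, a <= t <= b -> is_derive g t (dg t)) ->
  (forall t, a <= t <= b -> d < g t -> 0 <= dg t) ->
  d < g a -> g a <= g b.
Proof.
move=> hab hd h0 ha.
have := @nonincr_above (fun t => g (- t)) (fun t => - dg (- t)) (- b) (- a) d.
rewrite !Ropp_involutive; apply=> //; try lra.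
- move=> t ht; have e : - dg (- t) = (- 1) * dg (- t) by ring.
  rewrite e; apply: derive_comp; first by apply: hd; lra.
  by apply: derive_opp; apply: derive_id.
- by move=> t ht h; have := h0 (- t); lra.
Qed.

Lemma derive_slope (g : R -> R) (x l m : R) : is_derive g x l -> m < l ->
  exists e, 0 < e /\ forall s, 0 < s < e -> m * s < g (x + s) - g x /\ m * s < g x - g (x - s).
Proof.
move=> /is_derive_Reals hd hm; have [d hd'] := hd (l - m) ltac:(lra).
have hdp := cond_pos d; exists d; split=> // s hs; split.
  have /Rabs_def2 [_ q] := hd' s ltac:(lra) ltac:(rewrite Rabs_pos_eq; lra).
  have e : g (x + s) - g x = (g (x + s) - g x) / s * s by field; lra.
  by rewrite e; apply: Rmult_lt_compat_r; lra.
have /Rabs_def2 [_ q] := hd' (- s) ltac:(lra) ltac:(rewrite Rabs_left; lra).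
have e : g x - g (x - s) = (g (x + - s) - g x) / - s * s by rewrite /Rminus; field; lra.
by rewrite e; apply: Rmult_lt_compat_r; lra.
Qed.

Lemma second_derivative_min (f f1 : R -> R) (t f2 : R) :
  locally t (fun s => is_derive f s (f1 s)) -> is_derive f1 t f2 ->
  locally t (fun s => f t <= f s) -> f1 t = 0 /\ 0 <= f2.
Proof.
move=> h1 h2 h3.
have [d [hd hloc]] := proj1 (locally_ex _ _) (filter_and _ _ h1 h3).
have hf1 : f1 t = 0.
  have [|h10 _] := hloc t; first by rewrite Rminus_diag Rabs_R0.
  have pr : derivable_pt f t by exists (f1 t); apply/is_derive_Reals.
  have <- : derive_pt f t pr = f1 t by apply: derive_pt_eq_0; apply/is_derive_Reals.
  apply: (@deriv_minimum f (t - d) (t + d)); try lra.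
  by move=> x hx1 hx2; have [|_ //] := hloc x; apply: Rabs_def1; lra.
split=> //; apply: Rnot_lt_le => hneg.
have [e [he hs]] := derive_slope (m := 0) (derive_opp h2) ltac:(lra).
have [s [hs0 [hs1 hs2]]] := exists_small hd he.
have hin x : t <= x <= t + s -> is_derive f x (f1 x) /\ f t <= f x.
  by move=> hx; apply: hloc; apply: Rabs_def1; lra.
case: (@mvt f f1 t (t + s)) => [|x hx|x hx|x [hx ex]]; first by lra.
- by apply: (proj1 (hin _ _)); lra.
- by apply: (derive_continuous (proj1 (hin _ _))); lra.
have := proj2 (hin (t + s) ltac:(lra)); have [+ _] := hs (x - t) ltac:(lra).
have -> : t + (x - t) = x by ring.
nra.
Qed.

(** * Backward estimates for first-order equations *)

Lemma energy_bound (y al g a0 G : R) : a0 <= al -> Rabs g <= G ->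
  2 * Rabs y * (a0 * Rabs y - G) <= 2 * (al * y - g) * y.
Proof.
move=> hal hg; have h1 : g * y <= G * Rabs y.
  apply: Rle_trans (Rle_abs _) _; rewrite Rabs_mult.
  by apply: Rmult_le_compat_r => //; apply: Rabs_pos.
have h2 : a0 * y ^ 2 <= al * y ^ 2 by apply: Rmult_le_compat_r => //; apply: pow2_ge_0.
by rewrite -{1}(pow2_abs y) in h2; lra.
Qed.

(** The derivative of [y ^ 2] is [2 * (al * y - g) * y], which is nonnegative once [Rabs y] exceeds
    [G / a0]. Going backward, [Rabs y] can therefore not grow above the larger of this threshold and
    its value at [T]. *)
Lemma ode_back_bound (y al g : R -> R) (T a0 G : R) : 0 < a0 ->
  (forall t, t <= T -> is_derive y t (al t * y t - g t)) ->
  (forall t, t <= T -> a0 <= al t) -> (forall t, t <= T -> Rabs (g t) <= G) ->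
  forall t, t <= T -> Rabs (y t) <= Rmax (Rabs (y T)) (G / a0).
Proof.
move=> ha hd hal hg t ht; apply: Rnot_lt_le; set M := Rmax _ _ => hlt.
have hM1 : Rabs (y T) <= M by apply: Rmax_l.
have hM2 : G / a0 <= M by apply: Rmax_r.
have hM0 : 0 <= M by have := Rabs_pos (y T); lra.
have hGM : G <= M * a0 by have := Rmult_le_compat_r a0 _ _ (Rlt_le _ _ ha) hM2;
  have -> : G / a0 * a0 = G by field; lra.
have key : y t ^ 2 <= y T ^ 2.
  apply: (@nondecr_above (fun s => y s ^ 2)
     (fun s => 2 * (al s * y s - g s) * y s) t T (M ^ 2)) => //.
  - move=> s hs; have := hd s ltac:(lra) => hds; der; ring.
  - move=> s hs hs2.
    have hs3 : M < Rabs (y s).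
      apply: Rnot_le_lt => hle; move: hs2; rewrite -(pow2_abs (y s)).
      have := Rabs_pos (y s); nra.
    apply: Rle_trans (energy_bound (y s) (hal s ltac:(lra)) (hg s ltac:(lra))).
    by apply: Rmult_le_pos; nra.
  - by rewrite -(pow2_abs (y t)); nra.
move: key; rewrite -(pow2_abs (y t)) -(pow2_abs (y T)).
have := Rabs_pos (y T); nra.
Qed.

Definition tends0 (f : R -> R) : Prop :=
  forall e, 0 < e -> exists T, forall t, t <= T -> Rabs (f t) <= e.

Lemma tends0_bound (f g : R -> R) (T : R) :
  (forall t, t <= T -> Rabs (f t) <= Rabs (g t)) -> tends0 g -> tends0 f.
Proof.
move=> h hg e he; have [T1 hT1] := hg e he.
exists (Rmin T T1) => t ht; have h1 := Rmin_l T T1; have h2 := Rmin_r T T1.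
by apply: Rle_trans (h t _) (hT1 t _); lra.
Qed.

Lemma exp_le (x y : R) : x <= y -> exp x <= exp y.
Proof. by case=> [h|->]; [left; apply: exp_increasing | right]. Qed.

Lemma tends0_exp (a : R) : 0 < a -> tends0 (fun t => exp (a * t)).
Proof.
move=> ha e he; exists (ln e / a) => t ht.
rewrite Rabs_pos_eq; last by left; apply: exp_pos.
apply: Rle_trans (_ : exp (ln e) <= e); last by rewrite exp_ln //; lra.
apply: exp_le.
have -> : ln e = a * (ln e / a) by field; lra.
by apply: Rmult_le_compat_l; lra.
Qed.

Lemma ode_back_tends0 (y al g : R -> R) (T a0 : R) : 0 < a0 ->
  (forall t, t <= T -> is_derive y t (al t * y t - g t)) ->
  (forall t, t <= T -> a0 <= al t) -> tends0 g -> tends0 y.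
Proof.
move=> ha hd hal hg e he.
have [|T1 hT1] := hg (e * a0 / 2); first by nra.
pose T2 := Rmin T T1.
have hT2 : T2 <= T by apply: Rmin_l.
have hT2' : T2 <= T1 by apply: Rmin_r.
(* If [Rabs y] stayed above [e], then [y ^ 2] would decrease backward at rate at least [a0 * e ^ 2]
   and become negative at [s]. From one small value on, the previous bound keeps all earlier values
   small. *)
have [t1 [ht1 hy1]] : exists t1, t1 <= T2 /\ Rabs (y t1) <= e.
  apply: NNPP => hno.
  have hbig t : t <= T2 -> e < Rabs (y t).
    by move=> ht; apply: Rnot_le_lt => hle; apply: hno; exists t.
  pose s := T2 - (y T2 ^ 2 + 1) / (a0 * e ^ 2).
  have hpos : 0 < a0 * e ^ 2 by apply: Rmult_lt_0_compat => //; apply: pow_lt.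
  have hs : s <= T2.
    rewrite /s; have : 0 <= (y T2 ^ 2 + 1) / (a0 * e ^ 2); last by lra.
    by apply: Rlt_le; apply: Rdiv_lt_0_compat => //; nra.
  have key : y s ^ 2 - a0 * e ^ 2 * s <= y T2 ^ 2 - a0 * e ^ 2 * T2.
    apply: (@derive_ge0_le (fun t => y t ^ 2 - a0 * e ^ 2 * t)
      (fun t => 2 * (al t * y t - g t) * y t - a0 * e ^ 2) s T2 hs) => t ht.
    - have := hd t ltac:(lra) => hdt; der; ring.
    - have h0 := hbig t ltac:(lra).
      have := energy_bound (y t) (hal t ltac:(lra)) (hT1 t ltac:(lra)).
      have : (2 * e) * (a0 * e / 2) <= 2 * Rabs (y t) * (a0 * Rabs (y t) - e * a0 / 2).
        by apply: Rmult_le_compat; nra.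
      lra.
  have e1 : a0 * e ^ 2 * s = a0 * e ^ 2 * T2 - (y T2 ^ 2 + 1).
    by rewrite /s; field; split; nra.
  by have := pow2_ge_0 (y s); lra.
exists t1 => t ht.
apply: Rle_trans (_ : Rmax (Rabs (y t1)) (e * a0 / 2 / a0) <= e).
  apply: (@ode_back_bound y al g t1 a0 (e * a0 / 2)) => // s hs.
  - by apply: hd; lra.
  - by apply: hal; lra.
  - by apply: hT1; lra.
apply: Rmax_lub => //.
have -> : e * a0 / 2 / a0 = e / 2 by field; lra.
lra.
Qed.

(** Above the level [d], [/ y] decreases backward at rate at least [k]. It would reach 0 within the
    finite time [/ y t0 / k], although [y] exists for all earlier times. *)
Lemma riccati_blowup (y dy : R -> R) (T k d : R) : 0 < k -> 0 < d ->
  (forall t, t <= T -> is_derive y t (dy t)) ->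
  (forall t, t <= T -> d < y t -> dy t <= - k * y t ^ 2) ->
  forall t, t <= T -> y t <= d.
Proof.
move=> hk hd hder hric t0 ht0; apply: Rnot_lt_le => hlt.
have hbig t : t <= t0 -> d < y t.
  move=> ht; apply: Rlt_le_trans (hlt) _.
  apply: (@nonincr_above y dy t t0 d) => // s hs; first by apply: hder; lra.
  by move=> hs'; have := hric s ltac:(lra) hs'; nra.
pose s := t0 - (/ y t0) / k.
have hy0 : 0 < / y t0 by apply: Rinv_0_lt_compat; lra.
have hs : s <= t0.
  by rewrite /s; have : 0 < / y t0 / k; [apply: Rdiv_lt_0_compat | lra].
have key : / y s - k * s <= / y t0 - k * t0.
  apply: (@derive_ge0_le (fun t => / y t - k * t)
    (fun t => - dy t / y t ^ 2 - k) s t0 hs) => t ht.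
  - have h1 := hder t ltac:(lra); have h2 := hbig t ltac:(lra); der; [lra | ring].
  - have h1 := hric t ltac:(lra) (hbig t ltac:(lra)); have h2 := hbig t ltac:(lra).
    have h3 : 0 < y t ^ 2 by nra.
    have : k <= - dy t / y t ^ 2; last by lra.
    by apply/Rle_div_r => //; lra.
have h1 : 0 < / y s by apply: Rinv_0_lt_compat; have := hbig s hs; lra.
have : k * s = k * t0 - / y t0 by rewrite /s; field; split; [lra | lra].
lra.
Qed.

(** * Super-solutions in the viscosity sense *)

Definition growth (r u v : R) : R := u * (1 - r - u + r * v).

(** A test function comes with its derivatives as data, so that a solution of the profile system can
    serve as one, its equation giving [f2]. *)
Definition touches (f f1 : R -> R) (t f2 : R) (F : R -> R) : Prop :=
  locally t (fun s => is_derive f s (f1 s)) /\ is_derive f1 t f2 /\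
  locally t (fun s => f s <= F s) /\ f t = F t.

(* A super-solution in the viscosity sense: this form treats kinks and smooth
   points, and the conditions D2-D4, uniformly. *)
Record super (b r h c : R) (Phi Psi : R -> R) : Prop := Super {
  super_contl : forall t, continuous Phi t;
  super_contr : forall t, continuous Psi t;
  super_monol : forall s t, s <= t -> Phi s <= Phi t;
  super_monor : forall s t, s <= t -> Psi s <= Psi t;
  super_rangel : forall t, 0 < Phi t <= 1;
  super_ranger : forall t, 0 < Psi t <= 1;
  super_minfl : tends0 Phi;
  super_minfr : tends0 Psi;
  super_pinf : exists T, forall t, T <= t -> Phi t = 1 /\ Psi t = 1;
  super_phi : forall f f1 t f2, touches f f1 t f2 Phi -> Phi t < 1 ->
    f2 - c * f1 t + growth r (Phi t) (Psi t) < 0;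
  super_psi : forall f f1 t f2, touches f f1 t f2 Psi -> Psi t < 1 ->
    f2 - c * f1 t + b * Phi (t - c * h) * (1 - Psi t) < 0;
  super_exp : exists nu k T, 0 < nu /\ chi_lambda r c < nu < chi_mu r c /\ 0 < k /\
    forall t, t <= T -> k * exp (nu * t) <= Phi t /\ k * exp (nu * t) <= Psi t
}.

Lemma list_gap (D : list R) (d : R) :
  exists e, 0 < e /\ forall s, 0 < Rabs (s - d) < e -> ~ In s D.
Proof.
elim: D => [|x D [e [he IH]]]; first by exists 1; split; [lra | move=> s _ []].
case: (Req_dec x d) => [->|hx].
  exists e; split=> // s hs [hd|]; last exact: IH.
  by move: hs; rewrite hd Rminus_diag Rabs_R0; lra.
have hxd : 0 < Rabs (x - d) by apply: Rabs_pos_lt; lra.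
exists (Rmin e (Rabs (x - d))); split; first by apply: Rmin_pos.
have h1 := Rmin_l e (Rabs (x - d)); have h2 := Rmin_r e (Rabs (x - d)).
move=> s hs [hd|]; last by apply: IH; lra.
by move: hs; rewrite -hd; lra.
Qed.

Lemma piecewise_strict_increasing (f : R -> R) (D : list R) (a b : R) : a < b ->
  (forall t, a <= t <= b -> continuous f t) ->
  (forall t, a < t < b -> ~ In t D -> ex_derive f t /\ 0 < Derive f t) ->
  f a < f b.
Proof.
elim: D a b => [|x D IH] a b hab hc hd.
  have [t ht|t ht|t [ht e]] := @mvt f (Derive f) a b hab.
  - by apply: Derive_correct; apply: (proj1 (hd _ ht _)).
  - exact: hc.
  - by have := proj2 (hd t ht (fun x => x)); nra.
case: (classic (a < x < b)) => hx.
  apply: Rlt_trans (_ : f a < f x) _.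
    apply: IH => [|t ht|t ht ht']; first by lra.
    + by apply: hc; lra.
    + by apply: hd; [lra | move=> [e|//]; lra].
  apply: IH => [|t ht|t ht ht']; first by lra.
  + by apply: hc; lra.
  + by apply: hd; [lra | move=> [e|//]; lra].
apply: IH => // t ht ht'; apply: hd => // [[e|//]].
by apply: hx; lra.
Qed.

(** A function touching from below has slope at least the left and at most the right slope of [F].
    At a concave kink these are in the wrong order; [m1] and [m2] separate them strictly. *)
Lemma kink_not_touched (F g : R -> R) (d g1 e : R) : concave_kink F d ->
  0 < e -> (forall s, Rabs (s - d) < e -> continuous F s) ->
  (forall s, 0 < Rabs (s - d) < e -> ex_derive F s) ->
  is_derive g d g1 -> locally d (fun s => g s <= F s) -> g d = F d -> False.
Proof.
move=> [dl [dr [hl [hr hlr]]]] he hc hd hg hle hgF.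
pose m1 := (2 * dl + dr) / 3; pose m2 := (dl + 2 * dr) / 3.
have hm12 : dr < m2 /\ m2 < m1 /\ m1 < dl by rewrite /m1 /m2; lra.
have hl' : locally d (fun s => s < d -> m1 < Derive F s).
  by apply: (hl (fun y => m1 < y)); apply: open_gt; lra.
have hr' : locally d (fun s => d < s -> Derive F s < m2).
  by apply: (hr (fun y => y < m2)); apply: open_lt; lra.
have [e1 [he1 h1]] := proj1 (locally_ex _ _) (filter_and _ _ hle (filter_and _ _ hl' hr')).
have [q [hq0 [hq1 hq2]]] := exists_small he he1.
case: (Rlt_le_dec g1 m1) => hm.
- have [dd [hdp hdd]] := derive_slope (m := - m1) (derive_opp hg) ltac:(lra).
  have [s [hs [hs1 hs2]]] := exists_small hq0 hdp.
  have [t ht|t ht|x [hx ex]] := @mvt F (Derive F) (d - s) d ltac:(lra).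
  + by apply: Derive_correct; apply: hd; rewrite Rabs_left; lra.
  + by apply: hc; rewrite Rabs_left1; lra.
  have [_ [hx' _]] := h1 x ltac:(rewrite Rabs_left1; lra).
  have [hs' _] := h1 (d - s) ltac:(rewrite Rabs_left1; lra).
  have [_ hg'] := hdd s ltac:(lra).
  have : F d - F (d - s) > m1 * s by rewrite ex; nra.
  lra.
- have [dd [hdp hdd]] := derive_slope (m := m2) hg ltac:(lra).
  have [s [hs [hs1 hs2]]] := exists_small hq0 hdp.
  have [t ht|t ht|x [hx ex]] := @mvt F (Derive F) d (d + s) ltac:(lra).
  + by apply: Derive_correct; apply: hd; rewrite Rabs_pos_eq; lra.
  + by apply: hc; rewrite Rabs_pos_eq; lra.
  have [_ [_ hx']] := h1 x ltac:(rewrite Rabs_pos_eq; lra).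
  have [hs' _] := h1 (d + s) ltac:(rewrite Rabs_pos_eq; lra).
  have [hg' _] := hdd s ltac:(lra).
  have : F (d + s) - F d < m2 * s by rewrite ex; nra.
  lra.
Qed.

Lemma piecewise_trunc (f : R -> R) (D : list R) (T : R) :
  piecewise_increasing f D T ->
  (forall t, t <= T -> continuous f t) /\ (forall t, t <= T -> 0 < f t) /\
  (forall s t, s < t -> t <= T -> f s < f t).
Proof.
move=> [[O [_ [hO1 hO2]]] _].
have hc t : t <= T -> continuous f t by move=> ht; case: (hO2 _ (hO1 _ ht)).
split=> //; split=> [t ht|s t hst ht]; first by case: (hO2 _ (hO1 _ ht)) => _ [].
apply: (@piecewise_strict_increasing f D) => // [x hx|x hx hxD]; first by apply: hc; lra.
have [_ [_ /(_ hxD) [[h1 _] h2]]] := hO2 x (hO1 x ltac:(lra)); by split.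
Qed.

Lemma C2_near_derive (f : R -> R) (t : R) : C2_near f t ->
  locally t (fun s => is_derive f s (Derive f s)) /\
  is_derive (Derive f) t (Derive_n f 2 t).
Proof.
move=> h; split.
  by apply: filter_imp h => s [h1 _]; apply: Derive_correct.
have [_ [h2 _]] := locally_singleton _ _ h.
exact: Derive_correct.
Qed.

(* At a kink the smooth function cannot touch from below; at a smooth point the
   second derivative test applies. *)
Lemma piecewise_touch (f g g1 : R -> R) (D : list R) (T t g2 : R) :
  piecewise_increasing f D T -> t < T ->
  touches g g1 t g2 f -> ~ In t D /\ g1 t = Derive f t /\ g2 <= Derive_n f 2 t.
Proof.
move=> hp ht [hg1 [hg2 [hle heq]]].
have [hc [hpos _]] := piecewise_trunc hp.
have [hO [hk hC2]] := hp.
have htD : ~ In t D.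
  move=> hin; have [e [he hgap]] := list_gap D t.
  have [e' [h3 [h1 h2]]] := exists_small he (Rlt_Rminus _ _ ht).
  apply: (@kink_not_touched f g t (g1 t) e') => //.
  - exact: hk.
  - by move=> s /Rabs_def2 hs; apply: hc; lra.
  - move=> s hs.
    have hsT : s <= T by have /Rabs_def2 := proj2 hs; lra.
    have hsD : ~ In s D by apply: hgap; lra.
    by have [h _] := locally_singleton _ _ (hC2 s hsT hsD).
  - exact: (locally_singleton _ _ hg1).
have [hd1 hd2] := C2_near_derive (hC2 t ltac:(lra) htD).
split=> //.
have := @second_derivative_min (fun s => f s - g s) (fun s => Derive f s - g1 s) t
  (Derive_n f 2 t - g2).
case.
- by apply: filter_imp (filter_and _ _ hd1 hg1) => s [h1 h2]; apply: derive_minus.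
- exact: derive_minus.
- by apply: filter_imp hle => s hs; lra.
by lra.
Qed.

Lemma touches_ext (f f1 F G : R -> R) (t f2 : R) :
  locally t (fun s => F s = G s) -> touches f f1 t f2 F -> touches f f1 t f2 G.
Proof.
move=> h [h1 [h2 [h3 h4]]]; split=> //; split=> //; split.
  by apply: filter_imp (filter_and _ _ h h3) => s [<-].
by rewrite -(locally_singleton _ _ h).
Qed.

Lemma continuous_Rmin_comp (f : R -> R) (T t : R) :
  (forall s, s <= T -> continuous f s) -> continuous (fun s => f (Rmin s T)) t.
Proof.
move=> hc; apply: (@continuous_comp _ _ _ (fun s => Rmin s T) f); last first.
  by apply: hc; apply: Rmin_r.
apply: (continuous_ext (fun s => (s + T - Rabs (s - T)) / 2)).
  move=> s; rewrite /Rmin; case: Rle_dec => h; first by rewrite Rabs_left1; lra.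
  by rewrite Rabs_pos_eq; lra.
apply: (@continuous_scal_l _ _ _ (fun s => s + T - Rabs (s - T)) (/2)) => /=.
apply: continuous_minus.
  by apply: continuous_plus; [apply: continuous_id | apply: continuous_const].
apply: (continuous_comp (fun s => s - T) Rabs); last exact: continuous_Rabs.
by apply: continuous_minus; [apply: continuous_id | apply: continuous_const].
Qed.

Lemma is_lim_minf_tends0 (f : R -> R) : is_lim f m_infty 0 -> tends0 f.
Proof.
move=> h e he.
have [M hM] := proj2 (is_lim_spec _ _ _) h (mkposreal e he).
exists (M - 1) => t ht; have := hM t ltac:(lra); rewrite /= Rminus_0_r; lra.
Qed.

(* From D2, [c psi - psi'] has derivative at least a multiple of [exp (nu t)]; as
   [psi] stays bounded, so does [c psi], up to a factor. *)
Lemma exp_lower_bound (f f1 f2 : R -> R) (c nu k T : R) :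
  0 < c -> 0 < nu -> 0 < k ->
  (forall t, t <= T -> is_derive f t (f1 t) /\ is_derive f1 t (f2 t) /\
     0 < f t /\ 0 < f1 t /\ k * exp (nu * t) <= c * f1 t - f2 t) ->
  forall t, t <= T -> k / (c * nu) * exp (nu * t) <= f t.
Proof.
move=> hc hnu hk H t ht.
suff hA : k / nu * exp (nu * t) <= c * f t - f1 t.
  have [_ [_ [_ [h _]]]] := H t ht.
  apply: (Rmult_le_reg_l c) => //.
  have -> : c * (k / (c * nu) * exp (nu * t)) = k / nu * exp (nu * t) by field; lra.
  lra.
apply: Rnot_lt_le => hlt.
(* A deficit [eta] at [t] persists at all earlier times, since the difference is nondecreasing. Far
   to the left the exponential is negligible, so [f1 >= eta / 2] there and [f] would become
   negative. *)
set eta := k / nu * exp (nu * t) - (c * f t - f1 t).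
have heta : 0 < eta by rewrite /eta; lra.
have hmon s : s <= t -> c * f s - f1 s - k / nu * exp (nu * s) <= - eta.
  move=> hs.
  have : c * f s - f1 s - k / nu * exp (nu * s) <= c * f t - f1 t - k / nu * exp (nu * t).
    apply: (@derive_ge0_le (fun s => c * f s - f1 s - k / nu * exp (nu * s))
      (fun s => c * f1 s - f2 s - k * exp (nu * s)) s t hs) => x hx;
      have [h1 [h2 [h3 [h4 h5]]]] := H x ltac:(lra); last by lra.
    der; field; lra.
  rewrite /eta; lra.
have hk' : 0 < k / nu by apply: Rdiv_lt_0_compat.
have [T0 hT0] := tends0_exp hnu (e := eta / 2 / (k / nu)) ltac:(apply: Rdiv_lt_0_compat; lra).
pose s0 := Rmin t T0.
have hs0 : s0 <= t by apply: Rmin_l.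
have hs1 : s0 <= T0 by apply: Rmin_r.
have hder s : s <= s0 -> eta / 2 <= f1 s.
  move=> hs; have := hmon s ltac:(lra); have [_ [_ [h3 _]]] := H s ltac:(lra).
  have := Rmult_le_compat_l _ _ _ (Rlt_le _ _ hk') (Rle_trans _ _ _ (Rle_abs _) (hT0 s ltac:(lra))).
  have -> : k / nu * (eta / 2 / (k / nu)) = eta / 2 by field; lra.
  nra.
pose s := s0 - (f s0 + 1) / (eta / 2).
have hf0 : 0 < f s0 by have [_ [_ []]] := H s0 ltac:(lra).
have hs : s <= s0.
  by rewrite /s; have : 0 < (f s0 + 1) / (eta / 2); [apply: Rdiv_lt_0_compat; lra | lra].
have : f s - eta / 2 * s <= f s0 - eta / 2 * s0.
  apply: (@derive_ge0_le (fun s => f s - eta / 2 * s) (fun s => f1 s - eta / 2) s s0 hs)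
    => x hx.
  - have [h1 _] := H x ltac:(lra); der; ring.
  - by have := hder x ltac:(lra); lra.
have -> : eta / 2 * s = eta / 2 * s0 - (f s0 + 1) by rewrite /s; field; lra.
have [_ [_ [h _]]] := H s ltac:(lra).
lra.
Qed.

Lemma list_below (D : list R) : exists T, forall t, t <= T -> ~ In t D.
Proof.
elim: D => [|x D [T IH]]; first by exists 0 => t _ [].
exists (Rmin T (x - 1)) => t ht [h|]; last by apply: IH; have := Rmin_l T (x - 1); lra.
by have := Rmin_r T (x - 1); lra.
Qed.

Lemma trunc_mono (f : R -> R) (T : R) : (forall s t, s < t -> t <= T -> f s < f t) ->
  forall s t, s <= t -> f (Rmin s T) <= f (Rmin t T).
Proof.
move=> h s t hst.
have : Rmin s T <= Rmin t T by apply: Rle_min_compat_r.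
by case=> [h1|->]; [left; apply: h => //; apply: Rmin_r | right].
Qed.

(** Both functions are frozen once they reach 1. A touching condition with value below 1 then takes
    place strictly to the left of the freezing point, where D2 applies, or D3 or D4 if the other
    component is already frozen. *)
Lemma super_of_regular (b r h c : R) (psi phi : R -> R) :
  0 < b -> 0 < r <= 1 -> 0 <= h -> 0 < c ->
  regular_super_solution b r h c psi phi ->
  exists Phi Psi, super b r h c Phi Psi.
Proof.
move=> hb hr hh hc [t1 [t2 [D hS]]].
case: hS => hD hpsi hphi hpsi0 hphi0 hpsi1 hphi1 hmono hsm hD1 hD2 hD3 hD4.
have [cpsi [ppsi ipsi]] := piecewise_trunc hpsi.
have [cphi [pphi iphi]] := piecewise_trunc hphi.
have lpsi t : t <= t1 -> psi t <= 1.
  by case=> [ht|->]; [have := ipsi t t1 ht; lra | lra].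
have lphi t : t <= t2 -> phi t <= 1.
  by case=> [ht|->]; [have := iphi t t2 ht; lra | lra].
have mpsi t : psi (Rmin t t1) < 1 -> t < t1.
  by rewrite /Rmin; case: Rle_dec => h1 h2; last lra; case: h1 => // e; rewrite e in h2; lra.
have mphi t : phi (Rmin t t2) < 1 -> t < t2.
  by rewrite /Rmin; case: Rle_dec => h1 h2; last lra; case: h1 => // e; rewrite e in h2; lra.
have loc (f : R -> R) T t : t < T -> locally t (fun s => f (Rmin s T) = f s).
  move=> ht; apply/locally_ex; exists (T - t); split; first by lra.
  by move=> s /Rabs_def2 hs; rewrite Rmin_left //; lra.
have hch : 0 <= c * h by apply: Rmult_le_pos; lra.
exists (fun t => phi (Rmin t t2)), (fun t => psi (Rmin t t1)); split.
- by move=> t; apply: continuous_Rmin_comp.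
- by move=> t; apply: continuous_Rmin_comp.
- exact: trunc_mono.
- exact: trunc_mono.
- by move=> t; split; [apply: pphi | apply: lphi]; apply: Rmin_r.
- by move=> t; split; [apply: ppsi | apply: lpsi]; apply: Rmin_r.
- apply: tends0_bound (is_lim_minf_tends0 hphi0) => t ht.
  by rewrite Rmin_left; [right | exact: ht].
- apply: tends0_bound (is_lim_minf_tends0 hpsi0) => t ht.
  by rewrite Rmin_left; [right | exact: ht].
- exists (Rmax t1 t2) => t ht; have h1 := Rmax_l t1 t2; have h2 := Rmax_r t1 t2.
  by rewrite !Rmin_right; lra.
- move=> f f1 t f2 htouch hlt; have ht := mphi _ hlt.
  have htouch' := touches_ext (loc phi t2 t ht) htouch.
  have [htD [e1 e2]] := piecewise_touch hphi ht htouch'.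
  rewrite (Rmin_left t t2); last by lra.
  rewrite e1 /growth; case: (Rle_lt_dec t t1) => ht1.
    rewrite (Rmin_left t t1) //.
    have := proj1 (hD2 t ltac:(by apply: Rmin_glb; lra) htD); rewrite /profile_phi; lra.
  rewrite (Rmin_right t t1) ?hpsi1; last by lra.
  have := hD3 ltac:(lra) t ltac:(lra); lra.
- move=> f f1 t f2 htouch hlt; have ht := mpsi _ hlt.
  have htouch' := touches_ext (loc psi t1 t ht) htouch.
  have [htD [e1 e2]] := piecewise_touch hpsi ht htouch'.
  rewrite (Rmin_left t t1); last by lra.
  rewrite e1; case: (Rle_lt_dec t t2) => ht2.
    rewrite (Rmin_left (t - c * h) t2); last by lra.
    have := proj2 (hD2 t ltac:(by apply: Rmin_glb; lra) htD); rewrite /profile_psi; lra.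
  have := hD4 ltac:(lra) t ltac:(lra).
  have hR : phi (Rmin (t - c * h) t2) <= Rmin 1 (phi (t - c * h)).
    apply: Rmin_glb; first by apply: lphi; apply: Rmin_r.
    rewrite /Rmin; case: Rle_dec => h1; first by right.
    by left; apply: hmono; lra.
  have h1 : psi t <= 1 by apply: lpsi; lra.
  have : b * phi (Rmin (t - c * h) t2) * (1 - psi t)
     <= b * Rmin 1 (phi (t - c * h)) * (1 - psi t).
    by apply: Rmult_le_compat_r; [lra | apply: Rmult_le_compat_l; lra].
  lra.
case: hD1 => nu [m [C1 [hnu [hnu' [hm [hC1 [_ heq]]]]]]].
have [M hM] := heq 0%nat ltac:(lia) (mkposreal (1/2) ltac:(lra)).
have hlow t : t <= Rmin (M - 1) (- 1) -> t <= t2 -> C1 / 2 * exp (nu * t) <= phi t.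
  move=> ht ht2; have q1 := Rmin_l (M - 1) (- 1); have q2 := Rmin_r (M - 1) (- 1).
  have := hM t ltac:(lra); rewrite /norm /= /minus /plus /opp /= /abs /= Rmult_1_r.
  rewrite (Rabs_pos_eq (phi t)); last by have := pphi t ht2; lra.
  move=> /Rabs_le_between hb1; have hE := exp_pos (nu * t).
  have : 1 <= (- t) ^ m by case: hm => -> /=; lra.
  have : 0 < C1 * exp (nu * t) by apply: Rmult_lt_0_compat.
  nra.
have [TD hTD] := list_below D.
have [Tp hTp] := is_lim_minf_tends0 hpsi0 (e := 1/2) ltac:(lra).
pose T := Rmin (Rmin (Rmin (M - 1) (- 1)) TD) (Rmin Tp (Rmin t1 t2)).
have hT : T <= Rmin (M - 1) (- 1) /\ T <= TD /\ T <= Tp /\ T <= Rmin t1 t2 /\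
    T <= t1 /\ T <= t2.
  have := Rmin_l (Rmin (Rmin (M - 1) (- 1)) TD) (Rmin Tp (Rmin t1 t2)).
  have := Rmin_r (Rmin (Rmin (M - 1) (- 1)) TD) (Rmin Tp (Rmin t1 t2)).
  have := Rmin_l (Rmin (M - 1) (- 1)) TD; have := Rmin_r (Rmin (M - 1) (- 1)) TD.
  have := Rmin_l Tp (Rmin t1 t2); have := Rmin_r Tp (Rmin t1 t2).
  have := Rmin_l t1 t2; have := Rmin_r t1 t2.
  by rewrite -/T; lra.
(* D1 bounds [psi] from above only; the lower bound is extracted from D2. The constant bounds the
   source [b * phi (t - c * h) * (1 - psi t)] with [phi >= C1 / 2 * exp (nu * t)] and
   [1 - psi >= 1 / 2]. *)
pose k := b * (C1 / 4) * exp (- (nu * (c * h))).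
have hk : 0 < k.
  by apply: Rmult_lt_0_compat; [nra | apply: exp_pos].
have hcn : 0 < c * nu by nra.
exists nu, (Rmin (C1 / 2) (k / (c * nu))), T; do 2 split => //.
split; first by apply: Rmin_pos; [lra | apply: Rdiv_lt_0_compat].
move=> t ht; have hE := exp_pos (nu * t).
rewrite (Rmin_left t t2); last by lra.
rewrite (Rmin_left t t1); last by lra.
split.
  apply: Rle_trans (hlow t ltac:(lra) ltac:(lra)); apply: Rmult_le_compat_r; first by lra.
  exact: Rmin_l.
apply: Rle_trans (_ : k / (c * nu) * exp (nu * t) <= _).
  by apply: Rmult_le_compat_r; [lra | apply: Rmin_r].
have [[O [_ [hO1 hO2]]] [_ hC2]] := hpsi.
apply: (@exp_lower_bound psi (Derive psi) (Derive_n psi 2) c nu k T) => // s hs.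
have hsD := hTD s ltac:(lra).
have [hd1 hd2] := C2_near_derive (hC2 s ltac:(lra) hsD).
split; first exact: (locally_singleton _ _ hd1).
split=> //.
have [_ [hp /(_ hsD) [_ hp']]] := hO2 s (hO1 s ltac:(lra)).
do 2 split=> //.
have := proj2 (hD2 s ltac:(lra) hsD); rewrite /profile_psi.
have hl := hlow (s - c * h) ltac:(lra) ltac:(lra).
have := hTp s ltac:(lra); rewrite Rabs_pos_eq; last by lra.
have -> : k * exp (nu * s) = b * (1 / 2) * (C1 / 2 * exp (nu * (s - c * h))).
  have -> : nu * (s - c * h) = - (nu * (c * h)) + nu * s by ring.
  by rewrite exp_plus /k; field.
have hE' : 0 < C1 / 2 * exp (nu * (s - c * h)).
  by apply: Rmult_lt_0_compat; [lra | apply: exp_pos].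
move=> q1 q2.
have : b * (1 / 2) * (C1 / 2 * exp (nu * (s - c * h))) <= b * (1 - psi s) * phi (s - c * h).
  by apply: Rmult_le_compat; nra.
lra.
Qed.

(** * Limits along an ultrafilter *)

(** An ultrafilter on the natural numbers containing all tails. Bounded sequences converge along it,
    at all points [t] simultaneously, so no diagonal subsequence has to be extracted. *)
Record ultra (U : (nat -> Prop) -> Prop) : Prop := Ultra {
  ultra_and : forall P Q, U P -> U Q -> U (fun n => P n /\ Q n);
  ultra_imp : forall P Q : nat -> Prop, (forall n, P n -> Q n) -> U P -> U Q;
  ultra_tail : forall N : nat, U (fun n => Peano.le N n);
  ultra_ex : forall P, U P -> exists n, P n;
  ultra_dec : forall P, U P \/ U (fun n => ~ P n)
}.

Lemma ultra_exists : exists U, ultra U.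
Proof.
have [G [GU hG]] := filter.ultraFilterLemma filter.eventually_filter.
have PG := @filter.ultra_proper _ _ GU; have FG := @filter.filter_filter _ _ PG.
exists G; split.
- exact: (@filter.filterI _ _ FG).
- exact: (@filter.filterS _ _ FG).
- by move=> N; apply: hG; exists N => // n /= /leP.
- exact: (@filter.filter_ex _ _ PG).
- by move=> P; apply: filter.in_ultra_setVsetC.
Qed.

Definition ulim (U : (nat -> Prop) -> Prop) (x : nat -> R) (l : R) : Prop :=
  forall e, 0 < e -> U (fun n => Rabs (x n - l) < e).

Section UltraLimits.
Variables (U : (nat -> Prop) -> Prop) (hU : ultra U).

Lemma ultra_all (P : nat -> Prop) : (forall n, P n) -> U P.
Proof. by move=> h; apply: (ultra_imp hU) (ultra_tail hU 0) => n _. Qed.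

(** The limit is the supremum of those [y] that lie below [x n] for a large set of indices; the
    dichotomy [ultra_dec] turns failure of largeness into the reverse inequality on a large set. *)
Lemma ulim_exists (x : nat -> R) (A B : R) :
  U (fun n => A <= x n <= B) -> exists l, ulim U x l.
Proof.
move=> hAB.
pose E y := U (fun n => y <= x n).
have [l [hl1 hl2]] : {l | is_lub E l}.
  apply: completeness.
    exists B => y hy; apply: Rnot_lt_le => hlt.
    by have [n [[h1 h2] h3]] := ultra_ex hU (ultra_and hU hAB hy); lra.
  by exists A; apply: (ultra_imp hU) hAB => n [].
exists l => e he.
have h1 : U (fun n => x n < l + e).
  case: (ultra_dec hU (fun n => l + e <= x n)) => h; first by have := hl1 _ h; lra.
  by apply: (ultra_imp hU) h => n; lra.
have h2 : U (fun n => l - e < x n).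
  case: (ultra_dec hU (fun n => l - e < x n)) => // h.
  have : l <= l - e; last by lra.
  apply: hl2 => y hy; apply: Rnot_lt_le => hlt.
  by have [n [h3 h4]] := ultra_ex hU (ultra_and hU h hy); lra.
by apply: (ultra_imp hU) (ultra_and hU h1 h2) => n [? ?]; apply: Rabs_def1; lra.
Qed.

Lemma ulim_le (x y : nat -> R) (l m : R) :
  ulim U x l -> ulim U y m -> U (fun n => x n <= y n) -> l <= m.
Proof.
move=> hx hy hxy; apply: Rnot_lt_le => hlt.
have he : 0 < (l - m) / 2 by lra.
have [n [h1 [/Rabs_def2 h2 /Rabs_def2 h3]]] :=
  ultra_ex hU (ultra_and hU hxy (ultra_and hU (hx _ he) (hy _ he))); lra.
Qed.

Lemma ulim_const (a : R) : ulim U (fun _ => a) a.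
Proof. by move=> e he; apply: ultra_all => n; rewrite Rminus_diag Rabs_R0. Qed.

Lemma ulim_ge (x : nat -> R) (l a : R) : ulim U x l -> U (fun n => a <= x n) -> a <= l.
Proof. exact: ulim_le (ulim_const a). Qed.

Lemma ulim_le_const (x : nat -> R) (l a : R) :
  ulim U x l -> U (fun n => x n <= a) -> l <= a.
Proof. by move=> h; apply: ulim_le h (ulim_const a). Qed.

Lemma ulim_unique (x : nat -> R) (l m : R) : ulim U x l -> ulim U x m -> l = m.
Proof.
by move=> h1 h2; apply: Rle_antisym; apply: (ulim_le (x := x) (y := x)) => //;
  apply: ultra_all => n; right.
Qed.

Lemma ulim_ext (x y : nat -> R) (l : R) :
  U (fun n => x n = y n) -> ulim U x l -> ulim U y l.
Proof.
by move=> h hx e he; apply: (ultra_imp hU) (ultra_and hU h (hx e he)) => n [<-].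
Qed.

Lemma ulim_filterlim (x : nat -> R) (l : R) : ulim U x l <-> filterlim x U (locally l).
Proof.
split=> [h P [d hd]|h e he]; first by apply: (ultra_imp hU) (h d (cond_pos d)) => n; apply: hd.
exact: h (locally_ball l (mkposreal e he)).
Qed.

Let FU : Filter U.
Proof.
by split; [apply: ultra_all | apply: (ultra_and hU) | apply: (ultra_imp hU)].
Qed.

Lemma ulim_plus (x y : nat -> R) (l m : R) :
  ulim U x l -> ulim U y m -> ulim U (fun n => x n + y n) (l + m).
Proof.
by rewrite !ulim_filterlim => hx hy; apply: filterlim_comp_2 hx hy (@filterlim_plus _ R_NormedModule l m).
Qed.

Lemma ulim_continuous (f : R -> R) (x : nat -> R) (l : R) :
  continuous f l -> ulim U x l -> ulim U (fun n => f (x n)) (f l).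
Proof. by rewrite !ulim_filterlim => hf hx; apply: filterlim_comp hx hf. Qed.

Lemma ulim_scal (a : R) (x : nat -> R) (l : R) :
  ulim U x l -> ulim U (fun n => a * x n) (a * l).
Proof. by apply: ulim_continuous; apply: (@filterlim_scal_r _ R_NormedModule). Qed.

Lemma ulim_opp (x : nat -> R) (l : R) : ulim U x l -> ulim U (fun n => - x n) (- l).
Proof. by apply: ulim_continuous; apply: (@filterlim_opp _ R_NormedModule). Qed.

Lemma ulim_minus (x y : nat -> R) (l m : R) :
  ulim U x l -> ulim U y m -> ulim U (fun n => x n - y n) (l - m).
Proof. by move=> hx hy; apply: ulim_plus hx (ulim_opp hy). Qed.

Lemma ulim_mult (x y : nat -> R) (l m : R) :
  ulim U x l -> ulim U y m -> ulim U (fun n => x n * y n) (l * m).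
Proof.
by rewrite !ulim_filterlim => hx hy; apply: filterlim_comp_2 hx hy (@filterlim_mult R_AbsRing l m).
Qed.

Lemma ulim_abs_le (x : nat -> R) (l a : R) :
  ulim U x l -> U (fun n => Rabs (x n) <= a) -> Rabs l <= a.
Proof.
move=> hx h; apply: Rabs_le; split.
  by apply: ulim_ge hx _; apply: (ultra_imp hU) h => n /Rabs_le_between [].
by apply: ulim_le_const hx _; apply: (ultra_imp hU) h => n /Rabs_le_between [].
Qed.

(* Equi-Lipschitz derivatives make first-order Taylor remainders uniform, so that
   they survive a pointwise limit. *)
Lemma ulim_derive (u v : nat -> R -> R) (ul vl : R -> R) (a b M : R) :
  U (fun n => forall t, a < t < b -> is_derive (u n) t (v n t)) ->
  U (fun n => forall s t, a < s < b -> a < t < b -> Rabs (v n s - v n t) <= M * Rabs (s - t)) ->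
  (forall t, a < t < b -> ulim U (fun n => u n t) (ul t)) ->
  (forall t, a < t < b -> ulim U (fun n => v n t) (vl t)) ->
  forall t, a < t < b -> is_derive ul t (vl t).
Proof.
move=> hder hlip hu hv t ht; apply/is_derive_Reals => e he.
have hM := Rabs_pos M.
pose d := Rmin (Rmin (t - a) (b - t)) (e / (Rabs M + 1)).
have hd0 : 0 < e / (Rabs M + 1) by apply: Rdiv_lt_0_compat; lra.
have hd : 0 < d by apply: Rmin_pos => //; apply: Rmin_pos; lra.
have d1 : d <= t - a by apply: Rle_trans (Rmin_l _ _) (Rmin_l _ _).
have d2 : d <= b - t by apply: Rle_trans (Rmin_l _ _) (Rmin_r _ _).
have d3 : d <= e / (Rabs M + 1) by apply: Rmin_r.
exists (mkposreal d hd) => h hh0 /= hh.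
have [k1 k2] := Rabs_def2 _ _ hh.
have hth : a < t + h < b by lra.
have hah : 0 < Rabs h by apply: Rabs_pos_lt.
have key : Rabs (ul (t + h) - ul t - h * vl t) <= Rabs M * Rabs h * Rabs h.
  apply: (ulim_abs_le (x := fun n => u n (t + h) - u n t - h * v n t)).
    apply: ulim_minus; first by apply: ulim_minus; apply: hu.
    by apply: ulim_scal; apply: hv.
  apply: (ultra_imp hU) (ultra_and hU hder hlip) => n [hn1 hn2].
  have hxy x : Rmin t (t + h) <= x <= Rmax t (t + h) -> a < x < b /\ Rabs (x - t) <= Rabs h.
    rewrite /Rmin /Rmax; case: Rle_dec => h0 hx; split; try lra.
      by rewrite !Rabs_pos_eq; lra.
    by rewrite !Rabs_left1; lra.
  have [x hx|x hx|x [/hxy [hx hxt] ->]] := MVT_gen (u n) t (t + h) (v n).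
  + by apply: hn1; apply: (proj1 (hxy _ _)); lra.
  + apply/continuity_pt_filterlim; apply: (@derive_continuous _ _ (v n x)); apply: hn1.
    exact: (proj1 (hxy _ hx)).
  have -> : t + h - t = h by ring.
  have -> : v n x * h - h * v n t = (v n x - v n t) * h by ring.
  rewrite Rabs_mult; apply: Rmult_le_compat_r; first by apply: Rabs_pos.
  apply: Rle_trans (hn2 x t ltac:(lra) ht) _.
  have := Rle_abs M; have := Rabs_pos (x - t); nra.
have -> : (ul (t + h) - ul t) / h - vl t = (ul (t + h) - ul t - h * vl t) / h by field.
rewrite Rabs_div //; apply/Rlt_div_l => //.
apply: Rle_lt_trans key _.
apply: Rmult_lt_compat_r => //.
have e1 : e = (Rabs M + 1) * (e / (Rabs M + 1)) by field; lra.
nra.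
Qed.

End UltraLimits.

(** * Monotone solutions on bounded intervals *)

(** Variation of constants: [z1] and [z2] are the roots of [z ^ 2 = c * z + K], [up] is the
    particular solution vanishing at [a], and [P], [Q] fit the boundary values. *)
Lemma linear_bvp (c K a B al be : R) (F : R -> R) : 0 < K -> a < B ->
  (forall t, continuous F t) ->
  exists u u1 : R -> R, (forall t, is_derive u t (u1 t)) /\
    (forall t, is_derive u1 t (c * u1 t + K * u t - F t)) /\ u a = al /\ u B = be.
Proof.
move=> hK haB hF.
have hdisc : 0 < c ^ 2 + 4 * K by nra.
pose sq := sqrt (c ^ 2 + 4 * K).
have hsq : 0 < sq by apply: sqrt_lt_R0.
have hsq2 : sq * sq = c ^ 2 + 4 * K by apply: sqrt_sqrt; lra.
pose z1 := (c - sq) / 2; pose z2 := (c + sq) / 2.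
have hz1 : z1 * z1 = c * z1 + K by rewrite /z1; nra.
have hz2 : z2 * z2 = c * z2 + K by rewrite /z2; nra.
have hz : z2 - z1 = sq by rewrite /z1 /z2; field.
pose I (z t : R) : R := RInt (fun s => exp (- z * s) * F s) a t.
have hc z s : continuous (fun s => exp (- z * s) * F s) s.
  apply: (@continuous_mult _ _ (fun s => exp (- z * s)) F) => //.
  by apply: (derive_continuous (a := - z * exp (- z * s))); der; ring.
have hI z t : is_derive (I z) t (exp (- z * t) * F t).
  apply: (@is_derive_RInt _ (fun s => exp (- z * s) * F s) (I z) a t) => //.
  apply: filter_forall => s; apply: RInt_correct; apply: ex_RInt_continuous => x _.
  exact: hc.
have hI0 z : I z a = 0 by apply: RInt_point.
pose up t := - (exp (z2 * t) * I z2 t - exp (z1 * t) * I z1 t) / sq.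
pose e1 := exp (z1 * (B - a)); pose e2 := exp (z2 * (B - a)).
have he : e1 < e2 by apply: exp_increasing; apply: Rmult_lt_compat_r; lra.
pose Q := (be - up B - al * e1) / (e2 - e1); pose P := al - Q.
pose u t := P * exp (z1 * (t - a)) + Q * exp (z2 * (t - a)) + up t.
pose u1 t := z1 * P * exp (z1 * (t - a)) + z2 * Q * exp (z2 * (t - a))
   - (z2 * (exp (z2 * t) * I z2 t) - z1 * (exp (z1 * t) * I z1 t)) / sq.
have hEF z t : exp (z * t) * (exp (- z * t) * F t) = F t.
  rewrite -Rmult_assoc -exp_plus; have -> : z * t + - z * t = 0 by ring.
  by rewrite exp_0; ring.
exists u, u1; split; [|split; [|split]].
- move=> t.
  rewrite /u /up /Rdiv; der.
  by rewrite /u1 !hEF; field; lra.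
- move=> t.
  rewrite /u1 /Rdiv; der.
  rewrite /u /up !hEF.
  transitivity (z1 * z1 * P * exp (z1 * (t - a)) + z2 * z2 * Q * exp (z2 * (t - a))
    - (z2 * z2 * (exp (z2 * t) * I z2 t) - z1 * z1 * (exp (z1 * t) * I z1 t)) / sq
    - (z2 - z1) * F t / sq); first by field; lra.
  rewrite hz1 hz2 hz; field; lra.
- rewrite /u /up !hI0 Rminus_diag !Rmult_0_r exp_0 /P.
  by field; lra.
- rewrite /u -/e1 -/e2 /P; have -> : up B = be - al * e1 - Q * (e2 - e1).
    by rewrite /Q; field; lra.
  ring.
Qed.

Lemma interior_min (w : R -> R) (a B t : R) : a <= t <= B ->
  (forall s, a <= s <= B -> continuous w s) -> 0 <= w a -> 0 <= w B -> w t < 0 ->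
  exists s, a < s < B /\ w s < 0 /\ forall x, a <= x <= B -> w s <= w x.
Proof.
move=> ht hc ha hB hneg.
have [|s hs] := @continuity_ab_min w a B ltac:(lra).
  by move=> x hx; apply/continuity_pt_filterlim; apply: hc.
case: hs => hs1 hs2; have hlt : w s < 0 by have := hs1 t ht; lra.
exists s; split; last by split.
by split; apply: Rnot_le_lt => hle; [have e : s = a by lra | have e : s = B by lra];
  rewrite e in hlt; lra.
Qed.

Lemma locally_open (a B t : R) : a < t < B -> locally t (fun s => a < s < B).
Proof.
by move=> [h1 h2]; apply: filter_and; [apply: open_gt | apply: open_lt].
Qed.

Lemma max_principle (w w1 w2 : R -> R) (c K a B : R) : 0 < K ->
  (forall s, a <= s <= B -> continuous w s) -> 0 <= w a -> 0 <= w B ->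
  (forall s, a < s < B -> is_derive w s (w1 s)) ->
  (forall s, a < s < B -> is_derive w1 s (w2 s)) ->
  (forall s, a < s < B -> w2 s - c * w1 s - K * w s <= 0) ->
  forall t, a <= t <= B -> 0 <= w t.
Proof.
move=> hK hc ha hB h1 h2 hineq t ht; apply: Rnot_lt_le => hneg.
have [s [hs [hs1 hs2]]] := interior_min ht hc ha hB hneg.
have hloc := locally_open hs.
have := @second_derivative_min w w1 s (w2 s).
case.
- by apply: filter_imp hloc => x; apply: h1.
- exact: h2.
- by apply: filter_imp hloc => x hx; apply: hs2; lra.
by move=> e h; have := hineq s hs; rewrite e; nra.
Qed.

Definition clamp (a B t : R) : R := Rmin (Rmax a t) B.

Lemma clamp_range (a B t : R) : a <= B -> a <= clamp a B t <= B.
Proof.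
move=> h; split; last exact: Rmin_r.
by apply: Rmin_glb => //; apply: Rmax_l.
Qed.

Lemma clamp_id (a B t : R) : a <= t <= B -> clamp a B t = t.
Proof. by move=> h; rewrite /clamp Rmax_right; [rewrite Rmin_left; lra | lra]. Qed.

Lemma clamp_left (a B t : R) : a <= B -> t <= a -> clamp a B t = a.
Proof. by move=> h ht; rewrite /clamp Rmax_left; [rewrite Rmin_left; lra | lra]. Qed.

Lemma clamp_right (a B t : R) : a <= B -> B <= t -> clamp a B t = B.
Proof. by move=> h ht; rewrite /clamp Rmax_right; [rewrite Rmin_right; lra | lra]. Qed.

Lemma clamp_lip (a B s t : R) : a <= B -> s <= t ->
  0 <= clamp a B t - clamp a B s <= t - s.
Proof.
move=> h hst; rewrite /clamp /Rmax; case: (Rle_dec a t) => ?; case: (Rle_dec a s) => ?; rewrite /Rmin;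
  repeat (case: Rle_dec => ?); lra.
Qed.

(** Range, monotonicity and the Lipschitz constant all pass to pointwise limits, and the constants
    do not change along the iteration. *)
Record ramp (k M : R) (u : R -> R) : Prop := Ramp {
  ramp_range : forall t, k <= u t <= 1;
  ramp_lip : forall s t, s <= t -> 0 <= u t - u s <= M * (t - s)
}.

Lemma ramp_unit (k M : R) (u : R -> R) : 0 <= k -> ramp k M u -> forall t, 0 <= u t <= 1.
Proof. by move=> hk hu t; have := ramp_range hu t; lra. Qed.

Lemma ramp_mono (k M : R) (u : R -> R) : ramp k M u -> forall s t, s <= t -> u s <= u t.
Proof. by move=> hu s t hst; have := ramp_lip hu hst; lra. Qed.

Lemma ramp_abs (k M : R) (u : R -> R) (s t : R) : ramp k M u ->
  Rabs (u s - u t) <= M * Rabs (s - t).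
Proof.
move=> hu; case: (Rle_lt_dec s t) => hst.
  have hl := ramp_lip hu hst; rewrite (Rabs_left1 (s - t)) ?(Rabs_left1 (u s - u t)); lra.
have hl := ramp_lip hu (Rlt_le _ _ hst).
by rewrite (Rabs_pos_eq (s - t)) ?(Rabs_pos_eq (u s - u t)); lra.
Qed.

Lemma ramp_continuous (k M : R) (u : R -> R) (t : R) : ramp k M u -> continuous u t.
Proof.
move=> hu P [e he]; have hM := Rabs_pos M.
have hd : 0 < e / (Rabs M + 1) by apply: Rdiv_lt_0_compat; [apply: cond_pos | lra].
exists (mkposreal _ hd) => s hs; apply: he; change (Rabs (u s - u t) < e).
have {}hs : Rabs (s - t) < e / (Rabs M + 1) by [].
have e1 : e = (Rabs M + 1) * (e / (Rabs M + 1)) :> R by field; lra.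
rewrite e1; have := ramp_abs s t hu; have := Rle_abs M; have := Rabs_pos (s - t); nra.
Qed.

Record bvp_solution (c K a B k : R) (F u u1 : R -> R) : Prop := BvpSolution {
  bvp_ramp : ramp k (1 + K + c) u;
  bvp_left : forall t, t <= a -> u t = k;
  bvp_right : forall t, B <= t -> u t = 1;
  bvp_d1 : forall t, a < t < B -> is_derive u t (u1 t);
  bvp_d2 : forall t, a < t < B -> is_derive u1 t (c * u1 t + K * u t - F t);
  bvp_u1 : forall t, a < t < B -> 0 <= u1 t <= 1 + K + c
}.

Lemma derive_of_nondecreasing (u : R -> R) (a B t l : R) : a < t < B ->
  (forall x y, a < x -> x <= y -> y < B -> u x <= u y) -> is_derive u t l -> 0 <= l.
Proof.
move=> ht hm hd; apply: Rnot_lt_le => hl.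
have [e [he hs]] := derive_slope (m := 0) (derive_opp hd) ltac:(lra).
have [s [h1 [h2 h3]]] := exists_small he (Rlt_Rminus _ _ (proj2 ht)).
by have [h _] := hs s ltac:(lra); have := hm t (t + s) ltac:(lra) ltac:(lra) ltac:(lra); lra.
Qed.

(** The bounds on [F] make the constants [k] and 1 a sub- and a super-solution. Monotonicity follows
    from the maximum principle for [v (x + d) - v x], nonnegative at both ends because [v] stays
    between its boundary values. The length 2 leaves a unit interval on one side of every point. *)
Lemma bvp_exists (c K a B k : R) (F : R -> R) : 0 < c -> 0 < K -> 0 <= k < 1 -> a + 2 <= B ->
  (forall t, continuous F t) -> (forall s t, s <= t -> F s <= F t) ->
  (forall t, K * k <= F t <= K) ->
  exists p : (R -> R) * (R -> R), bvp_solution c K a B k F p.1 p.2.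
Proof.
move=> hc hK hk haB cF mF rF.
have haB1 : a < B by lra.
have [v [v1 [hv1 [hv2 [hva hvB]]]]] := linear_bvp c k 1 hK haB1 cF.
have cv t : continuous v t := derive_continuous (hv1 t).
have lo t : a <= t <= B -> k <= v t.
  suff h : forall t, a <= t <= B -> 0 <= v t - k by move=> ht; have := h t ht; lra.
  apply: (@max_principle (fun t => v t - k) v1 (fun t => c * v1 t + K * v t - F t) c K)
    => //; try lra.
  - move=> s hs; apply: (derive_continuous (a := v1 s - 0)).
    by apply: derive_minus => //; apply: derive_const.
  - by move=> s hs; der; ring.
  - by move=> s hs; have := rF s; lra.
have hi t : a <= t <= B -> v t <= 1.
  suff h : forall t, a <= t <= B -> 0 <= 1 - v t by move=> ht; have := h t ht; lra.
  apply: (@max_principle (fun t => 1 - v t) (fun t => - v1 t)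
     (fun t => - (c * v1 t + K * v t - F t)) c K) => //; try lra.
  - move=> s hs; apply: (derive_continuous (a := 0 - v1 s)).
    by apply: derive_minus => //; apply: derive_const.
  - by move=> s hs; der; ring.
  - by move=> s hs; der; ring.
  - by move=> s hs; have := rF s; lra.
have mono s t : a <= s -> s <= t -> t <= B -> v s <= v t.
  move=> has hst htB.
  pose d := t - s.
  suff h : forall x, a <= x <= B - d -> 0 <= v (x + d) - v x.
    have := h s ltac:(rewrite /d; lra); have -> : s + d = t by rewrite /d; ring.
    lra.
  have d1 x : is_derive (fun x => v (x + d) - v x) x (v1 (x + d) - v1 x).
    by der.
  apply: (@max_principle _ (fun x => v1 (x + d) - v1 x)
    (fun x => (c * v1 (x + d) + K * v (x + d) - F (x + d)) - (c * v1 x + K * v x - F x)) c K)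
    => //.
  - by move=> x hx; apply: derive_continuous (d1 x).
  - by have := lo (a + d) ltac:(rewrite /d; lra); lra.
  - have -> : B - d + d = B by ring.
    by have := hi (B - d) ltac:(rewrite /d; lra); lra.
  - by move=> x hx; der.
  - move=> x hx; have := mF x (x + d) ltac:(rewrite /d; lra); lra.
have v1pos t : a < t < B -> 0 <= v1 t.
  move=> ht; apply: (derive_of_nondecreasing ht _ (hv1 t)) => x y h1 h2 h3.
  by apply: mono; lra.
(* [v1 - c v] varies by at most K over a unit interval, and [v1] is at most 1
   somewhere in it. *)
have v1bd t : a < t < B -> v1 t <= 1 + K + c.
  move=> ht.
  have key x y : a <= x -> x <= y -> y <= B -> y <= x + 1 ->
      Rabs ((v1 y - c * v y) - (v1 x - c * v x)) <= K.
    move=> h1 h2 h3 h4.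
    have := @derive_abs_le (fun t => v1 t - c * v t) (fun t => K * v t - F t) x y K h2.
    move=> h; apply: Rle_trans (h _ _) _.
    + by move=> z hz; der; ring.
    + move=> z hz; have q1 := rF z; have q2 := lo z ltac:(lra); have q3 := hi z ltac:(lra).
      apply: Rabs_le; split; nra.
    + nra.
  case: (Rle_lt_dec (t + 1) B) => h1.
    have [x hx|x [hx ex]] := @mvt_le v v1 t (t + 1) ltac:(lra); first exact: hv1.
    have := key t x ltac:(lra) ltac:(lra) ltac:(lra) ltac:(lra).
    move=> /Rabs_le_between.
    have q1 := lo t ltac:(lra); have q2 := hi t ltac:(lra).
    have q3 := lo x ltac:(lra); have q5 := hi (t + 1) ltac:(lra).
    nra.
  have [x hx|x [hx ex]] := @mvt_le v v1 (t - 1) t ltac:(lra); first exact: hv1.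
  have := key x t ltac:(lra) ltac:(lra) ltac:(lra) ltac:(lra).
  move=> /Rabs_le_between.
  have q2 := hi t ltac:(lra).
  have q3 := lo x ltac:(lra); have q5 := lo (t - 1) ltac:(lra).
  nra.
have haB' : a <= B by lra.
(* Extension by the boundary values: the delayed argument may fall to the left of [a]. *)
pose u t := v (clamp a B t).
have heq t : a < t < B -> locally t (fun s => v s = u s).
  move=> ht; apply: filter_imp (locally_open ht) => s hs.
  by rewrite /u clamp_id //; lra.
exists (u, v1); split => /=.
- split=> [t|s t hst].
    by have h := clamp_range t haB'; split; [apply: lo | apply: hi].
  have h1 := clamp_range s haB'; have h2 := clamp_range t haB'.
  have h3 := clamp_lip haB' hst.
  rewrite /u; split; first by have := mono (clamp a B s) (clamp a B t); lra.
  case: (Req_dec (clamp a B s) (clamp a B t)) => [->|hne].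
    by rewrite Rminus_diag; apply: Rmult_le_pos; lra.
  have [x hx|x hx|x [hx ->]] := @mvt v v1 (clamp a B s) (clamp a B t) ltac:(lra).
  + exact: hv1.
  + exact: cv.
  have q1 := v1bd x ltac:(lra); have q2 := v1pos x ltac:(lra).
  by apply: Rmult_le_compat; lra.
- by move=> t ht; rewrite /u clamp_left.
- by move=> t ht; rewrite /u clamp_right.
- by move=> t ht; apply: (is_derive_ext_loc v); [apply: heq | apply: hv1].
- by move=> t ht; rewrite -(locally_singleton _ _ (heq t ht)); apply: hv2.
- by move=> t ht; split; [apply: v1pos | apply: v1bd].
Qed.

Lemma bvp_continuous (c K a B k : R) (F u u1 : R -> R) (t : R) :
  bvp_solution c K a B k F u u1 -> continuous u t.
Proof. by move=> /bvp_ramp; apply: ramp_continuous. Qed.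

Lemma bvp_compare (c K a B k : R) (F G u u1 v v1 : R -> R) : 0 < K -> a < B ->
  bvp_solution c K a B k F u u1 -> bvp_solution c K a B k G v v1 ->
  (forall t, F t <= G t) -> forall t, u t <= v t.
Proof.
move=> hK haB hu hv hFG t.
case: (Rle_lt_dec t a) => h1; first by rewrite (bvp_left hu h1) (bvp_left hv h1); lra.
case: (Rle_lt_dec B t) => h2; first by rewrite (bvp_right hu h2) (bvp_right hv h2); lra.
suff h : forall t, a <= t <= B -> 0 <= v t - u t by have := h t ltac:(lra); lra.
apply: (@max_principle _ (fun t => v1 t - u1 t)
  (fun t => (c * v1 t + K * v t - G t) - (c * u1 t + K * u t - F t)) c K) => //.
- by move=> s hs; apply: (@continuous_minus _ _ _ v u); apply: bvp_continuous; eassumption.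
- by rewrite (bvp_left hu) ?(bvp_left hv); lra.
- by rewrite (bvp_right hu) ?(bvp_right hv); lra.
- by move=> s hs; apply: derive_minus; [apply: (bvp_d1 hv) | apply: (bvp_d1 hu)].
- by move=> s hs; apply: derive_minus; [apply: (bvp_d2 hv) | apply: (bvp_d2 hu)].
- by move=> s hs; have := hFG s; lra.
Qed.

(** At a negative minimum of [S - u] the function [u], lowered by that amount, touches [S] from
    below, and [S < 1] there because [u <= 1]. The inequality for [S] then contradicts the equation
    of [u], as [K * (S - u)] is negative. *)
Lemma bvp_below_super (c K a B k : R) (F u u1 S H : R -> R) : 0 < K -> a < B ->
  bvp_solution c K a B k F u u1 ->
  (forall t, continuous S t) -> k <= S a -> S B = 1 ->
  (forall f f1 t f2, touches f f1 t f2 S -> S t < 1 -> f2 - c * f1 t + H t < 0) ->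
  (forall t, a < t < B -> F t <= K * S t + H t) ->
  forall t, a <= t <= B -> u t <= S t.
Proof.
move=> hK haB hu cS hSa hSB hS hF t ht; apply: Rnot_lt_le => hlt.
have [||||s [hs [hs1 hs2]]] := @interior_min (fun t => S t - u t) a B t ht.
- by move=> s hs; apply: (@continuous_minus _ _ _ S u) => //; apply: bvp_continuous; eassumption.
- by rewrite (bvp_left hu); lra.
- by rewrite (bvp_right hu); lra.
- lra.
pose m := S s - u s.
have hloc := locally_open hs.
have hSs : S s < 1 by have := proj2 (ramp_range (bvp_ramp hu) s); lra.
have := hS (fun x => u x + m) u1 s (c * u1 s + K * u s - F s) _ hSs.
have := hF s hs; rewrite -/m in hs1 *.
have e : S s = u s + m by rewrite /m; ring.
move=> q1 q2; have := q2 _.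
have {}q2 : touches (fun x => u x + m) u1 s (c * u1 s + K * u s - F s) S.
  split; [|split; [|split]].
  - apply: filter_imp hloc => x hx; have := bvp_d1 hu hx => h; der; ring.
  - exact: (bvp_d2 hu).
  - by apply: filter_imp hloc => x hx; have := hs2 x; rewrite /m; lra.
  - by rewrite e.
move=> /(_ q2); rewrite e in q1; nra.
Qed.

(** * Passage to the limit in the wave system *)

Lemma lipschitz_of_derive (f f1 : R -> R) (a b K : R) :
  (forall t, a < t < b -> is_derive f t (f1 t)) ->
  (forall t, a < t < b -> Rabs (f1 t) <= K) ->
  forall s t, a < s < b -> a < t < b -> Rabs (f s - f t) <= K * Rabs (s - t).
Proof.
move=> hd hK s t hs ht.
case: (Rle_lt_dec s t) => hst.
  rewrite Rabs_minus_sym (Rabs_left1 (s - t)); last by lra.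
  rewrite Ropp_minus_distr.
  by apply: (@derive_abs_le f f1) => // x hx; [apply: hd | apply: hK]; lra.
rewrite (Rabs_pos_eq (s - t)); last by lra.
by apply: (@derive_abs_le f f1) => // [|x hx|x hx]; [lra | apply: hd | apply: hK]; lra.
Qed.

Lemma ulim_second_order (U : (nat -> Prop) -> Prop) (hU : ultra U)
  (u u1 E : nat -> R -> R) (ul u1l El : R -> R) (a b c M N : R) : 0 < c ->
  U (fun n => forall t, a < t < b -> is_derive (u n) t (u1 n t) /\
    is_derive (u1 n) t (c * u1 n t + E n t) /\ 0 <= u1 n t <= M /\ Rabs (E n t) <= N) ->
  U (fun n => forall s t, a < s < b -> a < t < b ->
    Rabs (E n s - E n t) <= N * Rabs (s - t)) ->
  (forall t, a < t < b -> ulim U (fun n => u n t) (ul t)) ->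
  (forall t, a < t < b -> ulim U (fun n => E n t) (El t)) ->
  (forall t, a < t < b -> ulim U (fun n => u1 n t) (u1l t)) ->
  forall t, a < t < b -> is_derive ul t (u1l t) /\ is_derive u1l t (c * u1l t + El t) /\ 0 <= u1l t <= M.
Proof.
move=> hc h1 h2 hu hE hu1.
have lip1 n : (forall t, a < t < b -> is_derive (u n) t (u1 n t) /\
    is_derive (u1 n) t (c * u1 n t + E n t) /\ 0 <= u1 n t <= M /\ Rabs (E n t) <= N) ->
  forall s t, a < s < b -> a < t < b -> Rabs (u1 n s - u1 n t) <= (c * M + N) * Rabs (s - t).
  move=> hn; apply: (@lipschitz_of_derive _ (fun t => c * u1 n t + E n t)).
    by move=> t ht; have [_ []] := hn t ht.
  move=> t /hn [_ [_ [q1 /Rabs_le_between q2]]]; apply: Rabs_le; nra.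
move=> t ht; split; [|split; [|split]].
- apply: (ulim_derive hU (u := u) (v := u1) (a := a) (b := b) (M := c * M + N)) => //.
    by apply: (ultra_imp hU) h1 => n hn s hs; case: (hn s hs).
  by apply: (ultra_imp hU) h1 => n; apply: lip1.
- apply: (ulim_derive hU (u := u1) (v := fun n t => c * u1 n t + E n t)
    (vl := fun t => c * u1l t + El t) (a := a) (b := b) (M := c * (c * M + N) + N)) => //.
  + by apply: (ultra_imp hU) h1 => n hn s hs; case: (hn s hs) => _ [].
  + apply: (ultra_imp hU) (ultra_and hU h1 h2) => n [hn hE'] s x hs hx.
    have := lip1 n hn s x hs hx; have := hE' s x hs hx.
    have -> : c * u1 n s + E n s - (c * u1 n x + E n x)
       = c * (u1 n s - u1 n x) + (E n s - E n x) by ring.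
    have := Rabs_triang (c * (u1 n s - u1 n x)) (E n s - E n x).
    rewrite Rabs_mult (Rabs_pos_eq c); last by lra.
    move=> q1 q2 q3; nra.
  + move=> s hs; apply: ulim_plus => //; last exact: hE.
    by apply: ulim_scal => //; apply: hu1.
- by apply: (ulim_ge hU (hu1 t ht)); apply: (ultra_imp hU) h1 => n /(_ t ht) [_ [_ [[]]]].
- by apply: (ulim_le_const hU (hu1 t ht)); apply: (ultra_imp hU) h1 => n /(_ t ht) [_ [_ [[]]]].
Qed.

(** The limit is chosen at every [t], with an arbitrary value where none exists. Convergence is
    claimed only at points with bounds, as derivatives are controlled only inside the interval. *)
Lemma ulim_fun (U : (nat -> Prop) -> Prop) (hU : ultra U) (u : nat -> R -> R) :
  exists ul : R -> R, forall t A B, U (fun n => A <= u n t <= B) ->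
    ulim U (fun n => u n t) (ul t).
Proof.
exists (fun t => epsilon (inhabits 0) (fun l => ulim U (fun n => u n t) l)) => t A B h.
by apply: (epsilon_spec (inhabits 0)); apply: (ulim_exists hU h).
Qed.

Record wave_on (b r h c M A B : R) (phi phi1 psi psi1 : R -> R) : Prop := WaveOn {
  wo_phi : forall t, A < t < B -> is_derive phi t (phi1 t);
  wo_phi1 : forall t, A < t < B ->
    is_derive phi1 t (c * phi1 t - growth r (phi t) (psi t));
  wo_psi : forall t, A < t < B -> is_derive psi t (psi1 t);
  wo_psi1 : forall t, A < t < B ->
    is_derive psi1 t (c * psi1 t - b * phi (t - c * h) * (1 - psi t));
  wo_phi1_bd : forall t, A < t < B -> 0 <= phi1 t <= M;
  wo_psi1_bd : forall t, A < t < B -> 0 <= psi1 t <= M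
}.

Lemma growth_lip (r u v u' v' d : R) : 0 < r <= 1 ->
  0 <= u <= 1 -> 0 <= v <= 1 -> 0 <= u' <= 1 -> 0 <= v' <= 1 ->
  Rabs (u - u') <= d -> Rabs (v - v') <= d ->
  Rabs (growth r u v - growth r u' v') <= 3 * d.
Proof.
move=> hr hu hv hu' hv' h1 h2.
have -> : growth r u v - growth r u' v' =
  (u - u') * (1 - r - (u + u') + r * v) + r * u' * (v - v') by rewrite /growth; ring.
apply: Rle_trans (Rabs_triang _ _) _; rewrite !Rabs_mult.
have h3 : Rabs (1 - r - (u + u') + r * v) <= 2 by apply: Rabs_le; split; nra.
have h4 : Rabs r * Rabs u' <= 1 by rewrite !Rabs_pos_eq; nra.
have q2 := Rabs_pos (v - v').
have q3 : Rabs (u - u') * Rabs (1 - r - (u + u') + r * v) <= d * 2.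
  by apply: Rmult_le_compat => //; apply: Rabs_pos.
have q4 : Rabs r * Rabs u' * Rabs (v - v') <= 1 * d.
  by apply: Rmult_le_compat => //; apply: Rmult_le_pos; apply: Rabs_pos.
lra.
Qed.

Lemma growth_bound (r u v : R) : 0 < r <= 1 -> 0 <= u <= 1 -> 0 <= v <= 1 ->
  Rabs (growth r u v) <= 1.
Proof.
move=> hr hu hv; rewrite /growth Rabs_mult (Rabs_pos_eq u); last by lra.
have : Rabs (1 - r - u + r * v) <= 1 by apply: Rabs_le; split; nra.
nra.
Qed.

Lemma uptake_lip (b w v w' v' d : R) : 0 < b ->
  0 <= w <= 1 -> 0 <= v <= 1 -> 0 <= w' <= 1 -> 0 <= v' <= 1 ->
  Rabs (w - w') <= d -> Rabs (v - v') <= d ->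
  Rabs (b * w * (1 - v) - b * w' * (1 - v')) <= 2 * b * d.
Proof.
move=> hb hw hv hw' hv' h1 h2.
have -> : b * w * (1 - v) - b * w' * (1 - v') =
  b * ((w - w') * (1 - v) + w' * (- (v - v'))) by ring.
rewrite Rabs_mult (Rabs_pos_eq b); last by lra.
have -> : 2 * b * d = b * (2 * d) by ring.
apply: Rmult_le_compat_l; first by lra.
apply: Rle_trans (Rabs_triang _ _) _; rewrite !Rabs_mult Rabs_Ropp.
rewrite (Rabs_pos_eq (1 - v)) ?(Rabs_pos_eq w'); try lra.
have q1 := Rabs_pos (w - w'); nra.
Qed.

Lemma uptake_bound (b w v : R) : 0 < b -> 0 <= w <= 1 -> 0 <= v <= 1 ->
  0 <= b * w * (1 - v) <= b.
Proof.
move=> hb hw hv; have h1 : 0 <= b * w <= b by nra.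
by split; [apply: Rmult_le_pos; lra | nra].
Qed.

Lemma ulim_ramp U (hU : ultra U) (k M : R) (u : nat -> R -> R) (ul : R -> R) :
  (forall n, ramp k M (u n)) -> (forall t, ulim U (fun n => u n t) (ul t)) -> ramp k M ul.
Proof.
move=> hu hl; split=> [t|s t hst].
  split; [apply: (ulim_ge hU (hl t)) | apply: (ulim_le_const hU (hl t))];
    by apply: ultra_all => // n; have := ramp_range (hu n) t; lra.
have hd := ulim_minus hU (hl t) (hl s).
split; [apply: (ulim_ge hU hd) | apply: (ulim_le_const hU hd)];
  by apply: ultra_all => // n; have := ramp_lip (hu n) hst; lra.
Qed.

(** [p n] and [u n] have the same limit, so the linear correction [K * (u n t - p n t)] disappears
    and the nonlinear equation remains. *)
Lemma ulim_wave (U : (nat -> Prop) -> Prop) (hU : ultra U) (K k M L c A B : R) (p u u1 f : nat -> R -> R)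
  (ul u1l fl : R -> R) : 0 < c -> 0 <= K -> 0 <= k ->
  (forall n, ramp k M (p n)) -> (forall n, ramp k M (u n)) ->
  (forall n t, Rabs (f n t) <= L) ->
  (forall n s t, Rabs (f n s - f n t) <= L * Rabs (s - t)) ->
  U (fun n => forall t, A < t < B -> is_derive (u n) t (u1 n t) /\
    is_derive (u1 n) t (c * u1 n t + K * (u n t - p n t) - f n t) /\ 0 <= u1 n t <= M) ->
  (forall t, ulim U (fun n => p n t) (ul t)) -> (forall t, ulim U (fun n => u n t) (ul t)) ->
  (forall t, A < t < B -> ulim U (fun n => u1 n t) (u1l t)) ->
  (forall t, ulim U (fun n => f n t) (fl t)) ->
  forall t, A < t < B ->
    is_derive ul t (u1l t) /\ is_derive u1l t (c * u1l t - fl t) /\ 0 <= u1l t <= M.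
Proof.
move=> hc hK hk hp hu hf1 hf2 hd lp lu lu1 lf.
have tri x y : Rabs (x - y) <= Rabs x + Rabs y.
  by rewrite -(Rabs_Ropp y); apply: Rabs_triang.
have hL : 0 <= L by have := hf1 0%nat 0; have := Rabs_pos (f 0%nat 0); lra.
apply: (ulim_second_order hU (u := u) (u1 := u1) (E := fun n t => K * (u n t - p n t) - f n t)
  (El := fun t => - fl t) (N := K + 2 * K * M + L)) => //.
- apply: (ultra_imp hU) hd => n hn t ht; have [d1 [d2 d3]] := hn t ht; split=> //.
  split; first by apply: derive_eq d2 _; ring.
  split=> //; apply: Rle_trans (tri _ _) _; have := hf1 n t.
  rewrite Rabs_mult (Rabs_pos_eq K); last by lra.
  have q1 := ramp_range (hu n) t; have q2 := ramp_range (hp n) t.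
  have : Rabs (u n t - p n t) <= 1 by apply: Rabs_le; lra.
  nra.
- apply: ultra_all => // n s t _ _.
  have -> : K * (u n s - p n s) - f n s - (K * (u n t - p n t) - f n t)
    = K * ((u n s - u n t) - (p n s - p n t)) - (f n s - f n t) by ring.
  apply: Rle_trans (tri _ _) _; rewrite Rabs_mult (Rabs_pos_eq K); last by lra.
  have := hf2 n s t; have := tri (u n s - u n t) (p n s - p n t).
  have := ramp_abs s t (hu n); have := ramp_abs s t (hp n).
  have := Rabs_pos (s - t); nra.
- move=> t _; have -> : - fl t = K * (ul t - ul t) - fl t by ring.
  by apply: ulim_minus => //; apply: ulim_scal => //; apply: ulim_minus.
Qed.

Section WaveLimit.
Variables (U : (nat -> Prop) -> Prop) (hU : ultra U) (b r h c K k M A B : R).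
Variables (p q u u1 v v1 : nat -> R -> R) (phi phi1 psi psi1 : R -> R).
Hypotheses (hb : 0 < b) (hr : 0 < r <= 1) (hc : 0 < c) (hK : 0 <= K) (hk : 0 <= k) (hM : 1 <= M).
Hypotheses (hp : forall n, ramp k M (p n)) (hq : forall n, ramp k M (q n)).
Hypotheses (hu : forall n, ramp k M (u n)) (hv : forall n, ramp k M (v n)).
Hypotheses (lp : forall t, ulim U (fun n => p n t) (phi t))
  (lq : forall t, ulim U (fun n => q n t) (psi t)).

(* [p = u] and [q = v] for a sequence of solutions; for the monotone iteration [u] and
   [v] are the successors of [p] and [q]. *)
Lemma wave_limit :
  (forall t, ulim U (fun n => u n t) (phi t)) -> (forall t, ulim U (fun n => v n t) (psi t)) ->
  (forall t, A < t < B -> ulim U (fun n => u1 n t) (phi1 t)) ->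
  (forall t, A < t < B -> ulim U (fun n => v1 n t) (psi1 t)) ->
  U (fun n => forall t, A < t < B -> is_derive (u n) t (u1 n t) /\
    is_derive (u1 n) t (c * u1 n t + K * (u n t - p n t) - growth r (p n t) (q n t)) /\
    0 <= u1 n t <= M) ->
  U (fun n => forall t, A < t < B -> is_derive (v n) t (v1 n t) /\
    is_derive (v1 n) t (c * v1 n t + K * (v n t - q n t) - b * p n (t - c * h) * (1 - q n t)) /\
    0 <= v1 n t <= M) ->
  wave_on b r h c M A B phi phi1 psi psi1.
Proof.
move=> lu lv lu1 lv1 hdu hdv.
have unit w t (hw : ramp k M w) := ramp_unit hk hw t.
have H1 := ulim_wave (ul := phi) (f := fun n t => growth r (p n t) (q n t))
  (fl := fun t => growth r (phi t) (psi t)) (L := 3 * M) hU hc hK hk hp hu.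
have H2 := ulim_wave (ul := psi) (f := fun n t => b * p n (t - c * h) * (1 - q n t))
  (fl := fun t => b * phi (t - c * h) * (1 - psi t)) (L := 2 * b * M) hU hc hK hk hq hv.
suff [q1 q2] : (forall t, A < t < B -> is_derive phi t (phi1 t) /\
    is_derive phi1 t (c * phi1 t - growth r (phi t) (psi t)) /\ 0 <= phi1 t <= M) /\
  (forall t, A < t < B -> is_derive psi t (psi1 t) /\
    is_derive psi1 t (c * psi1 t - b * phi (t - c * h) * (1 - psi t)) /\ 0 <= psi1 t <= M).
  by split=> t ht; have [? [? ?]] := q1 t ht; have [? [? ?]] := q2 t ht.
split.
- apply: (H1 _ _ _ _ _ _ hdu) => //.
  + by move=> n t; have := growth_bound hr (unit _ t (hp n)) (unit _ t (hq n)); lra.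
  + move=> n s t; rewrite (Rmult_assoc _ M).
    by apply: growth_lip => //; try exact: unit; apply: ramp_abs.
  + move=> t; rewrite /growth; apply: ulim_mult => //; apply: ulim_plus => //; last exact: ulim_scal.
    by apply: ulim_minus => //; apply: ulim_const.
- apply: (H2 _ _ _ _ _ _ hdv) => //.
  + move=> n t; have := uptake_bound hb (unit _ (t - c * h) (hp n)) (unit _ t (hq n)) => ?.
    by rewrite Rabs_pos_eq; nra.
  + move=> n s t; rewrite (Rmult_assoc _ M).
    apply: uptake_lip => //; try exact: unit; last exact: ramp_abs.
    have -> : s - t = s - c * h - (t - c * h) by ring.
    exact: ramp_abs.
  + move=> t; apply: ulim_mult => //; first exact: ulim_scal.
    by apply: ulim_minus => //; apply: ulim_const.
Qed.

End WaveLimit.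

(** An ultrafilter is not invariant under the shift of indices. Monotonicity repairs this: [x n.+1]
    lies between [x n] and the limit. *)
Lemma ulim_incr_shift U (hU : ultra U) (x : nat -> R) (l : R) :
  (forall n, x n <= x n.+1) -> ulim U x l -> ulim U (fun n => x n.+1) l.
Proof.
move=> hx hl e he.
have hm n m : Peano.le n m -> x n <= x m.
  by elim=> [|p _ IH]; [lra | have := hx p; lra].
have hb' n : x n <= l.
  by apply: (ulim_ge hU hl); apply: (ultra_imp hU) (ultra_tail hU n) => m; apply: hm.
apply: (ultra_imp hU) (hl e he) => n /Rabs_def2 [h1 h2].
by apply: Rabs_def1; [have := hb' n.+1; lra | have := hx n; lra].
Qed.

(** * Monotone iteration below a super-solution *)

Section Iteration.
Variables (b r h c a B k : R) (Phi Psi : R -> R).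
Hypotheses (hb : 0 < b) (hr : 0 < r <= 1) (hh : 0 <= h) (hc : 0 < c) (hk : 0 < k < 1).
Hypotheses (haB : a + 2 <= B) (hS : super b r h c Phi Psi).
Hypotheses (hkPhi : k <= Phi (a - c * h)) (hkPsi : k <= Psi (a - c * h)).
Hypotheses (hPhiB : Phi B = 1) (hPsiB : Psi B = 1).

(** The constant 2 compensates the decrease of [growth] in its first argument and [b] that of the
    uptake term in [psi], so that both right-hand sides are nondecreasing on the unit square. *)
Let K := 2 + b.
Let M := 1 + K + c.

Definition rhs1 (phi psi : R -> R) (t : R) : R := K * phi t + growth r (phi t) (psi t).
Definition rhs2 (phi psi : R -> R) (t : R) : R :=
  K * psi t + b * phi (t - c * h) * (1 - psi t).

Definition bvp_sol (F : R -> R) : (R -> R) * (R -> R) :=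
  epsilon (inhabits ((fun _ => 0), (fun _ => 0)))
    (fun p => bvp_solution c K a B k F p.1 p.2).

(** Each component is paired with its derivative. The initial constant [k] is a sub-solution:
    [growth r k k = k * (1 - r) * (1 - k)] and [b * k * (1 - k)] are nonnegative. *)
Fixpoint iterate (n : nat) : ((R -> R) * (R -> R)) * ((R -> R) * (R -> R)) :=
  if n is n'.+1 then
    let: ((phi, _), (psi, _)) := iterate n' in
    (bvp_sol (rhs1 phi psi), bvp_sol (rhs2 phi psi))
  else (((fun _ => k), (fun _ => 0)), ((fun _ => k), (fun _ => 0))).

Let ph n := (iterate n).1.1.
Let ph1 n := (iterate n).1.2.
Let ps n := (iterate n).2.1.
Let ps1 n := (iterate n).2.2.

Lemma rhs1_mono (u v u' v' : R) : 0 <= u -> u <= u' -> u' <= 1 -> 0 <= v -> v <= v' -> v' <= 1 ->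
  K * u + growth r u v <= K * u' + growth r u' v'.
Proof.
move=> h1 h2 h3 h4 h5 h6.
have : 0 <= (u' - u) * (K + (1 - r) - (u + u') + r * v').
  by apply: Rmult_le_pos; [lra | rewrite /K; nra].
have : 0 <= r * u * (v' - v) by apply: Rmult_le_pos; nra.
rewrite /growth; nra.
Qed.

Lemma rhs2_mono (w v w' v' : R) : 0 <= w -> w <= w' -> w' <= 1 -> 0 <= v -> v <= v' -> v' <= 1 ->
  K * v + b * w * (1 - v) <= K * v' + b * w' * (1 - v').
Proof.
move=> h1 h2 h3 h4 h5 h6.
have : 0 <= (v' - v) * (K - b * w') by apply: Rmult_le_pos; [lra | rewrite /K; nra].
have : 0 <= b * (w' - w) * (1 - v) by apply: Rmult_le_pos; nra.
nra.
Qed.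

Let hk0 : 0 <= k. Proof. by lra. Qed.

Lemma bvp_sol_rhs1 (phi psi : R -> R) : ramp k M phi -> ramp k M psi ->
  bvp_solution c K a B k (rhs1 phi psi) (bvp_sol (rhs1 phi psi)).1 (bvp_sol (rhs1 phi psi)).2.
Proof.
move=> h1 h2.
apply: (epsilon_spec (inhabits ((fun _ : R => 0), (fun _ : R => 0)))
  (fun p => bvp_solution c K a B k (rhs1 phi psi) p.1 p.2)).
apply: bvp_exists => //; try (rewrite /K; lra).
- move=> t; rewrite /rhs1 /growth.
  have c1 := ramp_continuous (t := t) h1; have c2 := ramp_continuous (t := t) h2.
  apply: (@continuous_plus _ _ _ (fun t => K * phi t) (fun t => phi t * (1 - r - phi t + r * psi t))).
    by apply: (@continuous_scal_r _ _ _ K phi).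
  apply: (@continuous_mult _ _ phi (fun t => 1 - r - phi t + r * psi t)) => //.
  apply: (@continuous_plus _ _ _ (fun t => 1 - r - phi t) (fun t => r * psi t)).
    by apply: (@continuous_minus _ _ _ (fun _ => 1 - r) phi) => //; apply: continuous_const.
  by apply: (@continuous_scal_r _ _ _ r psi).
- move=> s t hst; have q1 := ramp_unit hk0 h1 s; have q2 := ramp_unit hk0 h1 t.
  have q3 := ramp_unit hk0 h2 s; have q4 := ramp_unit hk0 h2 t.
  have q5 := ramp_lip h1 hst; have q6 := ramp_lip h2 hst.
  by apply: rhs1_mono; lra.
- move=> t; have q1 := ramp_range h1 t; have q2 := ramp_range h2 t; split.
    apply: Rle_trans (_ : K * k + growth r k k <= _); last by apply: rhs1_mono; lra.
    rewrite /growth; have : 0 <= k * (1 - r - k + r * k); last by lra.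
    by apply: Rmult_le_pos; nra.
  apply: Rle_trans (_ : _ <= K * 1 + growth r 1 1) _; first by apply: rhs1_mono; lra.
  by rewrite /growth; lra.
Qed.

Lemma bvp_sol_rhs2 (phi psi : R -> R) : ramp k M phi -> ramp k M psi ->
  bvp_solution c K a B k (rhs2 phi psi) (bvp_sol (rhs2 phi psi)).1 (bvp_sol (rhs2 phi psi)).2.
Proof.
move=> h1 h2.
apply: (epsilon_spec (inhabits ((fun _ : R => 0), (fun _ : R => 0)))
  (fun p => bvp_solution c K a B k (rhs2 phi psi) p.1 p.2)).
apply: bvp_exists => //; try (rewrite /K; lra).
- move=> t; rewrite /rhs2.
  have c1 := ramp_continuous (t := t - c * h) h1; have c2 := ramp_continuous (t := t) h2.
  apply: (@continuous_plus _ _ _ (fun t => K * psi t) (fun t => b * phi (t - c * h) * (1 - psi t))).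
    by apply: (@continuous_scal_r _ _ _ K psi).
  apply: (@continuous_mult _ _ (fun t => b * phi (t - c * h)) (fun t => 1 - psi t)).
    apply: (@continuous_scal_r _ _ _ b (fun t => phi (t - c * h))).
    apply: (continuous_comp (fun t => t - c * h) phi) => //.
    by apply: (@continuous_minus _ _ _ (fun t => t) (fun _ => c * h));
      [apply: continuous_id | apply: continuous_const].
  by apply: (@continuous_minus _ _ _ (fun _ => 1) psi) => //; apply: continuous_const.
- move=> s t hst.
  have q1 := ramp_unit hk0 h1 (s - c * h); have q2 := ramp_unit hk0 h1 (t - c * h).
  have q3 := ramp_unit hk0 h2 s; have q4 := ramp_unit hk0 h2 t.
  have q5 := @ramp_lip _ _ _ h1 (s - c * h) (t - c * h) ltac:(lra).
  have q6 := ramp_lip h2 hst.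
  by apply: rhs2_mono; lra.
- move=> t; have q1 := ramp_range h1 (t - c * h); have q2 := ramp_range h2 t; split.
    apply: Rle_trans (_ : K * k + b * k * (1 - k) <= _); last by apply: rhs2_mono; lra.
    have : 0 <= b * k * (1 - k); last by lra.
    by apply: Rmult_le_pos; nra.
  by apply: Rle_trans (_ : _ <= K * 1 + b * 1 * (1 - 1)) _; [apply: rhs2_mono; lra | lra].
Qed.

Lemma iterate_ramp n : ramp k M (ph n) /\ ramp k M (ps n).
Proof.
rewrite /ph /ps; elim: n => [|n] /=.
  by split; split=> [t|s t hst] /=; try lra; split; try lra;
    rewrite Rminus_diag; apply: Rmult_le_pos; rewrite /M /K; lra.
case: (iterate n) => [[phi phi1] [psi psi1]] /= [h1 h2]; split.
  exact: (bvp_ramp (bvp_sol_rhs1 h1 h2)).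
exact: (bvp_ramp (bvp_sol_rhs2 h1 h2)).
Qed.

Lemma iterate_S n :
  bvp_solution c K a B k (rhs1 (ph n) (ps n)) (ph n.+1) (ph1 n.+1) /\
  bvp_solution c K a B k (rhs2 (ph n) (ps n)) (ps n.+1) (ps1 n.+1).
Proof.
have [h1 h2] := iterate_ramp n.
move: h1 h2; rewrite /ph /ps /ph1 /ps1 /=.
case: (iterate n) => [[phi phi1] [psi psi1]] /= h1 h2.
by split; [apply: bvp_sol_rhs1 | apply: bvp_sol_rhs2].
Qed.

(** The comparison cannot extend to -oo, where the super-solution drops below [k]. The half-line
    from [a - c * h] suffices: the equations are used to the right of [a] and the delay reaches back
    by [c * h]. *)
Lemma iterate_below n t : a - c * h <= t -> ph n t <= Phi t /\ ps n t <= Psi t.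
Proof.
have hK : 0 < K by rewrite /K; lra.
have haB1 : a < B by lra.
have hch : 0 <= c * h by apply: Rmult_le_pos; lra.
elim: n t => [|n IH] t ht.
  have := super_monol hS ht; have := super_monor hS ht; rewrite /ph /ps /=; lra.
have [h1 h2] := iterate_ramp n; have [s1 s2] := iterate_S n.
have m1 := super_monol hS ht; have m2 := super_monor hS ht.
case: (Rle_lt_dec t a) => hta.
  by rewrite (bvp_left s1 hta) (bvp_left s2 hta); lra.
case: (Rle_lt_dec B t) => htB.
  have := super_monol hS htB; have := super_monor hS htB.
  by rewrite (bvp_right s1 htB) (bvp_right s2 htB); lra.
have hPa := @super_monol _ _ _ _ _ _ hS (a - c * h) a ltac:(lra).
have hPa' := @super_monor _ _ _ _ _ _ hS (a - c * h) a ltac:(lra).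
split.
- apply: (bvp_below_super (H := fun t => growth r (Phi t) (Psi t)) hK haB1 s1
    (super_contl hS)) => //; try lra.
    exact: (super_phi hS).
  move=> s hs; have [q1 q2] := IH s ltac:(lra).
  have q3 := ramp_unit hk0 h1 s; have q4 := ramp_unit hk0 h2 s.
  have := super_rangel hS s; have := super_ranger hS s.
  by move=> ? ?; apply: rhs1_mono; lra.
- apply: (bvp_below_super (H := fun t => b * Phi (t - c * h) * (1 - Psi t)) hK haB1 s2
    (super_contr hS)) => //; try lra.
    exact: (super_psi hS).
  move=> s hs; have [q1 _] := IH (s - c * h) ltac:(lra); have [_ q2] := IH s ltac:(lra).
  have q3 := ramp_unit hk0 h1 (s - c * h); have q4 := ramp_unit hk0 h2 s.
  have := super_rangel hS (s - c * h); have := super_ranger hS s.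
  by move=> ? ?; apply: rhs2_mono; lra.
Qed.

Lemma iterate_incr n t : ph n t <= ph n.+1 t /\ ps n t <= ps n.+1 t.
Proof.
have hK : 0 < K by rewrite /K; lra.
have haB1 : a < B by lra.
elim: n t => [|n IH] t.
  have [h1 h2] := iterate_ramp 1.
  have := ramp_range h1 t; have := ramp_range h2 t.
  by change (ph 0 t) with k; change (ps 0 t) with k; lra.
have [s1 s2] := iterate_S n; have [s3 s4] := iterate_S n.+1.
have [r1 r2] := iterate_ramp n; have [r3 r4] := iterate_ramp n.+1.
split.
- apply: (bvp_compare hK haB1 s1 s3) => s; have [q1 q2] := IH s.
  have := ramp_unit hk0 r1 s; have := ramp_unit hk0 r2 s.
  have := ramp_unit hk0 r3 s; have := ramp_unit hk0 r4 s.
  by move=> ? ? ? ?; apply: rhs1_mono; lra.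
- apply: (bvp_compare hK haB1 s2 s4) => s; have [_ q2] := IH s.
  have [q1 _] := IH (s - c * h).
  have := ramp_unit hk0 r1 (s - c * h); have := ramp_unit hk0 r2 s.
  have := ramp_unit hk0 r3 (s - c * h); have := ramp_unit hk0 r4 s.
  by move=> ? ? ? ?; apply: rhs2_mono; lra.
Qed.

Lemma finite_wave : exists phi phi1 psi psi1,
  ramp k M phi /\ ramp k M psi /\ wave_on b r h c M a B phi phi1 psi psi1 /\
  (forall t, t <= a -> phi t = k /\ psi t = k) /\
  (forall t, B <= t -> phi t = 1 /\ psi t = 1) /\
  (forall t, a <= t -> phi t <= Phi t /\ psi t <= Psi t).
Proof.
have [U hU] := ultra_exists.
have hK : 0 < K by rewrite /K; lra.
have hM : 1 <= M by rewrite /M; lra.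
have hch : 0 <= c * h by apply: Rmult_le_pos; lra.
pose phi t := epsilon (inhabits 0) (fun l => ulim U (fun n => ph n t) l).
pose psi t := epsilon (inhabits 0) (fun l => ulim U (fun n => ps n t) l).
have r1 n : ramp k M (ph n) := proj1 (iterate_ramp n).
have r2 n : ramp k M (ps n) := proj2 (iterate_ramp n).
have l1 t : ulim U (fun n => ph n t) (phi t).
  apply: (epsilon_spec (inhabits 0)); apply: (ulim_exists hU (A := 0) (B := 1)).
  by apply: ultra_all => // n; apply: (ramp_unit hk0).
have l2 t : ulim U (fun n => ps n t) (psi t).
  apply: (epsilon_spec (inhabits 0)); apply: (ulim_exists hU (A := 0) (B := 1)).
  by apply: ultra_all => // n; apply: (ramp_unit hk0).
have l1' t : ulim U (fun n => ph n.+1 t) (phi t).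
  by apply: (ulim_incr_shift hU _ (l1 t)) => n; case: (iterate_incr n t).
have l2' t : ulim U (fun n => ps n.+1 t) (psi t).
  by apply: (ulim_incr_shift hU _ (l2 t)) => n; case: (iterate_incr n t).
have R1 : ramp k M phi by apply: (ulim_ramp hU r1 l1).
have R2 : ramp k M psi by apply: (ulim_ramp hU r2 l2).
have [phi1 l3] := ulim_fun hU (fun n => ph1 n.+1).
have [psi1 l4] := ulim_fun hU (fun n => ps1 n.+1).
exists phi, phi1, psi, psi1; split=> //; split=> //; split.
  apply: (wave_limit (K := K) (k := k) (p := ph) (q := ps) (u := fun n => ph n.+1)
    (v := fun n => ps n.+1) (u1 := fun n => ph1 n.+1) (v1 := fun n => ps1 n.+1) hU) => //; try lra.
  - move=> t ht; apply: (l3 t 0 M); apply: ultra_all => // n.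
    by have [s1 _] := iterate_S n; apply: (bvp_u1 s1).
  - move=> t ht; apply: (l4 t 0 M); apply: ultra_all => // n.
    by have [_ s1] := iterate_S n; apply: (bvp_u1 s1).
  - apply: ultra_all => // n t ht; have [s1 _] := iterate_S n; split; first exact: (bvp_d1 s1).
    split; last exact: (bvp_u1 s1).
    by apply: derive_eq (bvp_d2 s1 ht) _; rewrite /rhs1; ring.
  - apply: ultra_all => // n t ht; have [_ s1] := iterate_S n; split; first exact: (bvp_d1 s1).
    split; last exact: (bvp_u1 s1).
    by apply: derive_eq (bvp_d2 s1 ht) _; rewrite /rhs2; ring.
have ex (x : nat -> R) l m : ulim U x l -> (forall n, x n = m) -> l = m.
  move=> hl e; apply: (ulim_unique hU hl); apply: (ulim_ext hU (x := fun _ => m)).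
    by apply: ultra_all.
  exact: ulim_const.
split.
  move=> t ht; split; [apply: ex (l1' t) _ | apply: ex (l2' t) _] => n;
    have [s1 s2] := iterate_S n; [exact: (bvp_left s1) | exact: (bvp_left s2)].
split.
  move=> t ht; split; [apply: ex (l1' t) _ | apply: ex (l2' t) _] => n;
    have [s1 s2] := iterate_S n; [exact: (bvp_right s1) | exact: (bvp_right s2)].
move=> t ht; split; [apply: (ulim_le_const hU (l1 t)) | apply: (ulim_le_const hU (l2 t))];
  apply: ultra_all => // n; have [|q1 q2] := @iterate_below n t; lra.
Qed.

End Iteration.

(** * Entire solutions *)

(** Differentiating the first two groups, with the equations inserted, produces [r * psi * phi] with
    both signs, up to a delay of favourable sign. What is left is at most of size [r * phi ^ 2], and
    the third term, a multiple of the flux of [psi] advanced by the delay, absorbs it. *)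
Definition defect (b r h c : R) (phi phi1 psi psi1 : R -> R) (t : R) : R :=
  r / b * (c * psi t ^ 2 / 2 - psi t * psi1 t) - (c * phi t - phi1 t)
  - r * phi t * (2 / b) * (c * psi (t + c * h) - psi1 (t + c * h)).

(* The point of this monotone quantity is its vanishing limit at -oo: it bounds
   psi^2 by phi, and so excludes waves that start from an equilibrium (0, psi)
   with psi > 0. *)
Lemma defect_le (b r h c M A B k : R) (phi phi1 psi psi1 : R -> R) (x t : R) :
  0 < b -> 0 < r <= 1 -> 0 <= h -> 0 < c -> 0 <= k ->
  ramp k M phi -> ramp k M psi -> wave_on b r h c M A B phi phi1 psi psi1 ->
  A < x -> x <= t -> t + c * h < B -> psi (t + c * h) <= 1 / 2 ->
  defect b r h c phi phi1 psi psi1 t <=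
    r / b * (c * psi x ^ 2 / 2) + phi1 x + 2 / b * psi1 (x + c * h).
Proof.
move=> hb hr hh hc hk r1 r2 hw hAx hxt htB hpsi.
have hch : 0 <= c * h by apply: Rmult_le_pos; lra.
have u1 := ramp_unit hk r1.
have u2 := ramp_unit hk r2.
have m1 := ramp_mono r1.
have m2 := ramp_mono r2.
(* The factor [phi t] is frozen, so that only the flux is differentiated in the last term. For
   [s <= t] it dominates [phi s], and [psi <= 1 / 2] makes [2 * (1 - psi)] at least 1. *)
pose G s := r / b * (c * psi s ^ 2 / 2 - psi s * psi1 s) - (c * phi s - phi1 s)
  - r * phi t * (2 / b) * (c * psi (s + c * h) - psi1 (s + c * h)).
have hG : G t <= G x.
  apply: (@derive_le0_ge G (fun s => - (r / b) * psi1 s ^ 2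
    + r * psi s * phi (s - c * h) * (1 - psi s) - growth r (phi s) (psi s)
    - 2 * r * phi t * phi s * (1 - psi (s + c * h))) x t hxt) => s hs.
  - have d1 := wo_phi hw (t := s) ltac:(lra).
    have d2 := wo_phi1 hw (t := s) ltac:(lra).
    have d3 := wo_psi hw (t := s) ltac:(lra).
    have d4 := wo_psi1 hw (t := s) ltac:(lra).
    have d5 := wo_psi hw (t := (s + c * h)) ltac:(lra).
    have d6 := wo_psi1 hw (t := (s + c * h)) ltac:(lra).
    have e : s + c * h - c * h = s by ring.
    rewrite e in d6; rewrite /G /Rdiv; der; field; lra.
  - have q1 := u1 s; have q2 := u2 s.
    have q4 := m1 s t ltac:(lra); have q5 := m2 (s + c * h) (t + c * h) ltac:(lra).
    have q6 := m1 (s - c * h) s ltac:(lra).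
    have w1 : 0 <= r / b * psi1 s ^ 2.
      by apply: Rmult_le_pos; [apply: Rlt_le; apply: Rdiv_lt_0_compat; lra | apply: pow2_ge_0].
    have w2 : r * psi s * (phi (s - c * h) * (1 - psi s)) <= r * psi s * phi s.
      by apply: Rmult_le_compat_l; [nra | nra].
    have w3 : 0 <= r * phi t * phi s by apply: Rmult_le_pos; nra.
    have w4 : r * phi t * phi s * 1 <= r * phi t * phi s * (2 * (1 - psi (s + c * h))).
      by apply: Rmult_le_compat_l; lra.
    have w5 : 0 <= (1 - r) * (phi s * (1 - phi s)) by apply: Rmult_le_pos; nra.
    have w6 : r * phi s * phi s <= r * phi s * phi t by apply: Rmult_le_compat_l; nra.
    rewrite /growth; nra.
have p2 := wo_psi1_bd hw (t := x) ltac:(lra).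
have p3 := wo_psi1_bd hw (t := (x + c * h)) ltac:(lra).
have q1 := u1 x; have q2 := u2 x; have q3 := u1 t; have q4 := u2 (x + c * h).
apply: Rle_trans hG _; rewrite /G.
have hrb : 0 < r / b by apply: Rdiv_lt_0_compat; lra.
have w1 : 0 <= r / b * (psi x * psi1 x) by apply: Rmult_le_pos; nra.
have w2 : 0 <= r * phi t <= 1 by nra.
have w3 : r * phi t * (2 / b * psi1 (x + c * h)) <= 1 * (2 / b * psi1 (x + c * h)).
  by apply: Rmult_le_compat_r; nra.
have w4 : 0 <= r * phi t * (2 / b * (c * psi (x + c * h))).
  by apply: Rmult_le_pos; [lra | apply: Rmult_le_pos; nra].
nra.
Qed.

(** [c * f - f1] has derivative [g] and stays between [- M] and [c], so a source bounded below by a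
    positive constant cannot last long. *)
Lemma source_bound (f f1 g : R -> R) (c d M x y : R) : 0 < c -> x <= y ->
  (forall t, x <= t <= y -> is_derive f t (f1 t)) ->
  (forall t, x <= t <= y -> is_derive f1 t (c * f1 t - g t)) ->
  (forall t, 0 <= f t <= 1) -> (forall t, x <= t <= y -> 0 <= f1 t <= M) ->
  (forall t, x <= t <= y -> d <= g t) -> d * (y - x) <= c + M.
Proof.
move=> hc hxy h1 h2 hf hf1 hg.
have : c * f x - f1 x - d * x <= c * f y - f1 y - d * y.
  apply: (@derive_ge0_le (fun t => c * f t - f1 t - d * t) (fun t => g t - d) x y hxy) => t ht.
    by der; ring.
  by have := hg t ht; lra.
have := hf x; have := hf y; have := hf1 x ltac:(lra); have := hf1 y ltac:(lra); nra.
Qed.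

Lemma small_derivative (f f1 g : R -> R) (c x d : R) : 0 < c ->
  (forall t, x <= t <= x + 1 -> is_derive f t (f1 t)) ->
  (forall t, x <= t <= x + 1 -> is_derive f1 t (c * f1 t - g t)) ->
  (forall t, x <= t <= x + 1 -> 0 <= f t) ->
  (forall s t, x <= s -> s <= t -> t <= x + 1 -> f s <= f t) ->
  (forall t, x <= t <= x + 1 -> Rabs (g t) <= d) ->
  f1 x <= (c + 1) * f (x + 1) + d.
Proof.
move=> hc h1 h2 h3 hm h4.
have [|y [hy ey]] := @mvt_le f f1 x (x + 1) ltac:(lra); first exact: h1.
have := @derive_abs_le (fun t => f1 t - c * f t) (fun t => - g t) x y d ltac:(lra).
move=> h.
have : Rabs (f1 y - c * f y - (f1 x - c * f x)) <= d * (y - x).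
  apply: h => t ht; last by rewrite Rabs_Ropp; apply: h4; lra.
  by have q1 := h1 t ltac:(lra); have q2 := h2 t ltac:(lra); der; ring.
move=> /Rabs_le_between q.
have := h3 x ltac:(lra); have := h3 y ltac:(lra).
have := hm x (x + 1) ltac:(lra) ltac:(lra) ltac:(lra).
have : 0 <= d by have := h4 x ltac:(lra); have := Rabs_pos (g x); lra.
nra.
Qed.

(** The wave on [[a, B]] is translated to the point [tau] where [psi] crosses 1/2. The defect
    inequality is based at [a + 1], where the super-solution bounds [phi] and [psi] by [e / C]; both
    its sides move with the wave. *)
Lemma approximate_wave (b r h c : R) (Phi Psi : R -> R) :
  0 < b -> 0 < r <= 1 -> 0 <= h -> 0 < c -> super b r h c Phi Psi ->
  forall m e, 0 < m -> 0 < e -> exists phi phi1 psi psi1 A B,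
  A <= - m /\ m <= B /\ ramp 0 (3 + b + c) phi /\ ramp 0 (3 + b + c) psi /\ psi 0 = 1 / 2 /\
  wave_on b r h c (3 + b + c) A B phi phi1 psi psi1 /\
  forall t, - m <= t -> t + c * h <= 0 -> defect b r h c phi phi1 psi psi1 t <= e.
Proof.
move=> hb hr hh hc hS m e hm he.
have hch : 0 <= c * h by apply: Rmult_le_pos; lra.
have hrb : 0 < r / b by apply: Rdiv_lt_0_compat; lra.
have h2b : 0 < 2 / b by apply: Rdiv_lt_0_compat; lra.
(* [C] times [e / C] bounds the three terms of [defect_le], the derivatives being estimated over a
   unit interval. *)
pose C := r / b * (c / 2) + (c + 2) + 2 / b * (c + 1 + b).
have hrbc : 0 < r / b * (c / 2) by apply: Rmult_lt_0_compat; lra.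
have h2bc : 0 < 2 / b * (c + 1 + b) by apply: Rmult_lt_0_compat; lra.
have hC : 0 < C by rewrite /C; lra.
have he' : 0 < Rmin (e / C) (1 / 4) by apply: Rmin_pos; [apply: Rdiv_lt_0_compat | lra].
have he1 := Rmin_l (e / C) (1 / 4); have he2 := Rmin_r (e / C) (1 / 4).
have [T hT] : exists T, forall t, t <= T ->
    Phi t <= Rmin (e / C) (1 / 4) /\ Psi t <= Rmin (e / C) (1 / 4).
  have [T1 hT1] := super_minfl hS he'; have [T2 hT2] := super_minfr hS he'.
  exists (Rmin T1 T2) => t ht; have w1 := Rmin_l T1 T2; have w2 := Rmin_r T1 T2.
  by split; apply: Rle_trans (Rle_abs _) _; [apply: hT1 | apply: hT2]; lra.
have [T4 hT4] := super_pinf hS.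
(* This keeps [[a, a + c * h + 2]] to the left of [T], where the super-solution is small, and gives
   [a - tau <= - m], since [tau > T] by the bound [Psi <= 1 / 4] there. *)
pose a := T - c * h - m - 2; have ea : a = T - c * h - m - 2 by [].
pose k := Rmin (Phi (a - c * h)) (Psi (a - c * h)) / 4.
have hk1 := super_rangel hS (a - c * h); have hk2 := super_ranger hS (a - c * h).
have hk3 := Rmin_l (Phi (a - c * h)) (Psi (a - c * h)).
have hk4 := Rmin_r (Phi (a - c * h)) (Psi (a - c * h)).
have hk5 : 0 < Rmin (Phi (a - c * h)) (Psi (a - c * h)) by apply: Rmin_pos; lra.
have hk : 0 < k <= 1 / 4 by rewrite /k; lra.
have hkp : k <= Phi (a - c * h) by rewrite /k; lra.
have hkp' : k <= Psi (a - c * h) by rewrite /k; lra.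
pose M := 3 + b + c.
(* While [psi <= 1 / 2] the source of [psi] is at least [b * k / 2]; over a length [N] this
   contradicts [source_bound]. *)
pose N := 2 * (c + M) / (b * k) + 1.
have hbk : 0 < b * k by apply: Rmult_lt_0_compat; lra.
have hN : b * k / 2 * N = c + M + b * k / 2 by rewrite /N; field; lra.
have hN1 : 1 <= N.
  by rewrite /N; have : 0 < 2 * (c + M) / (b * k); [apply: Rdiv_lt_0_compat; rewrite /M; lra | lra].
pose x1 := a + c * h + 1 + N.
pose B := Rmax T4 (x1 + m + 1).
have hB1 : T4 <= B by apply: Rmax_l.
have hB2 : x1 + m + 1 <= B by apply: Rmax_r.
have [hBP hBQ] := hT4 B hB1.
have [phi [phi1 [psi [psi1 [r1 [r2 [hw [hl [hr' hbelow]]]]]]]]] :=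
  @finite_wave b r h c a B k Phi Psi hb hr hh hc ltac:(lra) ltac:(rewrite /x1 in hB2; lra)
    hS hkp hkp' hBP hBQ.
have eM : 1 + (2 + b) + c = M by rewrite /M; ring.
rewrite eM in r1 r2 hw.
have hk0 : 0 <= k by lra.
have u1 := ramp_unit hk0 r1.
have u2 := ramp_unit hk0 r2.
have m1 := ramp_mono r1.
have m2 := ramp_mono r2.
have hx1 : 1 / 2 < psi (x1 + 1).
  apply: Rnot_le_lt => hle.
  have : b * k / 2 * (x1 - (a + c * h + 1)) <= c + M.
    apply: (@source_bound psi psi1 (fun t => b * phi (t - c * h) * (1 - psi t))) => // [|s hs|s hs|s hs|s hs].
    - by rewrite /x1; lra.
    - by apply: (wo_psi hw); lra.
    - by apply: (wo_psi1 hw); lra.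
    - by apply: (wo_psi1_bd hw); lra.
    - have q1 := ramp_range r1 (s - c * h); have q2 := m2 s (x1 + 1) ltac:(lra).
      have : b * k * (1 / 2) <= b * phi (s - c * h) * (1 - psi s); last by lra.
      by apply: Rmult_le_compat; nra.
  have -> : x1 - (a + c * h + 1) = N by rewrite /x1; ring.
  lra.
have [||tau [ht1 [ht2 _]]] := @last_crossing psi a (x1 + 1) (1 / 2)
    ltac:(rewrite /x1; lra) _ _ hx1.
- by move=> t _; apply: ramp_continuous r2.
- by have [_ ->] := hl a ltac:(lra); lra.
have htau : T < tau.
  apply: Rnot_le_lt => hle.
  by have [_ hT2] := hT tau hle; have [_ hb2] := hbelow tau ltac:(lra); lra.
exists (fun t => phi (t + tau)), (fun t => phi1 (t + tau)), (fun t => psi (t + tau)),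
  (fun t => psi1 (t + tau)), (a - tau), (B - tau).
split; first by lra.
split; first by lra.
have rs u : ramp k M u -> ramp 0 M (fun t => u (t + tau)).
  move=> hu; split=> [t|s t hst]; first by have := ramp_range hu (t + tau); lra.
  have -> : t - s = (t + tau) - (s + tau) by ring.
  by apply: (ramp_lip hu); lra.
split; first exact: rs.
split; first exact: rs.
split; first by rewrite Rplus_0_l.
have esh t : t - c * h + tau = t + tau - c * h by ring.
split.
  split=> t ht.
  - by apply: derive_shift; apply: (wo_phi hw); lra.
  - by apply: derive_shift; apply: (wo_phi1 hw); lra.
  - by apply: derive_shift; apply: (wo_psi hw); lra.
  - by rewrite esh; apply: derive_shift; apply: (wo_psi1 hw); lra.
  - by apply: (wo_phi1_bd hw); lra.
  - by apply: (wo_psi1_bd hw); lra.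
move=> t htm htc.
have esh' : t + c * h + tau = t + tau + c * h by ring.
have -> : defect b r h c (fun t => phi (t + tau)) (fun t => phi1 (t + tau))
  (fun t => psi (t + tau)) (fun t => psi1 (t + tau)) t
  = defect b r h c phi phi1 psi psi1 (t + tau) by rewrite /defect esh'.
have hhalf : psi (t + tau + c * h) <= 1 / 2 by rewrite -ht2; apply: m2; lra.
apply: Rle_trans (defect_le (x := a + 1) hb hr hh hc (Rlt_le _ _ (proj1 hk)) r1 r2 hw _ _ _ hhalf) _;
  try lra.
have sPQ s : a <= s <= a + c * h + 2 -> phi s <= e / C /\ psi s <= e / C.
  by move=> hs; have := hbelow s ltac:(lra); have := hT s ltac:(lra); lra.
have B1 : phi1 (a + 1) <= (c + 1) * phi (a + 1 + 1) + e / C.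
  apply: (@small_derivative phi phi1 (fun t => growth r (phi t) (psi t))) => // s hs.
  - by apply: (wo_phi hw); lra.
  - by apply: (wo_phi1 hw); lra.
  - by have := u1 s; lra.
  - by move=> s' *; apply: m1.
  - have q1 := u1 s; have q2 := u2 s; have [q3 _] := sPQ s ltac:(lra).
    rewrite /growth Rabs_mult (Rabs_pos_eq (phi s)); last by lra.
    have : Rabs (1 - r - phi s + r * psi s) <= 1 by apply: Rabs_le; split; nra.
    nra.
have B2 : psi1 (a + 1 + c * h) <= (c + 1) * psi (a + 1 + c * h + 1) + b * (e / C).
  apply: (@small_derivative psi psi1 (fun t => b * phi (t - c * h) * (1 - psi t))) => // s hs.
  - by apply: (wo_psi hw); lra.
  - by apply: (wo_psi1 hw); lra.
  - by have := u2 s; lra.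
  - by move=> s' *; apply: m2.
  - have q1 := u1 (s - c * h); have q2 := u2 s; have [q3 _] := sPQ (s - c * h) ltac:(lra).
    have q4 : 0 <= b * phi (s - c * h) <= b * (e / C) by nra.
    by apply: Rabs_le; split; nra.
have [q1 _] := sPQ (a + 1 + 1) ltac:(lra).
have [_ q2] := sPQ (a + 1 + c * h + 1) ltac:(lra).
have [_ q3] := sPQ (a + 1) ltac:(lra); have q4 := u2 (a + 1).
have w1 : r / b * (c * psi (a + 1) ^ 2 / 2) <= r / b * (c / 2 * (e / C)).
  apply: Rmult_le_compat_l; first by lra.
  have : psi (a + 1) ^ 2 <= e / C by nra.
  nra.
have w2 : 2 / b * psi1 (a + 1 + c * h) <= 2 / b * ((c + 1 + b) * (e / C)).
  by apply: Rmult_le_compat_l; [lra | nra].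
have w3 : phi1 (a + 1) <= (c + 2) * (e / C) by nra.
have -> : e = C * (e / C) by field; lra.
rewrite {1}/C; lra.
Qed.

Record entire (b r h c M : R) (phi phi1 psi psi1 : R -> R) : Prop := Entire {
  en_phi_ramp : ramp 0 M phi;
  en_psi_ramp : ramp 0 M psi;
  en_phi : forall t, is_derive phi t (phi1 t);
  en_phi1 : forall t, is_derive phi1 t (c * phi1 t - growth r (phi t) (psi t));
  en_psi : forall t, is_derive psi t (psi1 t);
  en_psi1 : forall t, is_derive psi1 t (c * psi1 t - b * phi (t - c * h) * (1 - psi t));
  en_phi1_bd : forall t, 0 <= phi1 t <= M;
  en_psi1_bd : forall t, 0 <= psi1 t <= M
}.

Lemma entire_of_super (b r h c : R) (Phi Psi : R -> R) :
  0 < b -> 0 < r <= 1 -> 0 <= h -> 0 < c -> super b r h c Phi Psi ->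
  exists M phi phi1 psi psi1, entire b r h c M phi phi1 psi psi1 /\ psi 0 = 1 / 2 /\
  forall t, t + c * h <= 0 -> defect b r h c phi phi1 psi psi1 t <= 0.
Proof.
move=> hb hr hh hc hS.
have [U hU] := ultra_exists.
pose M := 3 + b + c.
pose approx n (p : ((R -> R) * (R -> R)) * ((R -> R) * (R -> R))) :=
  ramp 0 M p.1.1 /\ ramp 0 M p.2.1 /\ p.2.1 0 = 1 / 2 /\
  wave_on b r h c M (- (INR n + 1)) (INR n + 1) p.1.1 p.1.2 p.2.1 p.2.2 /\
  forall t, - (INR n + 1) <= t -> t + c * h <= 0 ->
    defect b r h c p.1.1 p.1.2 p.2.1 p.2.2 t <= / (INR n + 1).
have hex n : exists p, approx n p.
  have hn := pos_INR n.
  have [phi [phi1 [psi [psi1 [A [B [hA [hB [r1 [r2 [h0 [hw hd]]]]]]]]]]]] :=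
    @approximate_wave b r h c Phi Psi hb hr hh hc hS (INR n + 1) (/ (INR n + 1))
      ltac:(lra) ltac:(apply: Rinv_0_lt_compat; lra).
  exists ((phi, phi1), (psi, psi1)); do 3 (split; first by []).
  split; last exact: hd.
  by case: hw => *; split=> /= *; auto with real;
    match goal with H : forall t, A < t < B -> _ |- _ => apply: H; lra end.
pose f n := proj1_sig (constructive_indefinite_description _ (hex n)).
have hf n : approx n (f n) by rewrite /f; case: constructive_indefinite_description.
pose ph n := (f n).1.1; pose ph1 n := (f n).1.2.
pose ps n := (f n).2.1; pose ps1 n := (f n).2.2.
have r1 n : ramp 0 M (ph n) by case: (hf n).
have r2 n : ramp 0 M (ps n) by case: (hf n) => _ [].
have hps0 n : ps n 0 = 1 / 2 by case: (hf n) => _ [_ []].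
have hw n : wave_on b r h c M (- (INR n + 1)) (INR n + 1) (ph n) (ph1 n) (ps n) (ps1 n).
  by case: (hf n) => _ [_ [_ []]].
have hd n t : - (INR n + 1) <= t -> t + c * h <= 0 ->
    defect b r h c (ph n) (ph1 n) (ps n) (ps1 n) t <= / (INR n + 1).
  by case: (hf n) => _ [_ [_ [_ h1]]]; apply: h1.
have hlarge T : U (fun n => T <= INR n + 1).
  have [N hN] := INR_unbounded T.
  by apply: (ultra_imp hU) (ultra_tail hU N) => n /le_INR; lra.
have [phi l1] := ulim_fun hU ph; have [phi1 l2] := ulim_fun hU ph1.
have [psi l3] := ulim_fun hU ps; have [psi1 l4] := ulim_fun hU ps1.
have habs t x : Rabs t + 1 <= x -> - x < t < x.
  move=> hx; have /Rabs_def2 [q1 q2] : Rabs t < x by lra.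
  by split.
have L1 t : ulim U (fun n => ph n t) (phi t).
  by apply: (l1 t 0 1); apply: ultra_all => // n; apply: ramp_range (r1 n) t.
have L3 t : ulim U (fun n => ps n t) (psi t).
  by apply: (l3 t 0 1); apply: ultra_all => // n; apply: ramp_range (r2 n) t.
have L2 t : ulim U (fun n => ph1 n t) (phi1 t).
  apply: (l2 t 0 M); apply: (ultra_imp hU) (hlarge (Rabs t + 1)) => n hn.
  by apply: (wo_phi1_bd (hw n)); apply: habs; lra.
have L4 t : ulim U (fun n => ps1 n t) (psi1 t).
  apply: (l4 t 0 M); apply: (ultra_imp hU) (hlarge (Rabs t + 1)) => n hn.
  by apply: (wo_psi1_bd (hw n)); apply: habs; lra.
have hM : 1 <= M by rewrite /M; lra.
have W t : wave_on b r h c M (- (Rabs t + 1)) (Rabs t + 1) phi phi1 psi psi1.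
  apply: (wave_limit (K := 0) (k := 0) (p := ph) (q := ps) (u := ph) (v := ps) (u1 := ph1) (v1 := ps1) hU) => //;
    try lra; apply: (ultra_imp hU) (hlarge (Rabs t + 1)) => n hn s hs; split.
  - by apply: (wo_phi (hw n)); lra.
  - split; last by apply: (wo_phi1_bd (hw n)); lra.
    by apply: derive_eq (wo_phi1 (hw n) _) _; [lra | ring].
  - by apply: (wo_psi (hw n)); lra.
  - split; last by apply: (wo_psi1_bd (hw n)); lra.
    by apply: derive_eq (wo_psi1 (hw n) _) _; [lra | ring].
exists M, phi, phi1, psi, psi1; split.
  have R1 := ulim_ramp hU r1 L1; have R2 := ulim_ramp hU r2 L3.
  by split=> // t; case: (W t) => d1 d2 d3 d4 d5 d6;
    [apply: d1 | apply: d2 | apply: d3 | apply: d4 | apply: d5 | apply: d6]; apply: habs; lra.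
split.
  apply: (ulim_unique hU (L3 0)); apply: (ulim_ext hU (x := fun _ => 1 / 2)).
    by apply: ultra_all.
  exact: ulim_const.
move=> t ht.
have LD : ulim U (fun n => defect b r h c (ph n) (ph1 n) (ps n) (ps1 n) t)
    (defect b r h c phi phi1 psi psi1 t).
  rewrite /defect; apply: ulim_minus => //; first apply: ulim_minus => //.
  - apply: ulim_scal => //; apply: ulim_minus => //; last exact: ulim_mult.
    have -> : c * psi t ^ 2 / 2 = c / 2 * (psi t * psi t) by field.
    apply: (ulim_ext hU (x := fun n => c / 2 * (ps n t * ps n t))).
      by apply: ultra_all => // n; field.
    by apply: ulim_scal => //; apply: ulim_mult.
  - by apply: ulim_minus => //; apply: ulim_scal.
  - apply: ulim_mult => //; last by apply: ulim_minus => //; apply: ulim_scal.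
    have -> : r * phi t * (2 / b) = r * (2 / b) * phi t by ring.
    apply: (ulim_ext hU (x := fun n => r * (2 / b) * ph n t)).
      by apply: ultra_all => // n; ring.
    exact: ulim_scal.
apply: Rnot_lt_le => hpos; set l := defect _ _ _ _ _ _ _ _ _ in LD hpos.
have : l <= l / 2; last by lra.
apply: (ulim_le_const hU LD).
apply: (ultra_imp hU) (ultra_and hU (hlarge (Rabs t)) (hlarge (2 / l))) => n [h1 h2].
have h3 := Rabs_le_between t (Rabs t).
apply: Rle_trans (hd n t _ ht) _; first by lra.
have h4 : 0 < 2 / l by apply: Rdiv_lt_0_compat; lra.
have -> : l / 2 = / (2 / l) by field; lra.
exact: Rinv_le_contravar.
Qed.

(** * Behaviour at infinity *)

Lemma tends0_plus (f g : R -> R) : tends0 f -> tends0 g -> tends0 (fun t => f t + g t).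
Proof.
move=> hf hg e he.
have [T1 h1] := hf (e / 2) ltac:(lra); have [T2 h2] := hg (e / 2) ltac:(lra).
exists (Rmin T1 T2) => t ht; have q1 := Rmin_l T1 T2; have q2 := Rmin_r T1 T2.
have := h1 t ltac:(lra); have := h2 t ltac:(lra); have := Rabs_triang (f t) (g t); lra.
Qed.

Lemma tends0_bounded_mult (f g : R -> R) (T K : R) :
  (forall t, t <= T -> Rabs (g t) <= K) -> tends0 f -> tends0 (fun t => f t * g t).
Proof.
move=> hg hf e he.
have hK : 0 <= K by have := hg T (Rle_refl _); have := Rabs_pos (g T); lra.
have [T1 h1] := hf (e / (K + 1)) ltac:(apply: Rdiv_lt_0_compat; lra).
exists (Rmin T T1) => t ht; have q1 := Rmin_l T T1; have q2 := Rmin_r T T1.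
rewrite Rabs_mult; have h2 := h1 t ltac:(lra); have h3 := hg t ltac:(lra).
have e1 : e = e / (K + 1) * (K + 1) by field; lra.
rewrite e1; apply: Rmult_le_compat; try exact: Rabs_pos; lra.
Qed.

Lemma tends0_scal (a : R) (f : R -> R) : tends0 f -> tends0 (fun t => a * f t).
Proof.
move=> hf.
apply: (@tends0_bound _ (fun t => f t * a) 0); first by move=> t _; rewrite Rmult_comm; lra.
by apply: (@tends0_bounded_mult f (fun _ => a) 0 (Rabs a)) => // t _; lra.
Qed.

Lemma tends0_minus (f g : R -> R) : tends0 f -> tends0 g -> tends0 (fun t => f t - g t).
Proof.
move=> hf hg; have h := tends0_plus hf (tends0_scal (- 1) hg).
by apply: (@tends0_bound _ _ 0) h => t _; right; f_equal; ring.
Qed.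

Lemma tends0_shift (f : R -> R) (s : R) : tends0 f -> tends0 (fun t => f (t + s)).
Proof.
by move=> hf e he; have [T hT] := hf e he; exists (T - s) => t ht; apply: hT; lra.
Qed.

Lemma tends0_le_const (f : R -> R) (a T : R) : tends0 f -> (forall t, t <= T -> a <= f t) -> a <= 0.
Proof.
move=> hf h; apply: Rnot_lt_le => ha.
have [T1 h1] := hf (a / 2) ltac:(lra).
have q1 := Rmin_l T T1; have q2 := Rmin_r T T1.
have := h1 (Rmin T T1) q2; have := h (Rmin T T1) q1; have := Rle_abs (f (Rmin T T1)); lra.
Qed.

Lemma nondecreasing_limit (f : R -> R) :
  (forall s t, s <= t -> f s <= f t) -> (forall t, 0 <= f t) ->
  exists l, 0 <= l /\ (forall t, l <= f t) /\ tends0 (fun t => f t - l).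
Proof.
move=> hm h0.
have [l [hl1 hl2]] : {l | is_lub (fun y => forall t, y <= f t) l}.
  by apply: completeness; [exists (f 0) => y /(_ 0) | exists 0].
have hlf t : l <= f t by apply: hl2 => y /(_ t).
exists l; split; first exact: hl1.
split=> // e he.
have [T hT] : exists T, f T < l + e.
  apply: NNPP => hno; have : l + e <= l; last by lra.
  by apply: hl1 => t; apply: Rnot_lt_le => hlt; apply: hno; exists t.
exists T => t ht; have := hm t T ht; have := hlf t => q1 q2.
by rewrite Rabs_pos_eq; lra.
Qed.

Lemma tends0_derivative (y y1 y2 : R -> R) (l K : R) :
  (forall t, is_derive y t (y1 t)) -> (forall t, is_derive y1 t (y2 t)) ->
  (forall t, Rabs (y2 t) <= K) -> tends0 (fun t => y t - l) -> tends0 y1.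
Proof.
move=> h1 h2 hK hy e he.
have hK0 : 0 <= K by have := hK 0; have := Rabs_pos (y2 0); lra.
(* Over a step [d] the mean slope is at most [e / 2], and the variation [K * d] of [y1] is at most
   [e / 2] as well. *)
pose d := e / (2 * K + 1).
have hd : 0 < d by apply: Rdiv_lt_0_compat; lra.
have [T hT] := hy (e * d / 4) ltac:(nra).
exists T => t ht.
have [|x [hx ex]] := @mvt_le y y1 (t - d) t ltac:(lra); first by move=> s _.
have := hT t ht; have := hT (t - d) ltac:(lra) => /Rabs_le_between q1 /Rabs_le_between q2.
have q3 : - (e / 2) <= y1 x <= e / 2.
  have e1 : t - (t - d) = d by ring.
  rewrite e1 in ex; split; apply: (Rmult_le_reg_r d) => //; lra.
have := @derive_abs_le y1 y2 x t K ltac:(lra) ltac:(by []) ltac:(by []).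
move=> /Rabs_le_between q4.
have q5 : K * (t - x) <= K * d by apply: Rmult_le_compat_l; lra.
have q6 : 2 * (K * d) + d = e by rewrite /d; field; lra.
by apply: Rabs_le; lra.
Qed.

(** To the left of [t0] monotonicity decides. To the right it reduces uniqueness to a scalar
    Gronwall estimate: integrating [g * f1 - f2], with [f] bounded by its value at the right end,
    gives [f1 <= L * f]. *)
Lemma vanishing (f f1 q : R -> R) (g Q t0 : R) :
  (forall t, is_derive f t (f1 t)) ->
  (forall t, is_derive f1 t (g * f1 t - q t * f t)) ->
  (forall s t, s <= t -> f s <= f t) -> (forall t, 0 <= f t) ->
  (forall t, Rabs (q t) <= Q) -> f t0 = 0 -> forall t, f t = 0.
Proof.
move=> h1 h2 hm h0 hq hf t.
have hQ : 0 <= Q by have := hq 0; have := Rabs_pos (q 0); lra.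
case: (Rle_lt_dec t t0) => ht; first by have := hm t t0 ht; have := h0 t; lra.
have hf1 : f1 t0 = 0.
  have [] // := @second_derivative_min f f1 t0 (g * f1 t0 - q t0 * f t0).
  - exact: filter_forall.
  - by apply: filter_forall => s; rewrite hf.
pose L := Rabs g + Q * (t - t0).
have hL s : t0 <= s <= t -> f1 s <= L * f s.
  move=> hs.
  have := @derive_abs_le (fun s => g * f s - f1 s) (fun s => q s * f s) t0 s (Q * f s) ltac:(lra).
  move=> h; have : Rabs (g * f s - f1 s - (g * f t0 - f1 t0)) <= Q * f s * (s - t0).
    apply: h => x hx; first by der; ring.
    rewrite Rabs_mult (Rabs_pos_eq (f x)); last by done.
    by apply: Rmult_le_compat => //; [apply: Rabs_pos | apply: hm; lra].
  rewrite hf hf1 => /Rabs_le_between q1.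
  have q2 : g * f s <= Rabs g * f s by apply: Rmult_le_compat_r => //; apply: Rle_abs.
  have q3 : Q * f s * (s - t0) <= Q * f s * (t - t0).
    by apply: Rmult_le_compat_l; [apply: Rmult_le_pos | lra].
  rewrite /L; nra.
have : f t * exp (- L * t) <= f t0 * exp (- L * t0).
  apply: (@derive_le0_ge (fun s => f s * exp (- L * s))
    (fun s => (f1 s - L * f s) * exp (- L * s)) t0 t ltac:(lra)) => s hs.
  - by der; ring.
  - by have := hL s hs; have := exp_pos (- L * s); nra.
rewrite hf Rmult_0_l => hle.
have := exp_pos (- L * t); have := h0 t; nra.
Qed.

Record front (b r h c M : R) (phi phi1 psi psi1 : R -> R) : Prop := Front {
  fr_entire : entire b r h c M phi phi1 psi psi1;
  fr_phi_range : forall t, 0 < phi t < 1;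
  fr_psi_range : forall t, 0 <= psi t < 1;
  fr_phi0 : tends0 phi;
  fr_psi0 : tends0 psi;
  fr_psi10 : tends0 psi1;
  fr_phi_pinf : tends0 (fun t => phi (- t) - 1);
  fr_psi_pinf : tends0 (fun t => psi (- t) - 1)
}.

Lemma front_of_entire (b r h c M : R) (phi phi1 psi psi1 : R -> R) :
  0 < b -> 0 < r <= 1 -> 0 <= h -> 0 < c ->
  entire b r h c M phi phi1 psi psi1 -> psi 0 = 1 / 2 ->
  (forall t, t + c * h <= 0 -> defect b r h c phi phi1 psi psi1 t <= 0) ->
  front b r h c M phi phi1 psi psi1.
Proof.
move=> hb hr hh hc hE hpsi0 hdef.
have hrb : 0 < r / b by apply: Rdiv_lt_0_compat; lra.
have [r1 r2 d1 d2 d3 d4 b1 b2] := hE.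
have u1 := ramp_unit (Rle_refl 0) r1.
have u2 := ramp_unit (Rle_refl 0) r2.
have m1 := ramp_mono r1.
have m2 := ramp_mono r2.
pose K := c * M + 1 + b.
have B1 t : Rabs (c * phi1 t - growth r (phi t) (psi t)) <= K.
  have := growth_bound hr (u1 t) (u2 t) => /Rabs_le_between q; have := b1 t => q'.
  by apply: Rabs_le; rewrite /K; split; nra.
have B2 t : Rabs (c * psi1 t - b * phi (t - c * h) * (1 - psi t)) <= K.
  have := uptake_bound hb (u1 (t - c * h)) (u2 t) => q; have := b2 t => q'.
  by apply: Rabs_le; rewrite /K; split; nra.
have [p0 [hp0 [hp0' lp]]] := nondecreasing_limit m1 (fun t => proj1 (u1 t)).
have [s0 [hs0 [hs0' ls]]] := nondecreasing_limit m2 (fun t => proj1 (u2 t)).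
have l1 := tends0_derivative d1 d2 B1 lp.
have l2 := tends0_derivative d3 d4 B2 ls.
have hM : 0 <= M by have := b1 0; lra.
(* A positive limit of [phi] would feed [psi] on the whole half-line [t <= 0], where
   [1 - psi >= 1 / 2], against [source_bound]. *)
have ep : p0 = 0.
  case: hp0 => // hp; exfalso; pose d := b * p0 * (1 / 2).
  have hd : 0 < d by apply: Rmult_lt_0_compat; nra.
  have hx : 0 < (c + M + 1) / d by apply: Rdiv_lt_0_compat; lra.
  have := @source_bound psi psi1 _ c d M (- ((c + M + 1) / d)) 0 hc ltac:(lra)
    (fun t _ => d3 t) (fun t _ => d4 t) u2 (fun t _ => b2 t).
  have -> : d * (0 - - ((c + M + 1) / d)) = c + M + 1 by field; lra.
  move=> q; suff : c + M + 1 <= c + M by lra.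
  apply: q => t ht.
  have q1 := hp0' (t - c * h); have q2 := m2 t 0 ltac:(lra).
  by apply: Rmult_le_compat; nra.
have lp0 : tends0 phi by apply: (tends0_bound (T := 0)) lp => t _; right; f_equal; lra.
(* All terms of the defect except the one in [psi ^ 2] tend to 0 at -oo. *)
have es : s0 = 0.
  suff : r / b * (c * s0 ^ 2 / 2) <= 0.
    have : 0 <= r / b * (c * s0 ^ 2 / 2).
      by apply: Rmult_le_pos; [lra | nra].
    move=> q1 q2; have : r / b * c * (s0 * s0) = 0 by lra.
    have : 0 < r / b * c by apply: Rmult_lt_0_compat.
    move=> q3 /Rmult_integral [q4|]; first by lra.
    by case/Rmult_integral.
  pose G t := (r / b * psi1 t) + (c * phi t - phi1 t)
    + phi t * (r * (2 / b) * (c * psi (t + c * h) - psi1 (t + c * h))).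
  have hG : tends0 G.
    apply: tends0_plus; first apply: tends0_plus.
    - exact: tends0_scal.
    - by apply: tends0_minus => //; apply: tends0_scal.
    - apply: (@tends0_bounded_mult _ _ 0 (r * (2 / b) * (c + M))) => // t _.
      rewrite Rabs_mult (Rabs_pos_eq (r * (2 / b))); last by lra.
      apply: Rmult_le_compat_l; first by lra.
      have := u2 (t + c * h); have := b2 (t + c * h) => q1 q2.
      by apply: Rabs_le; split; nra.
  apply: (tends0_le_const hG (T := - (c * h))) => t ht.
  have := hdef t ltac:(lra); rewrite /defect /G.
  have q1 := hs0' t; have q2 := u2 t; have q3 := b2 t.
  have q4 : r / b * (c * s0 ^ 2 / 2) <= r / b * (c * psi t ^ 2 / 2).
    apply: Rmult_le_compat_l; first by lra.
    have : s0 ^ 2 <= psi t ^ 2 by nra.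
    nra.
  have q5 : r / b * (psi t * psi1 t) <= r / b * psi1 t.
    by apply: Rmult_le_compat_l; [lra | nra].
  lra.
have ls0 : tends0 psi by apply: (tends0_bound (T := 0)) ls => t _; right; f_equal; lra.
(* If [phi] vanishes at one point it vanishes identically. Then [psi1 >= c * psi], and from the
   value 1/2 at 0, [psi] grows at rate at least [c / 2] and exceeds 1. *)
have phi_pos t : 0 < phi t.
  apply: Rnot_le_lt => hle.
  have hz : forall t, phi t = 0.
    apply: (@vanishing phi phi1 (fun t => 1 - r - phi t + r * psi t) c 1 t) => //.
    - by move=> s; apply: derive_eq (d2 s) _; rewrite /growth; ring.
    - by move=> s; case: (u1 s).
    - by move=> s; have := u1 s; have := u2 s => q1 q2; apply: Rabs_le; split; nra.
    - by have := u1 t; lra.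
  have hconst s : c * psi s - psi1 s <= 0.
    apply: (tends0_le_const (T := s) (tends0_minus (tends0_scal c ls0) l2)) => x hx.
    apply: (@derive_le0_ge (fun t => c * psi t - psi1 t)
      (fun t => b * phi (t - c * h) * (1 - psi t)) x s hx) => y hy.
      by der; ring.
    by rewrite hz; lra.
  have : psi 0 + c / 2 * (2 / c) <= psi (2 / c).
    have h2c : 0 < 2 / c by apply: Rdiv_lt_0_compat; lra.
    have := @derive_ge0_le (fun t => psi t - c / 2 * t) (fun t => psi1 t - c / 2) 0 (2 / c)
      ltac:(lra).
    move=> hh1; have : psi 0 - c / 2 * 0 <= psi (2 / c) - c / 2 * (2 / c); last by lra.
    apply: hh1 => x hx; first by der; ring.
    have := hconst x; have := m2 0 x ltac:(lra); nra.
  have -> : c / 2 * (2 / c) = 1 by field; lra.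
  by have := u2 (2 / c); lra.
have psi_lt t : psi t < 1.
  apply: Rnot_le_lt => hle.
  have hz : forall s, 1 - psi (- s) = 0.
    apply: (@vanishing (fun s => 1 - psi (- s)) (fun s => psi1 (- s))
      (fun s => - (b * phi (- s - c * h))) (- c) b (- t)).
    - move=> s; have q := d3 (- s).
      have hn : is_derive (fun s : R => - s) s (- 1) by apply: derive_opp; apply: derive_id.
      have q' := derive_comp q hn.
      by apply: derive_eq (derive_minus (derive_const 1 s) q') _; ring.
    - move=> s; have q := d4 (- s).
      have hn : is_derive (fun s : R => - s) s (- 1) by apply: derive_opp; apply: derive_id.
      by apply: derive_eq (derive_comp q hn) _; ring.
    - by move=> s y hsy; have := m2 (- y) (- s); lra.
    - by move=> s; have := u2 (- s); lra.
    - move=> s; rewrite Rabs_Ropp; have := u1 (- s - c * h) => q.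
      by apply: Rabs_le; split; nra.
    - by rewrite Ropp_involutive; have := u2 t; lra.
  by have := hz 0; rewrite Ropp_0 hpsi0; lra.
have phi_lt t : phi t < 1.
  apply: Rnot_le_lt => hle; have e1 : phi t = 1 by have := u1 t; lra.
  have [||| hz h2] := @second_derivative_min (fun s => 1 - phi s) (fun s => - phi1 s) t
    (- (c * phi1 t - growth r (phi t) (psi t))).
  - by apply: filter_forall => s; der; ring.
  - by der; ring.
  - by apply: filter_forall => s; have := u1 s; lra.
  move: h2; rewrite /growth e1; have := psi_lt t.
  have -> : phi1 t = 0 by lra.
  nra.
(* By [source_bound] each source takes small values at arbitrarily late times. Since
   [phi >= phi 0 > 0] there, this must come from the other factor, and monotonicity makes the
   conclusion hold from then on. *)
have unbounded f f1 g e T : (forall t, is_derive f t (f1 t)) ->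
    (forall t, is_derive f1 t (c * f1 t - g t)) -> (forall t, 0 <= f t <= 1) ->
    (forall t, 0 <= f1 t <= M) -> 0 < e -> exists t, T <= t /\ g t < phi 0 * e.
  move=> h1 h2 h3 h4 he; apply: NNPP => hno.
  have hd : 0 < phi 0 * e by apply: Rmult_lt_0_compat.
  have hx : 0 < (c + M + 1) / (phi 0 * e) by apply: Rdiv_lt_0_compat; lra.
  have := @source_bound f f1 g c (phi 0 * e) M T (T + (c + M + 1) / (phi 0 * e)) hc ltac:(lra)
    (fun t _ => h1 t) (fun t _ => h2 t) h3 (fun t _ => h4 t).
  have -> : phi 0 * e * (T + (c + M + 1) / (phi 0 * e) - T) = c + M + 1.
    by field; have := phi_pos 0; split; lra.
  move=> q; suff : c + M + 1 <= c + M by lra.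
  by apply: q => t ht; apply: Rnot_lt_le => hlt; apply: hno; exists t; split=> //; lra.
have psi_end e : 0 < e -> exists T, forall t, T <= t -> 1 - psi t <= e.
  move=> he; have [T [hT hs]] := unbounded _ _ _ (b * e) (c * h) d3 d4 u2 b2 ltac:(nra).
  exists T => t ht; apply: Rnot_lt_le => hlt; have := m1 0 (T - c * h) ltac:(lra).
  have := m2 _ _ ht; have := phi_pos 0 => q1 q2 q3.
  have : phi 0 * e <= phi (T - c * h) * (1 - psi T) by apply: Rmult_le_compat; lra.
  nra.
have phi_end e : 0 < e -> exists T, forall t, T <= t -> 1 - phi t <= e.
  move=> he; have [T0 hT0] := psi_end (e / 2) ltac:(lra).
  have [T [hT hs]] := unbounded _ _ _ (e / 2) (Rmax 0 T0) d1 d2 u1 b1 ltac:(lra).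
  have q1 := Rmax_l 0 T0; have q2 := Rmax_r 0 T0; have q3 := hT0 T ltac:(lra).
  exists T => t ht; apply: Rnot_lt_le => hlt; have q4 := m1 0 T ltac:(lra).
  have q5 := m1 T t ht; have := phi_pos 0 => q6; have := u2 T => q7.
  have : phi 0 * (e / 2) <= phi T * (1 - r - phi T + r * psi T); last by rewrite -/(growth _ _ _); lra.
  by apply: Rmult_le_compat; nra.
have reflect f : (forall t, f t < 1) -> (forall e, 0 < e -> exists T, forall t, T <= t -> 1 - f t <= e) ->
    tends0 (fun t => f (- t) - 1).
  move=> h1 h2 e he; have [T hT] := h2 e he; exists (- T) => t ht.
  by have := hT (- t) ltac:(lra); have := h1 (- t) => ? ?; apply: Rabs_le; lra.
have R1 := reflect phi phi_lt phi_end; have R2 := reflect psi psi_lt psi_end.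
by split=> // t; split=> //; case: (u2 t).
Qed.

(** * Asymptotic relations at -oo *)

Lemma le_of_derive_tends0 (f df : R -> R) (T : R) :
  (forall t, t <= T -> is_derive f t (df t)) -> (forall t, t <= T -> df t <= 0) ->
  tends0 f -> forall t, t <= T -> f t <= 0.
Proof.
move=> hd h0 hf t ht; apply: (tends0_le_const (T := t) hf) => s hs.
by apply: (@derive_le0_ge f df s t hs) => x hx; [apply: hd | apply: h0]; lra.
Qed.

Lemma abs_le_of_derive (f df g dg : R -> R) T :
  (forall t, t <= T -> is_derive f t (df t)) -> (forall t, t <= T -> is_derive g t (dg t)) ->
  (forall t, t <= T -> Rabs (df t) <= dg t) -> tends0 f -> tends0 g ->
  forall t, t <= T -> Rabs (f t) <= g t.
Proof.
move=> hf hg h f0 g0 t ht.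
have h1 : f t - g t <= 0.
  apply: (@le_of_derive_tends0 (fun t => f t - g t) (fun t => df t - dg t) T) => // [s hs|s hs|].
  - by apply: derive_minus; [apply: hf | apply: hg].
  - by have /Rabs_le_between := h s hs; lra.
  - exact: tends0_minus.
have h2 : - f t - g t <= 0.
  apply: (@le_of_derive_tends0 (fun t => - f t - g t) (fun t => - df t - dg t) T) => // [s hs|s hs|].
  - by apply: derive_minus; [apply: derive_opp; apply: hf | apply: hg].
  - by have /Rabs_le_between := h s hs; lra.
  - apply: tends0_minus => //.
    by apply: (tends0_bound (T := 0)) f0 => s _; rewrite Rabs_Ropp; lra.
by apply: Rabs_le; lra.
Qed.

(** [y / om] solves an equation of the same form with coefficient [al - rho]. The weights in use are
    exponentials and powers of the flux. *)
Lemma ode_back_weighted (y al g rho om : R -> R) (T a0 G : R) : 0 < a0 ->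
  (forall t, t <= T -> is_derive y t (al t * y t - g t)) ->
  (forall t, t <= T -> 0 < om t /\ is_derive om t (rho t * om t)) ->
  (forall t, t <= T -> a0 <= al t - rho t) ->
  (forall t, t <= T -> Rabs (g t) <= G * om t) ->
  exists K, forall t, t <= T -> Rabs (y t) <= K * om t.
Proof.
move=> ha hy hom hal hg.
have hb := @ode_back_bound (fun t => y t / om t) (fun t => al t - rho t)
  (fun t => g t / om t) T a0 G ha.
exists (Rmax (Rabs (y T / om T)) (G / a0)) => t ht.
have [h1 _] := hom t ht.
have -> : y t = y t / om t * om t by field; lra.
rewrite Rabs_mult (Rabs_pos_eq (om t)); last by lra.
apply: Rmult_le_compat_r; first by lra.
apply: hb => // s hs; have [h2 h3] := hom s hs.
- der; first by lra.
  by field; lra.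
- rewrite Rabs_div; last by lra.
  rewrite (Rabs_pos_eq (om s)); last by lra.
  by apply/Rle_div_l => //; apply: hg.
Qed.

Lemma bigO_intro (f g : R -> R) (K T : R) :
  (forall t, t <= T -> Rabs (f t) <= K * Rabs (g t)) -> bigO_minf f g.
Proof. by move=> h; exists K, T => t ht; apply: h; lra. Qed.

Lemma bigO_elim (f g : R -> R) (T0 : R) : bigO_minf f g ->
  exists K T, 0 <= K /\ T <= T0 /\ forall t, t <= T -> Rabs (f t) <= K * Rabs (g t).
Proof.
move=> [K [M hM]]; exists (Rmax K 0), (Rmin (M - 1) T0).
split; first exact: Rmax_r.
split; first exact: Rmin_r.
move=> t ht; have q := Rmin_l (M - 1) T0.
apply: Rle_trans (hM t ltac:(lra)) _.
by apply: Rmult_le_compat_r; [apply: Rabs_pos | apply: Rmax_l].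
Qed.

Lemma bigO_near (T : R) (f f' g : R -> R) :
  (forall t, t <= T -> f t = f' t) -> bigO_minf f' g -> bigO_minf f g.
Proof.
by move=> e /(@bigO_elim _ _ T) [K [T' [_ [hT h]]]]; apply: (@bigO_intro _ _ K T') => t ht;
  rewrite e; [apply: h | lra].
Qed.

Lemma bigO_ext (f f' g : R -> R) :
  (forall t, f t = f' t) -> bigO_minf f' g -> bigO_minf f g.
Proof. by move=> e; apply: (bigO_near (T := 0)) => t _. Qed.

Lemma bigO_trans (g f k : R -> R) : bigO_minf f g -> bigO_minf g k -> bigO_minf f k.
Proof.
move=> /(@bigO_elim _ _ 0) [K [T [hK [_ h]]]] /(@bigO_elim _ _ T) [K' [T' [_ [hT h']]]].
apply: (@bigO_intro _ _ (K * K') T') => t ht.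
apply: Rle_trans (h t ltac:(lra)) _.
by rewrite Rmult_assoc; apply: Rmult_le_compat_l => //; apply: h'.
Qed.

Lemma bigO_refl (f : R -> R) : bigO_minf f f.
Proof. by apply: (@bigO_intro _ _ 1 0) => t _; lra. Qed.

Lemma bigO_eq (T : R) (f g : R -> R) : (forall t, t <= T -> f t = g t) -> bigO_minf f g.
Proof. by move=> e; apply: bigO_near e (bigO_refl g). Qed.

Lemma bigO_plus (f g k : R -> R) :
  bigO_minf f k -> bigO_minf g k -> bigO_minf (fun t => f t + g t) k.
Proof.
move=> /(@bigO_elim _ _ 0) [K [T [_ [_ h]]]] /(@bigO_elim _ _ T) [K' [T' [_ [hT h']]]].
apply: (@bigO_intro _ _ (K + K') T') => t ht.
have := h t ltac:(lra); have := h' t ht; have := Rabs_triang (f t) (g t); lra.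
Qed.

Lemma bigO_scal (a : R) (f g : R -> R) : bigO_minf f g -> bigO_minf (fun t => a * f t) g.
Proof.
move=> /(@bigO_elim _ _ 0) [K [T [_ [_ h]]]]; apply: (@bigO_intro _ _ (Rabs a * K) T) => t ht.
by rewrite Rabs_mult Rmult_assoc; apply: Rmult_le_compat_l; [apply: Rabs_pos | apply: h].
Qed.

Lemma bigO_minus (f g k : R -> R) :
  bigO_minf f k -> bigO_minf g k -> bigO_minf (fun t => f t - g t) k.
Proof.
move=> hf hg; apply: (@bigO_ext _ (fun t => f t + - 1 * g t)); first by move=> t; ring.
by apply: bigO_plus => //; apply: bigO_scal.
Qed.

Lemma bigO_mult (f g f' g' : R -> R) : bigO_minf f f' -> bigO_minf g g' ->
  bigO_minf (fun t => f t * g t) (fun t => f' t * g' t).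
Proof.
move=> /(@bigO_elim _ _ 0) [K [T [_ [_ h]]]] /(@bigO_elim _ _ T) [K' [T' [_ [hT h']]]].
apply: (@bigO_intro _ _ (K * K') T') => t ht; rewrite !Rabs_mult.
have -> : K * K' * (Rabs (f' t) * Rabs (g' t)) = K * Rabs (f' t) * (K' * Rabs (g' t)) by ring.
by apply: Rmult_le_compat; try exact: Rabs_pos; [apply: h; lra | apply: h'].
Qed.

Lemma bigO_tends0 (f g : R -> R) : bigO_minf f g -> tends0 g -> tends0 f.
Proof.
move=> /(@bigO_elim _ _ 0) [K [T [hK [_ h]]]] hg.
apply: (tends0_bound (T := T) _ (tends0_scal K hg)) => t /h.
by rewrite Rabs_mult (Rabs_pos_eq K).
Qed.

Lemma bigO_tends0_const (f : R -> R) : tends0 f -> bigO_minf f (fun _ => 1).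
Proof.
by move=> /(_ 1 Rlt_0_1) [T hT]; apply: (@bigO_intro _ _ 1 T) => t /hT; rewrite Rabs_R1; lra.
Qed.

(** [f - K * G] and [f + K * G] are monotone near -oo. The summand 1 covers a bounded [G], where
    only boundedness of [f] results. *)
Lemma bigO_integral (f df G dG : R -> R) (T : R) :
  (forall t, t <= T -> is_derive f t (df t)) -> (forall t, t <= T -> is_derive G t (dG t)) ->
  (forall t, t <= T -> 0 <= dG t) -> bigO_minf df dG ->
  bigO_minf f (fun t => 1 + Rabs (G t)).
Proof.
move=> hf hG h0 /(@bigO_elim _ _ T) [K [T' [hK [hT h]]]].
apply: (@bigO_intro _ _ (Rabs (f T') + K * Rabs (G T') + K) T') => t ht.
have key s : t <= s <= T' -> Rabs (df s) <= K * dG s.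
  by move=> hs; rewrite -(Rabs_pos_eq (dG s)); [apply: h | apply: h0]; lra.
have q1 : f T' - K * G T' <= f t - K * G t.
  apply: (@derive_le0_ge (fun t => f t - K * G t) (fun t => df t - K * dG t) t T' ht) => s hs.
  - have w1 := hf s ltac:(lra); have w2 := hG s ltac:(lra); der; ring.
  - by have /Rabs_le_between := key s hs; lra.
have q2 : f t + K * G t <= f T' + K * G T'.
  apply: (@derive_ge0_le (fun t => f t + K * G t) (fun t => df t + K * dG t) t T' ht) => s hs.
  - have w1 := hf s ltac:(lra); have w2 := hG s ltac:(lra); der; ring.
  - by have /Rabs_le_between := key s hs; lra.
have w1 := Rabs_pos (f T'); have w2 := Rabs_pos (G T'); have w3 := Rabs_pos (G t).
have w4 : 0 <= K * Rabs (G T') by apply: Rmult_le_pos.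
have w5 : K * (G T' - G t) <= K * (Rabs (G T') + Rabs (G t)).
  by apply: Rmult_le_compat_l => //; have := Rle_abs (G T'); have := Rle_abs (- G t);
    rewrite Rabs_Ropp; lra.
rewrite (Rabs_pos_eq (1 + _)); last by lra.
apply: Rle_trans (_ : Rabs (f T') + K * (Rabs (G T') + Rabs (G t)) <= _); last by nra.
by have := Rle_abs (f T'); have := Rle_abs (- f T'); rewrite Rabs_Ropp => w6 w7;
  apply: Rabs_le; lra.
Qed.

Lemma bigO_exp (a e : R) : a <= e -> bigO_minf (fun t => exp (e * t)) (fun t => exp (a * t)).
Proof.
move=> h; apply: (@bigO_intro _ _ 1 0) => t ht.
rewrite !Rabs_pos_eq; try (by left; apply: exp_pos).
by rewrite Rmult_1_l; apply: exp_le; nra.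
Qed.

Lemma bigO_exp_mult (f g : R -> R) (a e k : R) : k <= a + e ->
  bigO_minf f (fun t => exp (a * t)) -> bigO_minf g (fun t => exp (e * t)) ->
  bigO_minf (fun t => f t * g t) (fun t => exp (k * t)).
Proof.
move=> hk hf hg; apply: bigO_trans (bigO_mult hf hg) _; apply: bigO_trans (bigO_exp hk).
by apply: bigO_ext (bigO_refl _) => t; rewrite -exp_plus; f_equal; ring.
Qed.

Lemma bigO_exp_shift (f : R -> R) (a s : R) : bigO_minf f (fun t => exp (a * t)) ->
  bigO_minf (fun t => f (t - s)) (fun t => exp (a * t)).
Proof.
move=> /(@bigO_elim _ _ 0) [K [T [_ [_ h]]]].
apply: (@bigO_intro _ _ (K * Rabs (exp (- a * s))) (T + s)) => t ht.
rewrite Rmult_assoc -Rabs_mult -exp_plus.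
have -> : - a * s + a * t = a * (t - s) by ring.
by apply: h; lra.
Qed.

Lemma bigO_ode_exp (y al g : R -> R) (a rho : R) : rho < a ->
  (forall t, is_derive y t (al t * y t - g t)) -> tends0 (fun t => al t - a) ->
  bigO_minf g (fun t => exp (rho * t)) -> bigO_minf y (fun t => exp (rho * t)).
Proof.
move=> hrho hy hal hg; have [T0 h0] := hal ((a - rho) / 2) ltac:(lra).
have [K [T [_ [hT h]]]] := bigO_elim T0 hg.
have pos t : Rabs (exp (rho * t)) = exp (rho * t).
  by rewrite Rabs_pos_eq //; left; apply: exp_pos.
have h' t : t <= T -> Rabs (g t) <= K * exp (rho * t) by rewrite -pos; apply: h.
have [K' hK'] := @ode_back_weighted y al g (fun _ => rho) (fun t => exp (rho * t)) T
  ((a - rho) / 2) K ltac:(lra) (fun t _ => hy t)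
  ltac:(by move=> t _; split; [apply: exp_pos | der; ring])
  ltac:(by move=> t ht; have /Rabs_le_between := h0 t ltac:(lra); lra) h'.
by apply: (@bigO_intro _ _ K' T) => t ht; rewrite pos; apply: hK'.
Qed.

Lemma bigO_integral_exp (f df : R -> R) (rho : R) : 0 < rho ->
  (forall t, is_derive f t (df t)) -> tends0 f ->
  bigO_minf df (fun t => exp (rho * t)) -> bigO_minf f (fun t => exp (rho * t)).
Proof.
move=> hrho hf f0 /(@bigO_elim _ _ 0) [K [T [hK [_ h]]]].
have pos t : Rabs (exp (rho * t)) = exp (rho * t).
  by rewrite Rabs_pos_eq //; left; apply: exp_pos.
apply: (@bigO_intro _ _ (K / rho) T) => t ht; rewrite pos.
apply: (@abs_le_of_derive f df (fun t => K / rho * exp (rho * t)) (fun t => K * exp (rho * t)) T)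
  => // [s _|s /h|]; first by der; field; lra.
- by rewrite pos.
- by apply: tends0_scal; apply: tends0_exp.
Qed.

(** * Decay of the wave against decay of the super-solution *)

(** Backward in time [la] attracts and [mu] repels. Staying above [mu] is excluded by
    [riccati_blowup]; once [p] is below [mu - d1] it remains there at all earlier times, and
    [p - la] solves a linear equation with coefficient [mu - p >= d1]. *)
Lemma riccati_dichotomy (p eps : R -> R) (la mu : R) : la < mu ->
  (forall t, is_derive p t (- (p t - la) * (p t - mu) - eps t)) -> tends0 eps ->
  tends0 (fun t => p t - la) \/ tends0 (fun t => p t - mu).
Proof.
move=> hlm hd heps.
case: (classic (tends0 (fun t => p t - mu))) => hmu; [by right | left].
have [d0 [hd0 hfar]] : exists d, 0 < d /\ forall T, exists t, t <= T /\ d < Rabs (p t - mu).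
  apply: NNPP => hno; apply: hmu => e he; apply: NNPP => hno'; apply: hno.
  exists e; split=> // T; apply: NNPP => hno''; apply: hno'; exists T => t ht.
  by apply: Rnot_lt_le => hlt; apply: hno''; exists t.
have [d1 [hd1 [hd10 hd1m]]] := @exists_small d0 ((mu - la) / 2) hd0 ltac:(lra).
have hdd : 0 < d1 * (mu - la - d1) by apply: Rmult_lt_0_compat; lra.
have [T1 hT1] := heps (d1 * (mu - la - d1) / 2) ltac:(lra).
have hup t : t <= T1 -> p t - mu <= d1.
  apply: (@riccati_blowup (fun t => p t - mu) (fun t => - (p t - la) * (p t - mu) - eps t) T1 1 d1)
    => //; first by lra.
  - by move=> s _; der; ring.
  - move=> s hs hbig; have /Rabs_le_between q := hT1 s hs.
    have : d1 * (mu - la - d1) <= (mu - la) * (p s - mu) by apply: Rle_trans (_ : (mu - la) * d1 <= _); nra.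
    nra.
have [t0 [ht0 hfar0]] := hfar T1.
have hp0 : p t0 < mu - d1.
  have := hup t0 ht0; move: hfar0; rewrite /Rabs; case: Rcase_abs; lra.
have hlow t : t <= t0 -> p t < mu - d1.
  move=> ht; apply: Rnot_le_lt => hle.
  have [|||s [hs [es habove]]] := @last_crossing (fun t => - p t) t t0 (- (mu - d1)) ht.
  - move=> x _; apply: (derive_continuous (a := - (- (p x - la) * (p x - mu) - eps x))).
    by apply: derive_opp.
  - lra.
  - lra.
  have es' : p s = mu - d1 by lra.
  have /Rabs_le_between q := hT1 s ltac:(lra).
  have [|e [he hright]] := derive_slope (m := 0) (hd s); first by rewrite es'; nra.
  have [y [hy [hy1 hy2]]] := exists_small he (Rlt_Rminus _ _ (proj2 hs)).
  by have [h4 _] := hright y ltac:(lra); have := habove (s + y) ltac:(lra); lra.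
apply: (@ode_back_tends0 _ (fun t => mu - p t) eps t0 d1) => // t ht.
- by der; ring.
- by have := hlow t ht; lra.
Qed.

Section Flux.
Variables (b r h c M : R) (phi phi1 psi psi1 : R -> R).
Hypotheses (hb : 0 < b) (hr : 0 < r <= 1) (hh : 0 <= h) (hc : 0 < c).
Hypothesis hF : front b r h c M phi phi1 psi psi1.

Definition flux (t : R) : R := c * psi t - psi1 t.

Lemma flux_derive t : is_derive flux t (b * phi (t - c * h) * (1 - psi t)).
Proof.
have q1 := en_psi (fr_entire hF) t; have q2 := en_psi1 (fr_entire hF) t.
rewrite /flux; der; ring.
Qed.

Lemma flux_derive_pos t : 0 < b * phi (t - c * h) * (1 - psi t).
Proof.
have q1 := fr_phi_range hF (t - c * h); have q2 := fr_psi_range hF t.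
by apply: Rmult_lt_0_compat; [nra | lra].
Qed.

Lemma flux_tends0 : tends0 flux.
Proof.
by apply: tends0_minus; [apply: tends0_scal; apply: (fr_psi0 hF) | apply: (fr_psi10 hF)].
Qed.

Lemma flux_mono s t : s <= t -> flux s <= flux t.
Proof.
move=> hst; apply: (derive_ge0_le hst) => x _; first exact: flux_derive.
exact: Rlt_le (flux_derive_pos x).
Qed.

Lemma flux_pos t : 0 < flux t.
Proof.
have h1 : flux (t - 1) < flux t.
  have [s _|s _|x [_ e]] := @mvt flux (fun t => b * phi (t - c * h) * (1 - psi t)) (t - 1) t ltac:(lra).
  - exact: flux_derive.
  - exact: derive_continuous (flux_derive s).
  by have := flux_derive_pos x; lra.
suff : 0 <= flux (t - 1) by lra.
apply: Rnot_lt_le => hneg.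
have hn : tends0 (fun t => - flux t).
  by apply: (tends0_bound (T := 0)) flux_tends0 => s _; rewrite Rabs_Ropp; lra.
have := tends0_le_const (a := - flux (t - 1)) (T := t - 1) hn.
move=> h2; have := h2 (fun s hs => Ropp_le_contravar _ _ (flux_mono hs)); lra.
Qed.

Lemma phi_mono s t : s <= t -> phi s <= phi t.
Proof. by move=> hst; have := ramp_lip (en_phi_ramp (fr_entire hF)) hst; lra. Qed.

Lemma psi_mono s t : s <= t -> psi s <= psi t.
Proof. by move=> hst; have := ramp_lip (en_psi_ramp (fr_entire hF)) hst; lra. Qed.

(** The rate passes from [phi] to the flux by integrating its derivative, at most [b * phi], and
    from the flux to [psi] because [rho < c]. *)
Lemma psi_exp_bound (rho : R) : 0 < rho < c -> bigO_minf phi (fun t => exp (rho * t)) ->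
  bigO_minf psi (fun t => exp (rho * t)).
Proof.
move=> hrho hphi; have hch : 0 <= c * h by apply: Rmult_le_pos; lra.
apply: (@bigO_ode_exp psi (fun _ => c) flux c) => [|t||]; first by lra.
- by apply: derive_eq (en_psi (fr_entire hF) t) _; rewrite /flux; ring.
- by move=> e he; exists 0 => t _; rewrite Rminus_diag Rabs_R0; lra.
apply: (bigO_integral_exp _ flux_derive flux_tends0); first by lra.
apply: bigO_trans hphi; apply: (@bigO_intro _ _ b 0) => t _.
have q1 := @phi_mono (t - c * h) t ltac:(lra); have q2 := fr_psi_range hF t.
have q3 := fr_phi_range hF (t - c * h); have q4 := flux_derive_pos t.
rewrite !Rabs_pos_eq; try lra.
have : b * phi (t - c * h) * (1 - psi t) <= b * phi t * 1 by apply: Rmult_le_compat; nra.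
lra.
Qed.

End Flux.

(** The shifts that put the super-solution above the wave form a closed half-line, bounded below
    since [Phi] tends to 0 at -oo. At the extremal shift there is contact at a finite point: faster
    decay prevents it near -oo, and [Phi = Psi = 1] near +oo. As each reaction term is nondecreasing
    in the other component, the strict inequality of the super-solution fails there. *)
Lemma slide_contradiction (b r h c M : R) (Phi Psi phi phi1 psi psi1 : R -> R)
  (nu nu' k T : R) :
  0 < b -> 0 < r <= 1 -> super b r h c Phi Psi -> front b r h c M phi phi1 psi psi1 ->
  nu < nu' -> 0 < k ->
  (forall t, t <= T -> k * exp (nu * t) <= Phi t /\ k * exp (nu * t) <= Psi t) ->
  bigO_minf phi (fun t => exp (nu' * t)) -> bigO_minf psi (fun t => exp (nu' * t)) -> False.
Proof.
move=> hb hr hS hF hnn hk hlow hphi hpsi.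
have [T4 hT4] := super_pinf hS.
have hleft s0 : exists T', forall t, t <= T' -> phi t <= Phi (t + s0) /\ psi t <= Psi (t + s0).
  have small f : bigO_minf f (fun t => exp (nu' * t)) ->
      exists T', forall t, t <= T' -> f t <= k * exp (nu * (t + s0)).
    move=> hf; have h0 : tends0 (fun t => f t * exp (- nu * t)).
      apply: bigO_tends0 (@tends0_exp (nu' - nu) ltac:(lra)).
      by apply: (bigO_exp_mult _ hf (bigO_refl _)); lra.
    have [T' hT'] := h0 (k * exp (nu * s0)) ltac:(apply: Rmult_lt_0_compat; [lra | apply: exp_pos]).
    exists T' => t ht; have := Rle_trans _ _ _ (Rle_abs _) (hT' t ht).
    have -> : nu * (t + s0) = nu * s0 + nu * t by ring.
    rewrite exp_plus => h1; have q := exp_pos (nu * t).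
    have := Rmult_le_compat_r _ _ _ (Rlt_le _ _ q) h1.
    rewrite Rmult_assoc -exp_plus; have -> : - nu * t + nu * t = 0 by ring.
    by rewrite exp_0; lra.
  have [T1 h1] := small _ hphi; have [T2 h2] := small _ hpsi.
  exists (Rmin (Rmin T1 T2) (T - s0)) => t ht.
  have q1 := Rmin_l (Rmin T1 T2) (T - s0); have q2 := Rmin_r (Rmin T1 T2) (T - s0).
  have q3 := Rmin_l T1 T2; have q4 := Rmin_r T1 T2.
  have [h3 h4] := hlow (t + s0) ltac:(lra).
  by have := h1 t ltac:(lra); have := h2 t ltac:(lra); lra.
have hright s0 t : T4 - s0 <= t -> phi t <= Phi (t + s0) /\ psi t <= Psi (t + s0).
  move=> ht; have [-> ->] := hT4 (t + s0) ltac:(lra).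
  by have := fr_phi_range hF t; have := fr_psi_range hF t; lra.
pose S s := forall t, phi t <= Phi (t + s) /\ psi t <= Psi (t + s).
have hup s s' : S s -> s <= s' -> S s'.
  move=> hs hss t; have [h1 h2] := hs t.
  by have := @super_monol _ _ _ _ _ _ hS (t + s) (t + s') ltac:(lra);
    have := @super_monor _ _ _ _ _ _ hS (t + s) (t + s') ltac:(lra); lra.
have [sig hsig] : exists s, S s.
  have [T' hT'] := hleft 0; exists (Rmax 0 (T4 - T')) => t.
  have q1 := Rmax_l 0 (T4 - T'); have q2 := Rmax_r 0 (T4 - T').
  case: (Rle_lt_dec t T') => ht; last by apply: hright; lra.
  have [h1 h2] := hT' t ht; rewrite Rplus_0_r in h1 h2.
  by have := @super_monol _ _ _ _ _ _ hS t (t + Rmax 0 (T4 - T')) ltac:(lra);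
    have := @super_monor _ _ _ _ _ _ hS t (t + Rmax 0 (T4 - T')) ltac:(lra); lra.
have [s1 hs1] : exists s, ~ S s.
  have hp := fr_phi_range hF 0.
  have [T' hT'] := super_minfl hS (e := phi 0 / 2) ltac:(lra).
  exists T' => /(_ 0) [h1 _]; rewrite Rplus_0_l in h1.
  by have := hT' T' (Rle_refl _); have := Rle_abs (Phi T'); lra.
have [ss [hss1 hss2]] : {s | is_lub (fun s => ~ S s) s}.
  apply: completeness; last by exists s1.
  exists sig => s hs; apply: Rnot_lt_le => hlt; apply: hs; apply: hup hsig _; lra.
have hgt s : ss < s -> S s.
  by move=> hs; apply: NNPP => hn; have := hss1 s hn; lra.
have hSs : S ss.
  have cont (F : R -> R) v t : (forall t, continuous F t) -> (forall s, ss < s -> v <= F (t + s)) ->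
      v <= F (t + ss).
    move=> hc hv; apply: Rnot_lt_le => hlt.
    have [e [he hloc]] := proj1 (locally_ex _ _) (continuous_locally_lt (hc (t + ss)) hlt).
    have := hv (ss + e / 2) ltac:(lra).
    have := hloc (t + (ss + e / 2)) ltac:(rewrite Rabs_pos_eq; lra); lra.
  move=> t; split.
    by apply: (cont Phi _ t (super_contl hS)) => s hs; case: (hgt s hs t).
  by apply: (cont Psi _ t (super_contr hS)) => s hs; case: (hgt s hs t).
have hSs' (y : R) : phi (y - ss) <= Phi y /\ psi (y - ss) <= Psi y.
  by have := hSs (y - ss); have -> : y - ss + ss = y by ring.
have [U hU] := ultra_exists.
(* A pair of a point and a shift at which the order fails. For shifts tending to [ss] from below
   such points stay in a bounded interval, by comparison with the shift [ss - 1], and their limit is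
   the contact point. *)
pose bad (p : R * R) := phi p.1 > Phi (p.1 + p.2) \/ psi p.1 > Psi (p.1 + p.2).
have hbad n : exists p, bad p /\ ss - / (INR n + 1) <= p.2 <= ss.
  have hn := pos_INR n; have hn' : 0 < / (INR n + 1) by apply: Rinv_0_lt_compat; lra.
  have [s [hs hs']] : exists s, ~ S s /\ ss - / (INR n + 1) <= s.
    apply: NNPP => hno; have : ss <= ss - / (INR n + 1); last by lra.
    by apply: hss2 => s hs; apply: Rnot_lt_le => hlt; apply: hno; exists s; split=> //; lra.
  have [t ht] : exists t, ~ (phi t <= Phi (t + s) /\ psi t <= Psi (t + s)).
    by apply: not_all_ex_not.
  exists (t, s); split=> /=; last by have := hss1 s hs; lra.
  by case: (Rle_lt_dec (phi t) (Phi (t + s))) => h1; [right | left] => //=;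
    apply: Rnot_le_gt => h2; apply: ht.
pose f n := proj1_sig (constructive_indefinite_description _ (hbad n)).
have hf n : bad (f n) /\ ss - / (INR n + 1) <= (f n).2 <= ss.
  by rewrite /f; case: constructive_indefinite_description.
pose tt n := (f n).1; pose sn n := (f n).2.
have hinv n : / (INR n + 1) <= 1.
  by rewrite -Rinv_1; apply: Rinv_le_contravar; have := pos_INR n; lra.
have [T' hT'] := hleft (ss - 1).
have htt n : T' <= tt n <= T4 - ss + 1.
  have [hb' hs'] := hf n; have hi := hinv n.
  have no : ~ (phi (tt n) <= Phi (tt n + (ss - 1)) /\ psi (tt n) <= Psi (tt n + (ss - 1))).
    move=> [h1 h2].
    have := @super_monol _ _ _ _ _ _ hS (tt n + (ss - 1)) (tt n + sn n) ltac:(rewrite /sn; lra).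
    have := @super_monor _ _ _ _ _ _ hS (tt n + (ss - 1)) (tt n + sn n) ltac:(rewrite /sn; lra).
    by case: hb'; rewrite -/(tt n) -/(sn n); lra.
  split; apply: Rnot_lt_le => hlt; apply: no; first by apply: hT'; lra.
  by apply: hright; lra.
have [t lt] := ulim_exists hU (ultra_all hU htt).
have ls : ulim U sn ss.
  move=> e he; have [N hN] := INR_unbounded (/ e).
  apply: (ultra_imp hU) (ultra_tail hU N) => n /le_INR hn.
  have [_ hs'] := hf n; have hi : / (INR n + 1) < e.
    rewrite -(Rinv_inv e); apply: Rinv_lt_contravar; last by lra.
    by apply: Rmult_lt_0_compat; [apply: Rinv_0_lt_compat | have := pos_INR n; lra].
  by apply: Rabs_def1; rewrite /sn; lra.
have lts : ulim U (fun n => tt n + sn n) (t + ss) by apply: ulim_plus.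
have E := fr_entire hF; have e2 : t + ss - ss = t by ring.
have lim (u F : R -> R) : (forall t, continuous u t) -> (forall t, continuous F t) ->
    U (fun n => u (tt n) > F (tt n + sn n)) -> F (t + ss) <= u t.
  move=> cf cF hn; apply: (ulim_le hU (ulim_continuous hU (cF _) lts) (ulim_continuous hU (cf _) lt)).
  by apply: (ultra_imp hU) hn => n; lra.
have touch (u u1 F : R -> R) u2 : (forall t, is_derive u t (u1 t)) -> is_derive u1 t u2 ->
    (forall y, u (y - ss) <= F y) -> F (t + ss) <= u t ->
    touches (fun y => u (y - ss)) (fun y => u1 (y - ss)) (t + ss) u2 F /\ F (t + ss) = u t.
  move=> df df1 hle heq; have e1 : F (t + ss) = u t by have := hle (t + ss); rewrite e2; lra.
  split=> //; split; first by apply: filter_forall => y; apply: derive_shift_sub.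
  split; first by apply: derive_shift_sub; rewrite e2.
  by split; [apply: filter_forall | rewrite e2 e1].
case: (ultra_dec hU (fun n => phi (tt n) > Phi (tt n + sn n))) => hcase.
- have [h1 e1] := touch _ _ _ _ (en_phi E) (en_phi1 E t) (fun y => proj1 (hSs' y))
    (lim _ _ (fun t => derive_continuous (en_phi E t)) (super_contl hS) hcase).
  have q := fr_phi_range hF t; have := super_phi hS h1 ltac:(lra).
  rewrite e1 e2 /growth; have [_ q2] := hSs t.
  have : 0 <= phi t * r * (Psi (t + ss) - psi t) by apply: Rmult_le_pos; nra.
  lra.
- have [|h1 e1] := touch _ _ _ _ (en_psi E) (en_psi1 E t) (fun y => proj2 (hSs' y)).
    apply: (lim _ _ (fun t => derive_continuous (en_psi E t)) (super_contr hS)).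
    by apply: (ultra_imp hU) hcase => n hn; have [[hb'|hb'] _] := hf n; first by case: hn.
  have q := fr_psi_range hF t; have := super_psi hS h1 ltac:(lra).
  rewrite e1 e2; have [q2 _] := hSs (t - c * h).
  have e3 : t - c * h + ss = t + ss - c * h by ring.
  rewrite e3 in q2.
  have : 0 <= b * (Phi (t + ss - c * h) - phi (t - c * h)) * (1 - psi t).
    by apply: Rmult_le_pos; nra.
  lra.
Qed.

Lemma chi_facts (r c : R) : 0 < r <= 1 -> 2 * sqrt (1 - r) < c ->
  [/\ chi_lambda r c + chi_mu r c = c, chi_lambda r c * chi_mu r c = 1 - r,
      chi_lambda r c < chi_mu r c, 0 <= chi_lambda r c & (r < 1 -> 0 < chi_lambda r c)].
Proof.
move=> hr hc.
have [h1 [h2 h3]] := @chi_roots r c (proj2 hr) hc.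
have h4 : chi_lambda r c + chi_mu r c = c by rewrite /chi_lambda /chi_mu; field.
have h5 : chi_lambda r c * chi_mu r c = 1 - r.
  have -> : chi_mu r c = c - chi_lambda r c by lra.
  by move: h1; rewrite /chi; lra.
have hc0 : 0 < c by have := sqrt_pos (1 - r); lra.
have h6 : 0 <= chi_lambda r c by apply: Rnot_lt_le => hn; nra.
split=> // hr1; case: h6 => // e; rewrite -e in h5; lra.
Qed.

Lemma log_derivative (b r h c M : R) (phi phi1 psi psi1 : R -> R) (t : R) :
  front b r h c M phi phi1 psi psi1 ->
  is_derive (fun t => phi1 t / phi t) t
    (c * (phi1 t / phi t) - (phi1 t / phi t) ^ 2 - (1 - r - phi t + r * psi t)).
Proof.
move=> hF; have q1 := en_phi (fr_entire hF) t; have q2 := en_phi1 (fr_entire hF) t.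
have q3 := fr_phi_range hF t.
der; first by lra.
by rewrite /growth; field; lra.
Qed.

Lemma phi_exp_bound (b r h c M : R) (phi phi1 psi psi1 : R -> R) (rho l : R) :
  front b r h c M phi phi1 psi psi1 -> tends0 (fun t => phi1 t / phi t - l) -> rho < l ->
  bigO_minf phi (fun t => exp (rho * t)).
Proof.
move=> hF hp hrho; have [T hT] := hp (l - rho) ltac:(lra).
apply: (@bigO_intro _ _ (phi T * exp (- rho * T)) T) => t ht.
have : phi t * exp (- rho * t) <= phi T * exp (- rho * T).
  apply: (@derive_ge0_le (fun t => phi t * exp (- rho * t))
    (fun t => (phi1 t / phi t - rho) * (phi t * exp (- rho * t))) t T ht) => s hs.
  - have q1 := en_phi (fr_entire hF) s; have q3 := fr_phi_range hF s.
    by der; field; lra.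
  - have /Rabs_le_between q := hT s ltac:(lra); have q3 := fr_phi_range hF s.
    by have q4 := exp_pos (- rho * s); apply: Rmult_le_pos; [lra | nra].
move=> /(Rmult_le_compat_r _ _ _ (Rlt_le _ _ (exp_pos (rho * t)))).
rewrite Rmult_assoc -exp_plus; have -> : - rho * t + rho * t = 0 by ring.
have q3 := fr_phi_range hF t; rewrite exp_0 !Rabs_pos_eq; first lra; last by lra.
by left; apply: exp_pos.
Qed.

Lemma front_slow (b r h c M : R) (Phi Psi phi phi1 psi psi1 : R -> R) :
  0 < b -> 0 < r <= 1 -> 0 <= h -> 2 * sqrt (1 - r) < c ->
  super b r h c Phi Psi -> front b r h c M phi phi1 psi psi1 ->
  tends0 (fun t => phi1 t / phi t - chi_lambda r c).
Proof.
move=> hb hr hh hc hS hF.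
have hc0 : 0 < c by have := sqrt_pos (1 - r); lra.
have [hsum hprod hlm hl0 _] := chi_facts hr hc.
set la := chi_lambda r c in hsum hprod hlm hl0 *; set mu := chi_mu r c in hsum hprod hlm *.
have hd t : is_derive (fun t => phi1 t / phi t) t
    (- (phi1 t / phi t - la) * (phi1 t / phi t - mu) - (r * psi t - phi t)).
  by apply: derive_eq (log_derivative t hF) _; rewrite -hsum -hprod; ring.
have heps : tends0 (fun t => r * psi t - phi t).
  by apply: tends0_minus; [apply: tends0_scal; apply: (fr_psi0 hF) | apply: (fr_phi0 hF)].
case: (riccati_dichotomy hlm hd heps) => // hmu; exfalso.
have [nu [k [T1 [hnu [hnu2 [hk hlow]]]]]] := super_exp hS.
rewrite -/la -/mu in hnu2.
(* The rate [(nu + mu) / 2] exceeds that of the super-solution and stays below [mu], hence below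
   [c], as [psi_exp_bound] requires. *)
have hphi := phi_exp_bound (rho := (nu + mu) / 2) hF hmu ltac:(lra).
have hpsi := @psi_exp_bound b r h c M phi phi1 psi psi1 hb hh hc0 hF ((nu + mu) / 2) ltac:(lra) hphi.
apply: (slide_contradiction hb hr hS hF _ hk hlow hphi hpsi); lra.
Qed.

(** * Exponential asymptotics, r < 1 *)

Lemma derive_exp_limit (L w : R -> R) (d : R) : 0 < d -> (forall t, is_derive L t (w t)) ->
  bigO_minf w (fun t => exp (d * t)) ->
  exists l, bigO_minf (fun t => L t - l) (fun t => exp (d * t)).
Proof.
move=> hd hL hw; have [K [T [hK [_ hT]]]] := bigO_elim 0 hw.
have {}hT t : t <= T -> - (K * exp (d * t)) <= w t <= K * exp (d * t).
  move=> /hT; rewrite (Rabs_pos_eq (exp _)); last by left; apply: exp_pos.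
  by move=> /Rabs_le_between.
pose E t := K / d * exp (d * t).
have hE t : 0 <= E t.
  by apply: Rmult_le_pos; [apply: Rmult_le_pos => // |]; left; [apply: Rinv_0_lt_compat | apply: exp_pos].
have dE t : is_derive E t (K * exp (d * t)) by rewrite /E; der; field; lra.
have mono sg s t : sg = 1 \/ sg = -1 -> s <= t -> t <= T -> sg * L s + E s <= sg * L t + E t.
  move=> hsg hst ht; apply: (@derive_ge0_le (fun t => sg * L t + E t)
    (fun t => sg * w t + K * exp (d * t))) => // x hx; first by der; ring.
  by have := hT x ltac:(lra); case: hsg => ->; lra.
have hm t : Rmin t T <= T by apply: Rmin_r.
(* Truncating at [T] and subtracting a constant makes [L + E] monotone and nonnegative on the whole
   line; nonnegativity is the monotonicity of [- L + E]. *)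
have [l [_ [_ hl]]] := @nondecreasing_limit (fun t => L (Rmin t T) + E (Rmin t T) - (L T - E T))
  ltac:(by move=> s t hst; have := mono 1 _ _ ltac:(by left) (Rle_min_compat_r _ _ T hst) (hm t); lra)
  ltac:(by move=> t; have := mono (-1) (Rmin t T) T ltac:(by right) (hm t) (Rle_refl _);
        have := hE (Rmin t T); lra).
exists (l + (L T - E T)); apply: (bigO_integral_exp hd (df := w)) => // [t|].
  by rewrite -(Rminus_0_r (w t)); apply: derive_minus (hL t) (derive_const _ _).
apply: (tends0_bound (T := T)) (tends0_minus hl (tends0_scal (K / d) (tends0_exp hd))) => t ht.
by rewrite Rmin_left // /E; right; f_equal; ring.
Qed.

Lemma exp_minus_1_le (x : R) : Rabs x <= 1 / 2 -> Rabs (exp x - 1) <= 2 * Rabs x.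
Proof.
move=> /Rabs_le_between hx; have h1 := exp_ineq1_le x; have h2 := exp_ineq1_le (- x).
have h3 : exp x * exp (- x) = 1 by rewrite -exp_plus Rplus_opp_r exp_0.
have := Rle_abs x; have := Rle_abs (- x); rewrite Rabs_Ropp => q1 q2.
by apply: Rabs_le; split; [lra | case: (Rle_lt_dec 0 x) => ?; nra].
Qed.

Lemma bigO_exp_minus_1 (f : R -> R) : tends0 f -> bigO_minf (fun t => exp (f t) - 1) f.
Proof.
move=> /(_ (1 / 2) ltac:(lra)) [T hT]; apply: (@bigO_intro _ _ 2 T) => t ht.
exact: exp_minus_1_le (hT t ht).
Qed.

Lemma fast_asymptotics (b r h c M : R) (phi phi1 psi psi1 : R -> R) :
  0 < b -> 0 < r < 1 -> 0 <= h -> 2 * sqrt (1 - r) < c ->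
  front b r h c M phi phi1 psi psi1 ->
  tends0 (fun t => phi1 t / phi t - chi_lambda r c) ->
  exists l d, 0 < d /\
    bigO_minf (fun t => phi t - exp l * exp (chi_lambda r c * t))
      (fun t => exp ((chi_lambda r c + d) * t)) /\
    bigO_minf (fun t => psi t - b * exp l / (1 - r) * exp (chi_lambda r c * (t - c * h)))
      (fun t => exp ((chi_lambda r c + d) * t)).
Proof.
move=> hb hr hh hc hF hp.
have hr' : 0 < r <= 1 by lra.
have hc0 : 0 < c by have := sqrt_pos (1 - r); lra.
have [hsum hprod hlm hl0 hlpos] := chi_facts hr' hc.
have {hlpos hl0} hl := hlpos (proj2 hr).
set la := chi_lambda r c in hsum hprod hlm hl hp *; set mu := chi_mu r c in hsum hprod hlm.
(* [d] is limited by the source of [p - la], which decays at the crude rate [la / 2], and by the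
   spectral gap [mu - la] of its linear part. *)
have [d [hd [hd1 hd2]]] := @exists_small (la / 2) ((mu - la) / 2) ltac:(lra) ltac:(lra).
have phi2 := phi_exp_bound (rho := la / 2) hF hp ltac:(lra).
have psi2 := @psi_exp_bound b r h c M phi phi1 psi psi1 hb hh hc0 hF (la / 2) ltac:(lra) phi2.
have hw : bigO_minf (fun t => phi1 t / phi t - la) (fun t => exp (d * t)).
  apply: (@bigO_ode_exp _ (fun t => mu - phi1 t / phi t) (fun t => r * psi t - phi t) (mu - la))
    => [|t||]; first by lra.
  - apply: derive_eq (derive_minus (log_derivative t hF) (derive_const la t)) _.
    by rewrite -hsum -hprod; ring.
  - by apply: (tends0_bound (T := 0)) hp => t _; rewrite -Rabs_Ropp; right; f_equal; ring.
  - by apply: bigO_trans (bigO_exp (Rlt_le _ _ hd1)); apply: bigO_minus => //; apply: bigO_scal.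
have [|l heta] := @derive_exp_limit (fun t => ln (phi t) - la * t) (fun t => phi1 t / phi t - la) d hd
  _ hw.
  move=> t; have q1 := en_phi (fr_entire hF) t; have q2 := fr_phi_range hF t.
  by der; [lra | ring].
have hphi : bigO_minf (fun t => phi t - exp l * exp (la * t)) (fun t => exp ((la + d) * t)).
  apply: (@bigO_ext _ (fun t => exp l * (exp (la * t) * (exp (ln (phi t) - la * t - l) - 1)))).
    move=> t; rewrite -{1}(exp_ln (phi t)); last by case: (fr_phi_range hF t).
    have {1}-> : ln (phi t) = l + la * t + (ln (phi t) - la * t - l) by ring.
    by rewrite !exp_plus; ring.
  apply: bigO_scal; apply: (bigO_exp_mult (Rle_refl _) (bigO_refl _)).
  exact: (bigO_trans (bigO_exp_minus_1 (bigO_tends0 heta (tends0_exp hd))) heta).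
have hphi0 : bigO_minf phi (fun t => exp (la * t)).
  apply: (@bigO_ext _ (fun t => (phi t - exp l * exp (la * t)) + exp l * exp (la * t))).
    by move=> t; ring.
  apply: bigO_plus; last by apply: bigO_scal; apply: bigO_refl.
  by apply: bigO_trans hphi (bigO_exp _); lra.
(* Integrating [b * phi (t - c * h)] with the leading term of [phi] gives [a0 * exp (la * t)] for
   the flux. Solving for [psi] divides by [c - la = mu], and [la * mu = 1 - r] yields the stated
   coefficient. *)
pose a0 := b * exp l * exp (- la * (c * h)) / la.
have hflux : bigO_minf (fun t => flux c psi psi1 t - a0 * exp (la * t)) (fun t => exp ((la + d) * t)).
  apply: (bigO_integral_exp (df := fun t => b * ((phi (t - c * h) - exp l * exp (la * (t - c * h)))
     - phi (t - c * h) * psi t))) => [|t||]; first by lra.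
  - have q := flux_derive hF t; der.
    have -> : la * (t - c * h) = - la * (c * h) + la * t by ring.
    by rewrite exp_plus /a0; field; lra.
  - by apply: tends0_minus; [apply: (flux_tends0 hF) | apply: tends0_scal; apply: tends0_exp].
  - apply: bigO_scal; apply: bigO_minus; first exact: (bigO_exp_shift (c * h) hphi).
    by apply: (bigO_exp_mult _ (bigO_exp_shift (c * h) hphi0) psi2); lra.
exists l, d; split=> //; split=> //.
apply: (@bigO_ext _ (fun t => psi t - a0 / mu * exp (la * t))).
  move=> t; have -> : la * (t - c * h) = - la * (c * h) + la * t by ring.
  by rewrite exp_plus -hprod /a0; field; lra.
apply: (bigO_ode_exp (al := fun _ => c) (a := c) _ _ _ hflux); first by lra.
- have q1 := en_psi (fr_entire hF) => t; der.
  by rewrite /flux -hsum; field; lra.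
- by move=> e he; exists 0 => t _; rewrite Rminus_diag Rabs_R0; lra.
Qed.

(** * Algebraic asymptotics, r = 1 *)

Section SlowExpansion.
Variables (b h c M : R) (phi phi1 psi psi1 : R -> R).
Hypotheses (hb : 0 < b) (hh : 0 <= h) (hc : 0 < c).
Hypothesis hF : front b 1 h c M phi phi1 psi psi1.
Hypothesis hp0 : tends0 (fun t => phi1 t / phi t).

Let J := flux c psi psi1.
Let Jd (t : R) := b * phi (t - c * h) * (1 - psi t).
Let p (t : R) := phi1 t / phi t.
(** [eta] and [m] are the logarithmic derivatives of [Jd] and [J]; [rho] expresses [phi] as a
    multiple of the derivative of [J], the form in which [Oflux_int] applies. *)
Let eta (t : R) := p (t - c * h) - psi1 t / (1 - psi t).
Let m (t : R) := Jd t / J t.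
Let rho (t : R) := phi t / Jd t.

Let hch : 0 <= c * h. Proof. by apply: Rmult_le_pos; lra. Qed.
Let J_pos t : 0 < J t. Proof. exact: (flux_pos hb hF). Qed.
Let J_mono s t : s <= t -> J s <= J t. Proof. exact: (flux_mono hb hF). Qed.
Let J_tends0 : tends0 J. Proof. exact: (flux_tends0 hF). Qed.
Let J_derive t : is_derive J t (Jd t). Proof. exact: (flux_derive hF). Qed.
Let Jd_pos t : 0 < Jd t. Proof. exact: (flux_derive_pos hb hF). Qed.
Let phi_r t : 0 < phi t < 1. Proof. exact: (fr_phi_range hF). Qed.
Let psi_r t : 0 <= psi t < 1. Proof. exact: (fr_psi_range hF). Qed.
Let phi_d t : is_derive phi t (phi1 t). Proof. exact: (en_phi (fr_entire hF)). Qed.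
Let psi_d t : is_derive psi t (psi1 t). Proof. exact: (en_psi (fr_entire hF)). Qed.
Let phi1_p t : phi1 t = p t * phi t.
Proof. by rewrite /p; field; have := phi_r t; lra. Qed.
Let psi1_J t : psi1 t = c * psi t - J t. Proof. by rewrite /J /flux; ring. Qed.

Local Notation Oflux k f := (bigO_minf f (fun t => J t ^ k)).

Lemma Oflux_intro k f K T : (forall t, t <= T -> Rabs (f t) <= K * J t ^ k) -> Oflux k f.
Proof.
move=> hO; apply: (@bigO_intro _ _ K T) => t ht.
by rewrite (Rabs_pos_eq (J t ^ k)); [apply: hO | left; apply: pow_lt].
Qed.

Lemma Oflux_elim k f T0 : Oflux k f ->
  exists K T, 0 <= K /\ T <= T0 /\ forall t, t <= T -> Rabs (f t) <= K * J t ^ k.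
Proof.
move=> /(@bigO_elim _ _ T0) [K [T [hK [hT hO]]]]; exists K, T; split=> //; split=> // t /hO.
by rewrite (Rabs_pos_eq (J t ^ k)) //; left; apply: pow_lt.
Qed.

Lemma Oflux_mult k l f g : Oflux k f -> Oflux l g -> Oflux (k + l)%coq_nat (fun t => f t * g t).
Proof.
move=> hf hg; apply: bigO_trans (bigO_mult hf hg) _.
by apply: (@bigO_intro _ _ 1 0) => t _; rewrite pow_add; lra.
Qed.

Lemma Oflux_J : Oflux 1 J.
Proof. by apply: (@bigO_intro _ _ 1 0) => t _; rewrite pow_1; lra. Qed.

Lemma Oflux_weaken k f : Oflux k.+1 f -> Oflux k f.
Proof.
have [T1 hT1] := J_tends0 Rlt_0_1.
move=> /(@Oflux_elim _ _ T1) [K [T [hK [hT hO]]]]; apply: (@Oflux_intro _ _ K T) => t ht.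
apply: Rle_trans (hO t ht) _; apply: Rmult_le_compat_l => //=.
have := hT1 t ltac:(lra); rewrite Rabs_pos_eq; last by left.
have := pow_lt (J t) k (J_pos t); nra.
Qed.

Lemma Oflux_shift k f s : 0 <= s -> Oflux k f -> Oflux k (fun t => f (t - s)).
Proof.
move=> hs /(@Oflux_elim _ _ 0) [K [T [hK [_ hO]]]]; apply: (@Oflux_intro _ _ K T) => t ht.
apply: Rle_trans (hO (t - s) ltac:(lra)) _; apply: Rmult_le_compat_l => //.
by apply: pow_incr; split; [left | apply: J_mono; lra].
Qed.

Lemma Oflux_bounded f T K : (forall t, t <= T -> Rabs (f t) <= K) -> Oflux 0 f.
Proof. by move=> hO; apply: (@Oflux_intro _ _ K T) => t ht; rewrite /= Rmult_1_r; apply: hO. Qed.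

Lemma Oflux_tends0 k f : Oflux k.+1 f -> tends0 f.
Proof.
elim: k f => [|k IH] f; last by move/Oflux_weaken; apply: IH.
by move/bigO_tends0; apply; apply: (tends0_bound (T := 0)) J_tends0 => t _; rewrite pow_1; lra.
Qed.

Lemma Jd_derive t : is_derive Jd t (Jd t * eta t).
Proof.
have q1 := psi_d t; have q2 := phi_d (t - c * h).
rewrite /Jd; der; rewrite /eta /p; field.
by have := psi_r t; have := phi_r (t - c * h); lra.
Qed.

Lemma eta_tends0 : tends0 eta.
Proof.
apply: tends0_minus; first exact: (@tends0_shift _ (- (c * h)) hp0).
have [T hT] := fr_psi0 hF (e := 1 / 2) ltac:(lra).
apply: (@tends0_bounded_mult psi1 (fun t => / (1 - psi t)) T 2); last exact: (fr_psi10 hF).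
move=> t /hT /Rabs_le_between q; rewrite Rabs_pos_eq; last first.
  by left; apply: Rinv_0_lt_compat; lra.
have -> : 2 = / (1 / 2) by field.
by apply: Rinv_le_contravar; lra.
Qed.

Lemma m_pos t : 0 < m t. Proof. by apply: Rdiv_lt_0_compat. Qed.

(** [m' = eta * m - m ^ 2] with [eta] tending to 0, so a value above [d] would blow up backward. *)
Lemma m_tends0 : tends0 m.
Proof.
move=> d hd; have [T hT] := eta_tends0 (e := d / 2) ltac:(lra).
exists T => t ht; rewrite Rabs_pos_eq; last by left; apply: m_pos.
apply: (@riccati_blowup m (fun t => eta t * m t - m t ^ 2) T (1 / 2) d) => //; try lra.
- move=> s _; have q1 := J_derive s; have q2 := Jd_derive s; have q3 := J_pos s.
  rewrite /m; der; first by lra.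
  by field; lra.
- move=> s hs hbig; have /Rabs_le_between q := hT s hs; nra.
Qed.

(** The weight [J ^ k] has logarithmic derivative [INR k * m], which tends to 0. The effective
    coefficient stays above [c / 2] and the order of [g] passes to [y] without loss. *)
Lemma Oflux_ode k (y al g : R -> R) :
  (forall t, is_derive y t (al t * y t - g t)) -> tends0 (fun t => al t - c) -> Oflux k g -> Oflux k y.
Proof.
move=> hy hal hg.
have [T1 hT1] := hal (c / 4) ltac:(lra).
have hik : 0 <= INR k := pos_INR k.
have [T2 hT2] := m_tends0 (e := c / (4 * (INR k + 1))) ltac:(apply: Rdiv_lt_0_compat; lra).
have [K [T [hK [hT hO]]]] := Oflux_elim (Rmin T1 T2) hg.
have q1 := Rmin_l T1 T2; have q2 := Rmin_r T1 T2.
have [K' hK'] : exists K, forall t, t <= T -> Rabs (y t) <= K * J t ^ k.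
  apply: (@ode_back_weighted y al g (fun t => INR k * m t) (fun t => J t ^ k) T (c / 2) K)
    => // [|t ht|t ht]; first by lra.
  - split; first exact: pow_lt.
    have q := derive_pow k (J_derive t).
    apply: derive_eq q _; rewrite /m; case: (k) => [|j]; first by rewrite /= ; field; have := J_pos t; lra.
    by rewrite /Init.Nat.pred -tech_pow_Rmult; field; have := J_pos t; lra.
  - have /Rabs_le_between w := hT1 t ltac:(lra).
    have := hT2 t ltac:(lra); rewrite Rabs_pos_eq; last by left; apply: m_pos.
    move=> w'; have : INR k * m t <= c / 4; last by lra.
    apply: Rle_trans (_ : (INR k + 1) * (c / (4 * (INR k + 1))) <= _); last first.
      by right; field; lra.
    by apply: Rmult_le_compat; try lra; left; apply: m_pos.
exact: Oflux_intro hK'.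
Qed.

(** [Jd * J ^ k] is, up to the factor [k + 1], the derivative of [J ^ k.+1], so writing a derivative
    as a multiple of [Jd] gains one order. *)
Lemma Oflux_int k (f e : R -> R) :
  (forall t, is_derive f t (Jd t * e t)) -> Oflux k e -> tends0 f -> Oflux k.+1 f.
Proof.
move=> hf /(@Oflux_elim _ _ 0) [K [T [hK [_ hO]]]] f0.
apply: (@Oflux_intro _ _ K T); apply: (@abs_le_of_derive f (fun t => Jd t * e t) (fun t => K * J t ^ k.+1)
  (fun t => K * (INR k.+1 * Jd t * J t ^ k)) T) => // [t ht|t ht|].
- have q := J_derive t; apply: derive_eq (derive_mult (derive_const K t) (derive_pow k.+1 q)) _.
  by rewrite /Init.Nat.pred; ring.
- rewrite Rabs_mult (Rabs_pos_eq (Jd t)); last by left.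
  have hj := Jd_pos t; have hq := pow_lt (J t) k (J_pos t).
  apply: Rle_trans (_ : Jd t * (K * J t ^ k) <= _).
    by apply: Rmult_le_compat_l; [lra | apply: hO].
  have : 1 <= INR k.+1 by rewrite S_INR; have := pos_INR k; lra.
  have : 0 <= K * (Jd t * J t ^ k) by apply: Rmult_le_pos => //; apply: Rmult_le_pos; lra.
  nra.
- apply: tends0_scal; apply: (@Oflux_tends0 k); exact: bigO_refl.
Qed.

Lemma psi_O1 : Oflux 1 psi.
Proof.
apply: (@Oflux_ode 1 psi (fun _ => c) J); last exact: Oflux_J.
  by move=> t; apply: derive_eq (psi_d t) _; apply: psi1_J.
by move=> e he; exists 0 => t _; rewrite Rminus_diag Rabs_R0; lra.
Qed.

Lemma rho_O0 : Oflux 0 rho.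
Proof.
have [T1 hT1] := hp0 (e := / (c * h + 1)) ltac:(apply: Rinv_0_lt_compat; lra).
have [T2 hT2] := fr_psi0 hF (e := 1 / 2) ltac:(lra).
apply: (@Oflux_bounded _ (Rmin T1 T2) (6 / b)) => t ht.
have q1 := Rmin_l T1 T2; have q2 := Rmin_r T1 T2.
(* With [p <= d] and [d * (c * h) <= 1], [phi] grows over one delay by at most the factor
   [exp 1 <= 3]. The bound [1 - psi >= 1 / 2] doubles this to the 6 above. *)
pose d := / (c * h + 1).
have hd : 0 < d by apply: Rinv_0_lt_compat; lra.
have hdc : d * (c * h) <= 1.
  have : d * (c * h + 1) = 1 by rewrite /d; field; lra.
  lra.
have hdec : phi t * exp (- d * t) <= phi (t - c * h) * exp (- d * (t - c * h)).
  apply: (@derive_le0_ge (fun t => phi t * exp (- d * t))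
    (fun t => (p t - d) * (phi t * exp (- d * t))) (t - c * h) t ltac:(lra)) => s hs.
  - by have w := phi_d s; der; rewrite phi1_p; ring.
  - have /Rabs_le_between w := hT1 s ltac:(lra).
    have w2 := phi_r s; have w3 := exp_pos (- d * s).
    have : 0 <= phi s * exp (- d * s) by apply: Rmult_le_pos; lra.
    have : p s - d <= 0 by rewrite /p /d; lra.
    nra.
have h3 : phi t <= 3 * phi (t - c * h).
  have w : exp (- d * (t - c * h)) <= 3 * exp (- d * t).
    have -> : - d * (t - c * h) = d * (c * h) + - d * t by ring.
    rewrite exp_plus; apply: Rmult_le_compat_r; first by left; apply: exp_pos.
    by apply: Rle_trans (exp_le hdc) exp_le_3.
  have w2 := exp_pos (- d * t); have w3 := phi_r (t - c * h).
  apply: (Rmult_le_reg_r (exp (- d * t))) => //.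
  apply: Rle_trans hdec _.
  have -> : 3 * phi (t - c * h) * exp (- d * t) = phi (t - c * h) * (3 * exp (- d * t)) by ring.
  by apply: Rmult_le_compat_l; lra.
have /Rabs_le_between hp := hT2 t ltac:(lra).
have w1 := phi_r t; have w2 := Jd_pos t; have w3 := phi_r (t - c * h).
rewrite /rho Rabs_pos_eq; last by left; apply: Rdiv_lt_0_compat; lra.
apply/Rle_div_l => //.
have : b * phi (t - c * h) * (1 / 2) <= Jd t by apply: Rmult_le_compat_l; [nra | lra].
move=> w4; have -> : 6 / b * Jd t = 6 * (Jd t / b) by field; lra.
have w5 : phi (t - c * h) * (1 / 2) = b * phi (t - c * h) * (1 / 2) / b by field; lra.
have : phi (t - c * h) * (1 / 2) <= Jd t / b.
  by rewrite w5; apply: Rmult_le_compat_r => //; left; apply: Rinv_0_lt_compat.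
lra.
Qed.

Lemma phi_rho t : phi t = Jd t * rho t.
Proof. by rewrite /rho; field; have := Jd_pos t; lra. Qed.

Lemma phi_O1 : Oflux 1 phi.
Proof.
have hm : Oflux 0 m by have [T hT] := m_tends0 Rlt_0_1; apply: Oflux_bounded hT.
apply: (@bigO_ext _ (fun t => J t * (m t * rho t))).
  by move=> t; rewrite /m /rho; field; have := J_pos t; have := Jd_pos t; lra.
exact: (Oflux_mult Oflux_J (Oflux_mult hm rho_O0)).
Qed.

Lemma p_derive t : is_derive p t ((c - p t) * p t - (psi t - phi t)).
Proof. by apply: derive_eq (log_derivative t hF) _; rewrite -/(p t); ring. Qed.

Lemma cp_tends0 : tends0 (fun t => (c - p t) - c).
Proof.
apply: (tends0_bound (T := 0)) hp0 => t _.
have -> : c - p t - c = - p t by ring.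
rewrite Rabs_Ropp; exact: Rle_refl.
Qed.

Lemma p_O1 : Oflux 1 p.
Proof. exact: (Oflux_ode p_derive cp_tends0 (bigO_minus psi_O1 phi_O1)). Qed.

(** [phi' = Jd * (rho * p)]: the crude first order of [phi] gave that of [p], and integration
    returns an improved order for [phi]. *)
Lemma phi_O2 : Oflux 2 phi.
Proof.
apply: (@Oflux_int 1 phi (fun t => rho t * p t)); last exact: (fr_phi0 hF).
  by move=> t; apply: derive_eq (phi_d t) _; rewrite phi1_p {1}phi_rho; ring.
exact: (Oflux_mult rho_O0 p_O1).
Qed.

Lemma Jd_le_phi t : Jd t <= b * phi t.
Proof.
have w1 := psi_r t; have w2 := phi_r (t - c * h).
have w3 := @phi_mono _ _ _ _ _ _ _ _ _ hF (t - c * h) t ltac:(lra).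
have : b * phi (t - c * h) <= b * phi t by apply: Rmult_le_compat_l; lra.
have : 0 <= b * phi (t - c * h) by apply: Rmult_le_pos; lra.
rewrite /Jd; nra.
Qed.

Lemma Jd_O2 : Oflux 2 Jd.
Proof.
apply: bigO_trans phi_O2; apply: (@bigO_intro _ _ b 0) => t _.
have w := Jd_pos t; have w' := Jd_le_phi t; have w2 := phi_r t.
by rewrite !Rabs_pos_eq; lra.
Qed.

Lemma eta_O1 : Oflux 1 eta.
Proof.
apply: bigO_minus; first exact: (Oflux_shift hch p_O1).
have [T hT] := fr_psi0 hF (e := 1 / 2) ltac:(lra).
have hi : Oflux 0 (fun t => / (1 - psi t)).
  apply: (@Oflux_bounded _ T 2) => t /hT /Rabs_le_between q; rewrite Rabs_pos_eq; last first.
    by left; apply: Rinv_0_lt_compat; lra.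
  have -> : 2 = / (1 / 2) by field.
  by apply: Rinv_le_contravar; lra.
have h1 : Oflux 1 psi1.
  by apply: (bigO_ext psi1_J); apply: bigO_minus Oflux_J; apply: bigO_scal; apply: psi_O1.
exact: (Oflux_mult h1 hi).
Qed.

(** Iterating [psi = (J + psi1) / c] gives the formal series [J / c + J' / c ^ 2 + ...]; [z] is the
    remainder after two terms. *)
Let z (t : R) := psi t - J t / c - Jd t / c ^ 2.

Lemma z_O3 : Oflux 3 z.
Proof.
apply: (@Oflux_ode 3 z (fun _ => c) (fun t => / c ^ 2 * (Jd t * eta t))).
- move=> t; have q1 := J_derive t; have q2 := Jd_derive t; have q3 := psi_d t.
  by rewrite /z /Rdiv; der; rewrite psi1_J; field; lra.
- by move=> e he; exists 0 => t _; rewrite Rminus_diag Rabs_R0; lra.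
- by apply: bigO_scal; apply: (Oflux_mult Jd_O2 eta_O1).
Qed.

(** To leading order the equation of [p] reads [c * p = psi = J / c]; [x] is the deviation from this
    value and [g] the source that drives it. *)
Let x (t : R) := p t - J t / c ^ 2.
Let g (t : R) := z t + 2 / c ^ 2 * Jd t - phi t + / c ^ 2 * (J t * p t).

Lemma x_derive t : is_derive x t ((c - p t) * x t - g t).
Proof.
have q1 := J_derive t; have q2 := p_derive t.
by rewrite /x /Rdiv; der; rewrite /g /z; field; lra.
Qed.

Lemma x_O2 : Oflux 2 x.
Proof.
apply: (Oflux_ode x_derive cp_tends0).
apply: bigO_plus; last by apply: bigO_scal; apply: (Oflux_mult Oflux_J p_O1).
apply: bigO_minus phi_O2; apply: bigO_plus; first exact: Oflux_weaken z_O3.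
by apply: bigO_scal; apply: Jd_O2.
Qed.

Lemma phi1_derive t : is_derive phi1 t (phi t * (c * p t - (psi t - phi t))).
Proof.
apply: derive_eq (en_phi1 (fr_entire hF) t) _; rewrite /growth phi1_p; ring.
Qed.

Let tau (t : R) := phi (t - c * h) / phi t * (1 - psi t).

Lemma Jd_tau t : Jd t = b * (phi t * tau t).
Proof. by rewrite /Jd /tau; field; have := phi_r t; lra. Qed.

(** [tau] is the ratio of [Jd] to [b * phi]. In its first-order coefficient [(h + 1) / c], [h] comes
    from the delay and 1 from the factor [1 - psi]. *)
Let tau2 (t : R) := tau t - 1 + (h + 1) / c * J t.

(* Taylor expansion of the delayed term, [phi'' = O(J^2 phi)]. *)
Lemma delay_O2 : Oflux 2 (fun t => phi (t - c * h) / phi t - 1 + c * h * p t).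
Proof.
have hq : Oflux 2 (fun t => c * p t - (psi t - phi t)).
  apply: (@bigO_ext _ (fun t => c * x t - z t - / c ^ 2 * Jd t + phi t)).
    by move=> t; rewrite /x /z; field; lra.
  apply: bigO_plus phi_O2; apply: bigO_minus; last by apply: bigO_scal; apply: Jd_O2.
  by apply: bigO_minus (Oflux_weaken z_O3); apply: bigO_scal; apply: x_O2.
have [K [T [hK [_ hT]]]] := Oflux_elim 0 hq.
apply: (@Oflux_intro _ _ (c * h * (c * h) * K) T) => t ht.
have w := phi_r t.
have [|s [hs es]] := @mvt_le phi phi1 (t - c * h) t ltac:(lra); first by move=> s _.
have hJ2 := pow_lt (J t) 2 (J_pos t).
have h1 : Rabs (phi1 t - phi1 s) <= K * J t ^ 2 * phi t * (t - s).
  apply: (@derive_abs_le phi1 _ s t _ ltac:(lra)) => y hy; first exact: phi1_derive.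
  have w1 := phi_r y; rewrite Rabs_mult (Rabs_pos_eq (phi y)); last by lra.
  rewrite Rmult_comm; apply: Rmult_le_compat; [exact: Rabs_pos | lra | | ].
    apply: Rle_trans (hT y ltac:(lra)) _; apply: Rmult_le_compat_l => //.
    by apply: pow_incr; split; [left | apply: J_mono; lra].
  by apply: (phi_mono hF); lra.
have -> : phi (t - c * h) / phi t - 1 + c * h * p t = c * h * (phi1 t - phi1 s) / phi t.
  have -> : phi (t - c * h) = phi t - phi1 s * (c * h) by lra.
  by rewrite /p; field; lra.
rewrite Rabs_div; last by lra.
rewrite (Rabs_pos_eq (phi t)); last by lra.
apply/Rle_div_l; first by lra.
rewrite Rabs_mult (Rabs_pos_eq (c * h)); last by lra.
apply: Rle_trans (_ : c * h * (K * J t ^ 2 * phi t * (t - s)) <= _).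
  exact: Rmult_le_compat_l.
have -> : c * h * (c * h) * K * J t ^ 2 * phi t = c * h * (K * J t ^ 2 * phi t * (c * h)) by ring.
apply: Rmult_le_compat_l => //; apply: Rmult_le_compat_l; last by lra.
by apply: Rmult_le_pos; [apply: Rmult_le_pos; lra | lra].
Qed.

Lemma psi_O2 : Oflux 2 (fun t => psi t - / c * J t).
Proof.
apply: (@bigO_ext _ (fun t => z t + / c ^ 2 * Jd t)); first by move=> t; rewrite /z; field; lra.
by apply: bigO_plus; [apply: Oflux_weaken z_O3 | apply: bigO_scal; apply: Jd_O2].
Qed.

Lemma tau2_O2 : Oflux 2 tau2.
Proof.
pose s2 t := phi (t - c * h) / phi t - 1 + h / c * J t.
have hs2 : Oflux 2 s2.
  apply: (@bigO_ext _ (fun t => (phi (t - c * h) / phi t - 1 + c * h * p t) - c * h * x t)).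
    by move=> t; rewrite /s2 /x; field; have := phi_r t; lra.
  by apply: bigO_minus; [apply: delay_O2 | apply: bigO_scal; apply: x_O2].
apply: (@bigO_ext _ (fun t => (s2 t - (psi t - / c * J t)) - s2 t * psi t + h / c * (J t * psi t))).
  by move=> t; rewrite /tau2 /tau /s2; field; have := phi_r t; lra.
apply: bigO_plus; last by apply: bigO_scal; apply: (Oflux_mult Oflux_J psi_O1).
apply: bigO_minus; first exact: bigO_minus psi_O2.
exact: Oflux_weaken (Oflux_mult hs2 psi_O1).
Qed.

Lemma tau1_O1 : Oflux 1 (fun t => 1 - tau t).
Proof.
apply: (@bigO_ext _ (fun t => (h + 1) / c * J t - tau2 t)).
  by move=> t; rewrite /tau2; ring.
by apply: bigO_minus (Oflux_weaken tau2_O2); apply: bigO_scal; apply: Oflux_J.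
Qed.

(** To leading order [phi' = p * phi] is [(J / c ^ 2) * (Jd / b)], and integrating [J * Jd] gives
    the coefficient [/ (2 * b * c ^ 2)]. *)
Let Rm (t : R) := phi t - / (2 * b * c ^ 2) * J t ^ 2.

Lemma Rm_O3 : Oflux 3 Rm.
Proof.
apply: (@Oflux_int 2 Rm (fun t => rho t * (x t + / c ^ 2 * (J t * (1 - tau t))))).
- move=> t; have q1 := J_derive t; have q2 := phi_d t.
  rewrite /Rm; der.
  transitivity (phi t * (x t + / c ^ 2 * (J t * (1 - tau t)))); last by rewrite {1}phi_rho; ring.
  rewrite phi1_p Jd_tau /x; field; lra.
- apply: (Oflux_mult rho_O0); apply: bigO_plus; first exact: x_O2.
  by apply: bigO_scal; apply: (Oflux_mult Oflux_J tau1_O1).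
- by apply: tends0_minus; [apply: (fr_phi0 hF) | apply: tends0_scal; apply: (@Oflux_tends0 1); apply: bigO_refl].
Qed.

Lemma Jd_O3 : Oflux 3 (fun t => Jd t - / (2 * c ^ 2) * J t ^ 2).
Proof.
apply: (@bigO_ext _ (fun t => b * Rm t - b * (phi t * (1 - tau t)))).
  by move=> t; rewrite /Rm Jd_tau; field; lra.
by apply: bigO_minus; apply: bigO_scal; [apply: Rm_O3 | apply: (Oflux_mult phi_O2 tau1_O1)].
Qed.

(** [g0] is the second-order part of [g]. Inserting the leading terms of [Jd] and [phi] into
    [g0 / c] yields the coefficient [be] of [J ^ 2] in [p]. *)
Let g0 (t : R) := / c ^ 4 * J t ^ 2 + 2 / c ^ 2 * Jd t - phi t.
Let be := 2 / c ^ 5 - 1 / (2 * b * c ^ 3).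

Lemma p_O3 : Oflux 3 (fun t => p t - / c ^ 2 * J t - be * J t ^ 2).
Proof.
have hg0 : Oflux 2 g0.
  apply: bigO_minus phi_O2; apply: bigO_plus; apply: bigO_scal; [exact: bigO_refl | exact: Jd_O2].
(* Subtracting the quasi-static value [g0 / c] leaves an equation whose source [G] is of third
   order. *)
pose X t := x t - g0 t / c.
pose G t := z t + / c ^ 2 * (J t * x t)
  + / c * (2 / c ^ 4 * (J t * Jd t) + 2 / c ^ 2 * (Jd t * eta t) - p t * phi t)
  + / c * (p t * g0 t).
have hX : Oflux 3 X.
  apply: (@Oflux_ode 3 X (fun t => c - p t) G _ cp_tends0).
    move=> t; have q1 := J_derive t; have q2 := Jd_derive t; have q3 := phi_d t.
    have q4 := x_derive t.
    by rewrite /X /g0 /Rdiv; der; rewrite phi1_p /G /g /g0 /x; field; lra.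
  apply: bigO_plus; last by apply: bigO_scal; apply: (Oflux_mult p_O1 hg0).
  apply: bigO_plus; first by apply: bigO_plus z_O3 _; apply: bigO_scal; apply: (Oflux_mult Oflux_J x_O2).
  apply: bigO_scal; apply: bigO_minus; last exact: (Oflux_mult p_O1 phi_O2).
  by apply: bigO_plus; apply: bigO_scal; [apply: (Oflux_mult Oflux_J Jd_O2) | apply: (Oflux_mult Jd_O2 eta_O1)].
apply: (@bigO_ext _ (fun t => X t + / c * (2 / c ^ 2 * (Jd t - / (2 * c ^ 2) * J t ^ 2) - Rm t))).
  by move=> t; rewrite /X /g0 /Rm /x /be; field; lra.
apply: bigO_plus hX _; apply: bigO_scal; apply: bigO_minus Rm_O3; apply: bigO_scal; exact: Jd_O3.
Qed.

(** The coefficient of [J ^ 3] in [phi]: in [phi' = p * phi] one writes [phi] as [Jd / (b * tau)];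
    [be] is the second-order term of [p], [(h + 1) / c ^ 3] the correction by [tau], and [3] comes
    from integrating [J ^ 2 * Jd]. *)
Let ga := (be + (h + 1) / c ^ 3) / (3 * b).

Lemma phi_O4 : Oflux 4 (fun t => Rm t - ga * J t ^ 3).
Proof.
apply: (@Oflux_int 3 _ (fun t => rho t * ((p t - / c ^ 2 * J t - be * J t ^ 2)
  - / c ^ 2 * (J t * tau2 t) + 3 * b * ga * ((1 - tau t) * J t ^ 2)))).
- move=> t; have q1 := J_derive t; have q2 := phi_d t.
  rewrite /Rm; der.
  transitivity (phi t * ((p t - / c ^ 2 * J t - be * J t ^ 2)
    - / c ^ 2 * (J t * tau2 t) + 3 * b * ga * ((1 - tau t) * J t ^ 2)));
    last by rewrite {1}phi_rho; ring.
  rewrite phi1_p Jd_tau /tau2 /ga; field; lra.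
- apply: (Oflux_mult rho_O0); apply: bigO_plus; last by apply: bigO_scal; apply: (Oflux_mult tau1_O1 (bigO_refl _)).
  apply: bigO_minus p_O3 _; apply: bigO_scal; exact: (Oflux_mult Oflux_J tau2_O2).
- apply: tends0_minus; first exact: (Oflux_tends0 Rm_O3).
  by apply: tends0_scal; apply: (@Oflux_tends0 2); apply: bigO_refl.
Qed.

(** This is [b * ga - (h + 1) / (2 * c ^ 3)], the cubic coefficient of [b * phi * tau]. *)
Let kappa := - (c ^ 2 * (1 + h + 1 / b) - 4) / (6 * c ^ 5).

Lemma Jd_O4 : Oflux 4 (fun t => Jd t - / (2 * c ^ 2) * J t ^ 2 - kappa * J t ^ 3).
Proof.
apply: (@bigO_ext _ (fun t => b * (Rm t - ga * J t ^ 3) + b * (Rm t * (tau t - 1))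
  + / (2 * c ^ 2) * (J t ^ 2 * tau2 t))).
  move=> t; rewrite Jd_tau /Rm /tau2 /ga /be /kappa; field; lra.
apply: bigO_plus; last by apply: bigO_scal; apply: (Oflux_mult (bigO_refl _) tau2_O2).
apply: bigO_plus; first by apply: bigO_scal; apply: phi_O4.
apply: bigO_scal; apply: (Oflux_mult Rm_O3); apply: bigO_ext (bigO_scal (-1) tau1_O1) => t; ring.
Qed.

End SlowExpansion.

(** * Inversion of the relation between the flux and its derivative *)

Lemma ln_neg_bounds (t : R) : t <= - 3 ->
  1 <= ln (- t) /\ ln (- t) <= - t /\ ln (- t) ^ 2 <= 4 * - t.
Proof.
move=> ht.
have h1 : 1 <= ln (- t).
  rewrite -(ln_exp 1); apply: ln_le; first exact: exp_pos.
  by have := exp_le_3; lra.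
have hln x : 0 < x -> ln x <= x.
  by move=> hx; have := exp_ineq1_le (ln x); rewrite exp_ln //; lra.
split=> //; split; first by apply: hln; lra.
have hs : 0 < sqrt (- t) by apply: sqrt_lt_R0; lra.
have hss : sqrt (- t) * sqrt (- t) = - t by apply: sqrt_sqrt; lra.
have e : ln (- t) = 2 * ln (sqrt (- t)) by rewrite -{1}hss ln_mult //; ring.
have := hln _ hs; nra.
Qed.

Lemma ln_neg_derive (t : R) : t <= - 3 -> is_derive (fun t => ln (- t)) t (/ t).
Proof.
move=> ht; have q : 0 < - t by lra.
by apply: derive_eq (derive_ln (derive_opp (derive_id t)) q) _; field; lra.
Qed.

Lemma bigO_1_ln : bigO_minf (fun _ => 1) (fun t => ln (- t)).
Proof.
apply: (@bigO_intro _ _ 1 (- 3)) => t ht; have [l1 _] := ln_neg_bounds ht.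
by rewrite !Rabs_pos_eq; lra.
Qed.

Lemma bigO_ln_square : bigO_minf (fun t => ln (- t) ^ 2 / t ^ 2) (fun t => / t).
Proof.
apply: (@bigO_intro _ _ 4 (- 3)) => t ht; have [_ [_ l3]] := ln_neg_bounds ht.
have q : 0 < / t ^ 2 by apply: Rinv_0_lt_compat; nra.
rewrite Rabs_pos_eq; last by apply: Rmult_le_pos; [apply: pow2_ge_0 | lra].
rewrite Rabs_left; last by apply: Rinv_lt_0_compat; lra.
have -> : 4 * - / t = 4 * - t * / t ^ 2 by field; lra.
by apply: Rmult_le_compat_r; lra.
Qed.

Lemma bigO_ln_inv : bigO_minf (fun t => ln (- t) / t ^ 2) (fun t => / t).
Proof.
apply: bigO_trans bigO_ln_square; apply: (@bigO_intro _ _ 1 (- 3)) => t ht.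
have [l1 _] := ln_neg_bounds ht; have q : 0 < / t ^ 2 by apply: Rinv_0_lt_compat; nra.
rewrite Rmult_1_l !Rabs_mult; apply: Rmult_le_compat_r; first exact: Rabs_pos.
by rewrite !Rabs_pos_eq; nra.
Qed.

Section Inversion.
Variables (J Jd : R -> R) (c ka : R).
Hypotheses (hc : 0 < c) (J_pos : forall t, 0 < J t) (J0 : tends0 J).
Hypothesis J_derive : forall t, is_derive J t (Jd t).
Hypothesis Jd_O4 :
  bigO_minf (fun t => Jd t - / (2 * c ^ 2) * J t ^ 2 - ka * J t ^ 3) (fun t => J t ^ 4).

Let Y (t : R) := / J t.
Let e (t : R) := (Jd t - / (2 * c ^ 2) * J t ^ 2 - ka * J t ^ 3) * / J t ^ 2.

Lemma Y_derive t : is_derive Y t (- / (2 * c ^ 2) - (ka * J t + e t)).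
Proof.
have q := J_derive t; have qp := J_pos t; rewrite /Y; der; first by lra.
by rewrite /e; field; lra.
Qed.

Lemma e_O2 : bigO_minf e (fun t => J t ^ 2).
Proof.
apply: bigO_trans (bigO_mult Jd_O4 (bigO_refl _)) _; apply: (@bigO_intro _ _ 1 0) => t _.
by have qp := J_pos t; right; rewrite Rmult_1_l; f_equal; field; lra.
Qed.

Lemma rem_O1 : bigO_minf (fun t => ka * J t + e t) J.
Proof.
apply: bigO_plus; first by apply: bigO_scal; apply: bigO_refl.
apply: bigO_trans e_O2 _; apply: (@bigO_ext _ (fun t => J t * J t)); first by move=> t; ring.
apply: bigO_trans (bigO_mult (bigO_refl J) (bigO_tends0_const J0)) _.
by apply: (@bigO_intro _ _ 1 0) => t _; rewrite Rmult_1_r; lra.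
Qed.

Lemma J_inv : bigO_minf J (fun t => / t).
Proof.
have hc2 : 0 < c ^ 2 by apply: pow_lt.
(* Half of the slope [/ (2 * c ^ 2)] of [Y]; the other half absorbs the remainder. For [t <= 2 * T']
   the distance to [T'] is at least [- t / 2], which gives a lower bound linear in [- t]. *)
pose k := / (4 * c ^ 2); have hk : 0 < k by apply: Rinv_0_lt_compat; lra.
have ek : / (2 * c ^ 2) = 2 * k by rewrite /k; field; lra.
have [T hT] := bigO_tends0 rem_O1 J0 hk.
pose T' := Rmin T (- 1).
have hT1 : T' <= T by apply: Rmin_l.
have hT2 : T' <= - 1 by apply: Rmin_r.
apply: (@bigO_intro _ _ (2 / k) (2 * T')) => t ht.
have key : Y T' + k * T' <= Y t + k * t.
  apply: (@derive_le0_ge (fun t => Y t + k * t)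
    (fun t => - / (2 * c ^ 2) - (ka * J t + e t) + k) t T' ltac:(lra)) => s hs.
  - by have q := Y_derive s; der; ring.
  - by have /Rabs_le_between := hT s ltac:(lra); lra.
have hY : 0 < Y T' by apply: Rinv_0_lt_compat.
have hlow : k * - t / 2 <= Y t by nra.
rewrite Rabs_pos_eq; last by left.
rewrite Rabs_left; last by apply: Rinv_lt_0_compat; lra.
have -> : 2 / k * - / t = / (k * - t / 2) by field; lra.
have -> : J t = / Y t by rewrite /Y Rinv_inv.
by apply: Rinv_le_contravar => //; apply: Rmult_lt_0_compat; nra.
Qed.

Let F (t : R) := Y t + / (2 * c ^ 2) * t.

Lemma F_derive t : is_derive F t (- (ka * J t + e t)).
Proof. by have q := Y_derive t; rewrite /F; der; ring. Qed.

Lemma F_ln : bigO_minf F (fun t => ln (- t)).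
Proof.
have h : bigO_minf F (fun t => 1 + Rabs (- ln (- t))).
  apply: (bigO_integral (df := fun t => - (ka * J t + e t)) (dG := fun t => - / t) (T := - 3)).
  - by move=> t _; apply: F_derive.
  - by move=> t ht; apply: derive_opp; apply: ln_neg_derive.
  - by move=> t ht; have := @Rinv_lt_0_compat t ltac:(lra); lra.
  - apply: (@bigO_ext _ (fun t => - 1 * (ka * J t + e t))); first by move=> t; ring.
    apply: bigO_scal; apply: bigO_trans (bigO_trans rem_O1 J_inv) _.
    by apply: (@bigO_intro _ _ 1 0) => t _; rewrite Rabs_Ropp; lra.
apply: bigO_trans h _; apply: bigO_plus; first exact: bigO_1_ln.
by apply: (@bigO_intro _ _ 1 0) => t _; rewrite Rabs_Rabsolu Rabs_Ropp; lra.
Qed.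

Lemma J_first_order : bigO_minf (fun t => J t + 2 * c ^ 2 * / t) (fun t => ln (- t) / t ^ 2).
Proof.
apply: (bigO_near (T := - 3) (f' := fun t => J t * (2 * c ^ 2 * / t) * F t)).
  by move=> t ht; rewrite /F /Y; field; have := J_pos t; lra.
apply: bigO_trans (bigO_mult (bigO_mult J_inv (bigO_scal (2 * c ^ 2) (bigO_refl _))) F_ln) _.
by apply: (bigO_eq (T := - 3)) => t ht; field; lra.
Qed.

(** Inserting [J = - 2 * c ^ 2 / t] into [F' = - ka * J] gives the derivative of
    [2 * c ^ 2 * ka * ln (- t)]; without it, [F] has an integrable derivative. *)
Let F2 (t : R) := F t - 2 * c ^ 2 * ka * ln (- t).

Lemma F2_bounded : bigO_minf F2 (fun _ => 1).
Proof.
(* An antiderivative of [ln (- t) / t ^ 2], bounded at -oo. *)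
pose G t := (ln (- t) + 1) * - / t.
have h : bigO_minf F2 (fun t => 1 + Rabs (G t)).
  apply: (bigO_integral (df := fun t => - ka * (J t + 2 * c ^ 2 * / t) - e t)
    (dG := fun t => ln (- t) / t ^ 2) (T := - 3)).
  - by move=> t ht; have q1 := F_derive t; have q2 := ln_neg_derive ht; rewrite /F2; der; ring.
  - move=> t ht; have q2 := ln_neg_derive ht; rewrite /G; der; first by lra.
    by field; lra.
  - move=> t ht; have [l1 _] := ln_neg_bounds ht.
    by apply: Rmult_le_pos; [lra | left; apply: Rinv_0_lt_compat; nra].
  - apply: bigO_minus; first by apply: bigO_scal; apply: J_first_order.
    apply: bigO_trans e_O2 _; apply: (@bigO_ext _ (fun t => J t * J t)); first by move=> t; ring.
    apply: bigO_trans (bigO_mult J_inv J_inv) _.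
    apply: (@bigO_intro _ _ 1 (- 3)) => t ht; have [l1 _] := ln_neg_bounds ht.
    have -> : / t * / t = 1 / t ^ 2 by field; lra.
    rewrite Rmult_1_l !Rabs_mult; apply: Rmult_le_compat_r; first exact: Rabs_pos.
    by rewrite !Rabs_pos_eq; lra.
apply: bigO_trans h _; apply: bigO_plus; first exact: bigO_refl.
apply: (@bigO_intro _ _ 2 (- 3)) => t ht; have [l1 [l2 _]] := ln_neg_bounds ht.
have q : 0 < / - t by apply: Rinv_0_lt_compat; lra.
rewrite Rabs_Rabsolu Rabs_R1 /G -Rinv_opp Rabs_pos_eq; last by apply: Rmult_le_pos; lra.
have : (ln (- t) + 1) * / - t <= (2 * - t) * / - t by apply: Rmult_le_compat_r; lra.
have -> : (2 * - t) * / - t = 2 by field; lra.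
lra.
Qed.

(** The reciprocal of [- t / (2 * c ^ 2) + 2 * c ^ 2 * ka * ln (- t)], expanded to first order in
    [ln (- t) / t]. *)
Definition inverse_expansion (t : R) : R :=
  - (2 * c ^ 2) * / t - 8 * c ^ 6 * ka * (ln (- t) / t ^ 2).

Lemma inverse_expansion_O1 : bigO_minf inverse_expansion (fun t => / t).
Proof.
by apply: bigO_minus; apply: bigO_scal; [apply: bigO_refl | apply: bigO_ln_inv].
Qed.

Lemma J_second_order : bigO_minf (fun t => J t - inverse_expansion t) (fun t => / t ^ 2).
Proof.
(* [g] is [inverse_expansion t * Y t - 1] with the leading terms cancelled, so [- J * g] is the
   error. *)
pose g t := - (16 * c ^ 8 * ka ^ 2) * (ln (- t) ^ 2 / t ^ 2) + inverse_expansion t * F2 t.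
apply: (bigO_near (T := - 3) (f' := fun t => -1 * (J t * g t))).
  move=> t ht; rewrite /g /F2 /F /Y /inverse_expansion; field.
  by have := J_pos t; lra.
have hg : bigO_minf g (fun t => / t).
  apply: bigO_plus; first by apply: bigO_scal; apply: bigO_ln_square.
  apply: bigO_trans (bigO_mult inverse_expansion_O1 F2_bounded) _.
  by apply: (@bigO_intro _ _ 1 0) => t _; rewrite Rmult_1_r; lra.
apply: bigO_scal; apply: bigO_trans (bigO_mult J_inv hg) _.
by apply: (bigO_eq (T := - 3)) => t ht; field; lra.
Qed.

End Inversion.

Lemma slow_asymptotics (b h c M : R) (phi phi1 psi psi1 : R -> R) :
  0 < b -> 0 <= h -> 0 < c -> front b 1 h c M phi phi1 psi psi1 ->
  tends0 (fun t => phi1 t / phi t) ->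
  let Q := c ^ 2 * (1 + h + 1 / b) - 4 in
  bigO_minf (fun t => phi t - (2 * c ^ 2 / b / t ^ 2
    - 8 * c / (3 * b) * Q * (ln (- t) / t ^ 3))) (fun t => 1 / t ^ 3) /\
  bigO_minf (fun t => psi (t + c * h) - (- (2 * c) / t + 4 / 3 * Q * (ln (- t) / t ^ 2)))
    (fun t => 1 / t ^ 2).
Proof.
move=> hb hh hc hF hp Q.
have hch : 0 <= c * h by apply: Rmult_le_pos; lra.
pose J := flux c psi psi1.
have J_pos t : 0 < J t := flux_pos hb hF t.
have J_mono s t : s <= t -> J s <= J t by exact: (flux_mono hb hF).
pose ka := - Q / (6 * c ^ 5); pose Jd t := b * phi (t - c * h) * (1 - psi t).
have dJ t : is_derive J t (Jd t) := flux_derive hF t.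
have J4 : bigO_minf (fun t => Jd t - / (2 * c ^ 2) * J t ^ 2 - ka * J t ^ 3) (fun t => J t ^ 4).
  exact: (Jd_O4 hb hh hc hF hp).
have J0 : tends0 J := flux_tends0 hF.
have J1 := J_inv hc J_pos J0 dJ J4.
have Je := J_second_order hc J_pos J0 dJ J4.
have E1 := inverse_expansion_O1 c ka.
set E := inverse_expansion c ka in Je E1.
have Jpow k : bigO_minf (fun t => J t ^ k) (fun t => (/ t) ^ k).
  elim: k => [|k IH] /=; first exact: bigO_refl.
  exact: bigO_mult.
split.
(* [phi] is [J ^ 2 / (2 * b * c ^ 2)] up to [O(J ^ 3)], and [J] is replaced by its expansion [E].
   The last summand is the part of [E ^ 2] quadratic in the logarithm, beyond the announced
   order. *)
- apply: (bigO_near (T := - 3) (f' := fun t => (phi t - / (2 * b * c ^ 2) * J t ^ 2)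
    + / (2 * b * c ^ 2) * ((J t - E t) * (J t + E t))
    + 32 * c ^ 10 * ka ^ 2 / b * (ln (- t) ^ 2 / t ^ 2 * / t ^ 2))).
    by move=> t ht; rewrite /E /inverse_expansion /ka; field; lra.
  apply: bigO_plus; first apply: bigO_plus.
  + apply: bigO_trans (bigO_trans (Rm_O3 hb hh hc hF hp) (Jpow 3%nat)) _.
    by apply: (bigO_eq (T := - 3)) => t ht; field; lra.
  + apply: bigO_scal; apply: bigO_trans (bigO_mult Je (bigO_plus J1 E1)) _.
    by apply: (bigO_eq (T := - 3)) => t ht; field; lra.
  + apply: bigO_scal; apply: bigO_trans (bigO_mult bigO_ln_square (bigO_refl _)) _.
    by apply: (bigO_eq (T := - 3)) => t ht; field; lra.
have shift (f : R -> R) k : bigO_minf f (fun t => J t ^ k) ->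
    bigO_minf (fun t => f (t + c * h)) (fun t => (/ t) ^ k).
  move=> hf; have [K [T [hK [hT H]]]] := bigO_elim 0 (bigO_trans hf (Jpow k)).
  apply: (@bigO_intro _ _ (K * 2 ^ k) (Rmin (T - c * h) (- (2 * (c * h)) - 1))) => t ht.
  have q1 := Rmin_l (T - c * h) (- (2 * (c * h)) - 1).
  have q2 := Rmin_r (T - c * h) (- (2 * (c * h)) - 1).
  apply: Rle_trans (H (t + c * h) ltac:(lra)) _; rewrite Rmult_assoc.
  apply: Rmult_le_compat_l => //; rewrite -!RPow_abs -Rpow_mult_distr; apply: pow_incr.
  split; first exact: Rabs_pos.
  rewrite !Rabs_left; try (by apply: Rinv_lt_0_compat; lra).
  have -> : 2 * - / t = / (- t / 2) by field; lra.
  rewrite -Rinv_opp; apply: Rinv_le_contravar; lra.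
(* Advancing the argument by [c * h] changes [J] by [O(J ^ 2)] only, which is within the error
   [1 / t ^ 2]. *)
apply: (bigO_near (T := - 3) (f' := fun t => (psi (t + c * h) - / c * J (t + c * h))
  + / c * (J (t + c * h) - J t) + / c * (J t - E t))).
  by move=> t ht; rewrite /E /inverse_expansion /ka; field; lra.
have hsq : bigO_minf (fun t => (/ t) ^ 2) (fun t => 1 / t ^ 2).
  by apply: (bigO_eq (T := - 3)) => t ht; field; lra.
apply: bigO_plus; first apply: bigO_plus.
- exact: bigO_trans (shift _ _ (psi_O2 hb hh hc hF hp)) hsq.
- apply: bigO_scal; apply: bigO_trans hsq; apply: bigO_trans (shift _ 2%nat (bigO_refl _)).
  have [K [T [hK [hT H]]]] := Oflux_elim hb hF 0 (Jd_O2 hb hh hc hF hp).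
  apply: (@bigO_intro _ _ (K * (c * h)) (T - c * h)) => t ht.
  rewrite (Rabs_pos_eq (J (t + c * h) ^ 2)); last by left; apply: pow_lt.
  have -> : K * (c * h) * J (t + c * h) ^ 2 = K * J (t + c * h) ^ 2 * (t + c * h - t) by ring.
  apply: (@derive_abs_le J Jd t (t + c * h) _ ltac:(lra)) => s hs; first exact: dJ.
  apply: Rle_trans (H s ltac:(lra)) _; apply: Rmult_le_compat_l => //.
  by apply: pow_incr; split; [left; apply: J_pos | apply: J_mono; lra].
- apply: bigO_scal; apply: bigO_trans Je _.
  by apply: (@bigO_intro _ _ 1 0) => t _; rewrite /Rdiv !Rmult_1_l; lra.
Qed.

(** * Travelling waves in R^n *)

Lemma Rplus_associative : associative Rplus.
Proof. by move=> x y z; rewrite Rplus_assoc. Qed.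

HB.instance Definition _ :=
  Monoid.isComLaw.Build R 0 Rplus Rplus_associative Rplus_comm Rplus_0_l.

Lemma derive_n_of (g g1 g2 : R -> R) :
  (forall t, is_derive g t (g1 t)) -> (forall t, is_derive g1 t (g2 t)) ->
  forall t, ex_derive_n g 1 t /\ ex_derive_n g 2 t /\ Derive_n g 2 t = g2 t.
Proof.
move=> h1 h2 t.
have e s : g1 s = Derive g s by symmetry; apply: is_derive_unique.
split; first by exists (g1 t).
split.
  by apply: (ex_derive_ext g1) => //; exists (g2 t).
rewrite -(is_derive_unique _ _ _ (h2 t)) /=; apply: Derive_ext => s; exact: is_derive_unique.
Qed.

Section Travelling.
Variables (n : nat) (nu : 'I_n -> R) (c : R).
Hypothesis hnu : enorm nu = 1.

Lemma dot_nu : dot nu nu = 1.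
Proof.
move: hnu; rewrite /enorm => e.
(* [sqrt] takes the value 0 on negative numbers, which is incompatible with norm one. *)
case: (Rle_lt_dec 0 (dot nu nu)) => h; last by rewrite sqrt_neg_0 in e; lra.
by rewrite -(sqrt_sqrt _ h) e; ring.
Qed.

Lemma dot_update (x : 'I_n -> R) (i : 'I_n) (s : R) :
  dot nu (fun j => if j == i then s else x j)
  = nu i * s + \big[Rplus/0]_(j < n | j != i) (nu j * x j).
Proof.
rewrite /dot (bigD1 i) //= eqxx; congr (_ + _).
by apply: eq_bigr => j /negbTE ->.
Qed.

Lemma dot_update_id (x : 'I_n -> R) (i : 'I_n) :
  dot nu (fun j => if j == i then x i else x j) = dot nu x.
Proof. by apply: eq_bigr => j _; case: eqP => // ->. Qed.

Lemma slice_derive (f f1 : R -> R) (t : R) (x : 'I_n -> R) (i : 'I_n) (s : R) :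
  (forall t, is_derive f t (f1 t)) ->
  is_derive (slice (travelling nu c f t) x i) s (nu i * slice (travelling nu c f1 t) x i s).
Proof.
move=> h; rewrite /slice /travelling.
apply: (@derive_comp f (fun s => dot nu (fun j => if j == i then s else x j) + c * t)) => //.
apply: (is_derive_ext (fun s => nu i * s + \big[Rplus/0]_(j < n | j != i) (nu j * x j) + c * t)).
  by move=> y; rewrite dot_update.
by der; ring.
Qed.

Lemma travelling_derivatives (f f1 f2 : R -> R) :
  (forall t, is_derive f t (f1 t)) -> (forall t, is_derive f1 t (f2 t)) ->
  has_heat_derivatives (travelling nu c f) /\ forall t x,
    Derive (fun s => travelling nu c f s x) t = c * f1 (dot nu x + c * t) /\
    laplacian (travelling nu c f t) x = f2 (dot nu x + c * t).
Proof.
move=> h1 h2.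
have hs t x i := @derive_n_of (slice (travelling nu c f t) x i)
  (fun s => nu i * slice (travelling nu c f1 t) x i s)
  (fun s => nu i * (nu i * slice (travelling nu c f2 t) x i s)).
have {}hs t x i s : ex_derive_n (slice (travelling nu c f t) x i) 1 s /\
    ex_derive_n (slice (travelling nu c f t) x i) 2 s /\
    Derive_n (slice (travelling nu c f t) x i) 2 s
      = nu i * (nu i * slice (travelling nu c f2 t) x i s).
  apply: hs => y; first exact: slice_derive.
  apply: derive_eq (derive_mult (derive_const (nu i) y) (slice_derive t x i y h2)) _; ring.
have ht t x : is_derive (fun s => travelling nu c f s x) t (c * f1 (dot nu x + c * t)).
  by apply: (@derive_comp f (fun s => dot nu x + c * s)) => //; der; ring.
split.
  move=> t x; split; first by eexists; apply: ht.
  by move=> i s; have [? [? _]] := hs t x i s.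
move=> t x; split; first exact: is_derive_unique.
rewrite /laplacian.
under eq_bigr => i _.
  have [_ [_ ->]] := hs t x i (x i).
  rewrite {1}/slice /travelling dot_update_id.
  have -> : nu i * (nu i * f2 (dot nu x + c * t)) = f2 (dot nu x + c * t) * (nu i * nu i) by ring.
  over.
rewrite -(big_morph (Rmult (f2 (dot nu x + c * t)))
  (fun x y => Rmult_plus_distr_l _ x y) (Rmult_0_r _)).
by rewrite -/(dot nu nu) dot_nu; ring.
Qed.

End Travelling.

(** * From the profile to the wavefront *)

Lemma tends0_is_lim (f : R -> R) (l : R) :
  tends0 (fun t => f t - l) -> is_lim f m_infty l.
Proof.
move=> h; apply/is_lim_spec => e; have he := cond_pos e.
have [T hT] := h (e / 2) ltac:(lra).
by exists T => t ht; have := hT t ltac:(lra); lra.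
Qed.

Lemma tends0_is_lim_pinf (f : R -> R) (l : R) :
  tends0 (fun t => f (- t) - l) -> is_lim f p_infty l.
Proof.
move=> h; apply/is_lim_spec => e; have he := cond_pos e.
have [T hT] := h (e / 2) ltac:(lra).
exists (- T) => t ht; have := hT (- t) ltac:(lra); rewrite Ropp_involutive; lra.
Qed.

(** [1 - psi (t + c * h)] undoes the substitution [psi t = 1 - theta (t - c * h)]. The shift [s] is
    free because the profile system is autonomous; it later normalises the leading coefficient. *)
Lemma monotone_wavefront_of_front (n : nat) (nu : 'I_n -> R) (b r h c M s : R)
  (phi phi1 psi psi1 : R -> R) :
  enorm nu = 1 -> front b r h c M phi phi1 psi psi1 ->
  monotone_wavefront nu b r h c (fun t => phi (t + s)) (fun t => 1 - psi (t + c * h + s)).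
Proof.
move=> hnu hF.
have E := fr_entire hF.
have d1 t : is_derive (fun t => phi (t + s)) t (phi1 (t + s)).
  by apply: derive_shift; apply: (en_phi E).
have d2 t : is_derive (fun t => phi1 (t + s)) t
    (c * phi1 (t + s) - growth r (phi (t + s)) (psi (t + s))).
  by apply: derive_shift; apply: (en_phi1 E).
have d3 t : is_derive (fun t => 1 - psi (t + c * h + s)) t (- psi1 (t + c * h + s)).
  have q : is_derive (fun t => psi (t + c * h + s)) t (psi1 (t + c * h + s)).
    apply: (@derive_shift (fun t => psi (t + s)) t (c * h)); apply: derive_shift.
    exact: (en_psi E).
  by der; ring.
have d4 t : is_derive (fun t => - psi1 (t + c * h + s)) t
    (c * - psi1 (t + c * h + s) + b * phi (t + s) * (1 - psi (t + c * h + s))).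
  have q := @derive_shift (fun t => psi1 (t + s)) t (c * h) _
    (@derive_shift psi1 (t + c * h) s _ (en_psi1 E (t + c * h + s))).
  have e : t + c * h + s - c * h = t + s by ring.
  by rewrite e in q; der; ring.
have n1 := derive_n_of d1 d2; have n2 := derive_n_of d3 d4.
have C2 (g g2 : R -> R) : (forall t, ex_derive_n g 1 t /\ ex_derive_n g 2 t /\ Derive_n g 2 t = g2 t) ->
    (forall t, ex_derive g2 t) -> forall t, C2_near g t.
  move=> hg hc t; apply: filter_forall => x; have [h1 [h2 _]] := hg x; do 2 split=> //.
  apply: (continuous_ext g2); first by move=> y; have [_ [_ ->]] := hg y.
  exact: ex_derive_continuous.
split.
split=> //.
- apply: (C2 _ _ n1) => t.
  have q1 := d1 t; have q2 := d2 t.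
  have q3 : is_derive (fun t => psi (t + s)) t (psi1 (t + s)).
    by apply: derive_shift; apply: (en_psi E).
  by rewrite /growth; eexists; repeat der1.
- apply: (C2 _ _ n2) => t.
  have q1 := d1 t; have q2 := d3 t; have q3 := d4 t.
  by eexists; repeat der1.
- apply: tends0_is_lim; apply: (tends0_bound (T := 0)) (tends0_shift s (fr_phi0 hF)) => t _.
  by rewrite Rminus_0_r; right.
- apply: tends0_is_lim.
  apply: (tends0_bound (T := 0)) (tends0_shift (c * h + s) (fr_psi0 hF)) => t _.
  have -> : 1 - psi (t + c * h + s) - 1 = - psi (t + (c * h + s)) by rewrite -Rplus_assoc; ring.
  by rewrite Rabs_Ropp; right.
- apply: tends0_is_lim_pinf.
  apply: (tends0_bound (T := 0)) (tends0_shift (- s) (fr_phi_pinf hF)) => t _.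
  by right; do 4 f_equal; ring.
- apply: tends0_is_lim_pinf.
  apply: (tends0_bound (T := 0)) (tends0_shift (- (c * h + s)) (fr_psi_pinf hF)) => t _.
  have -> : - (t + - (c * h + s)) = - t + c * h + s by ring.
  rewrite -Rabs_Ropp; right; f_equal; ring.
- have [H1 H2] := travelling_derivatives c hnu d1 d2.
  have [H3 H4] := travelling_derivatives c hnu d3 d4.
  do 2 split=> //; move=> t x.
  have [-> ->] := H2 t x; have [-> ->] := H4 t x.
  rewrite /travelling; split; last by ring.
  have -> : dot nu x + c * (t - h) + c * h + s = dot nu x + c * t + s by ring.
  by rewrite /growth; ring.
- by move=> t; case: (fr_phi_range hF (t + s)).
- by move=> t; have := fr_psi_range hF (t + c * h + s); lra.
- by left=> x y hxy; apply: (phi_mono hF); lra.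
- by right=> x y hxy; have := psi_mono hF (s := x + c * h + s) (t := y + c * h + s); lra.
Qed.

Theorem theorem17 (b r h c : R)
  (hb : (0 < b)%R) (hr : (0 < r <= 1)%R) (hh : (0 <= h)%R)
  (hc : (2 * sqrt (1 - r) < c)%R)
  (hsuper : exists psi phi : R -> R, regular_super_solution b r h c psi phi)
  (n : nat) (nu : 'I_n -> R) (hnu : enorm nu = 1%R) :
  (exists phi theta : R -> R,
    monotone_wavefront nu b r h c phi theta /\
    (r = 1 ->
      bigO_minf
        (fun t => phi t -
          ((2 * c ^ 2 / b) / t ^ 2
           - 8 * c / (3 * b) * (c ^ 2 * (1 + h + 1 / b) - 4)
             * (ln (- t) / t ^ 3)))
        (fun t => 1 / t ^ 3) /\
      bigO_minf
        (fun t => theta t -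
          (1 + 2 * c / t
           - 4 / 3 * (c ^ 2 * (1 + h + 1 / b) - 4) * (ln (- t) / t ^ 2)))
        (fun t => 1 / t ^ 2)) /\
    (r < 1 ->
      exists eps : R, 0 < eps /\
        bigO_minf
          (fun t => phi t - exp (chi_lambda r c * t))
          (fun t => exp ((chi_lambda r c + eps) * t)) /\
        bigO_minf
          (fun t => theta t - (1 - b * exp (chi_lambda r c * t) / (1 - r)))
          (fun t => exp ((chi_lambda r c + eps) * t))))%R.
Proof.
have hc0 : 0 < c by have := sqrt_pos (1 - r); lra.
have [psi0 [phi0 hreg]] := hsuper.
have [Phi [Psi hS]] := super_of_regular hb hr hh hc0 hreg.
have [M [phi [phi1 [psi [psi1 [hE [hpsi0 hdef]]]]]]] := entire_of_super hb hr hh hc0 hS.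
have hF := front_of_entire hb hr hh hc0 hE hpsi0 hdef.
have hslow := front_slow hb hr hh hc hS hF.
case: (Req_dec r 1) => hr1.
- exists (fun t => phi (t + 0)), (fun t => 1 - psi (t + c * h + 0)).
  split; first exact: (monotone_wavefront_of_front 0 hnu hF).
  split=> [_|]; last by lra.
  have hla : chi_lambda r c = 0.
    rewrite /chi_lambda hr1.
    have -> : c ^ 2 - 4 * (1 - 1) = c ^ 2 by ring.
    by rewrite sqrt_pow2; lra.
  have hp : tends0 (fun t => phi1 t / phi t).
    by apply: (tends0_bound (T := 0)) hslow => t _; rewrite hla Rminus_0_r; right.
  rewrite hr1 in hF.
  have [a1 a2] := slow_asymptotics hb hh hc0 hF hp.
  split; first by apply: (bigO_ext _ a1) => t; rewrite Rplus_0_r.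
  apply: (bigO_near (T := -3) _ (bigO_scal (- 1) a2)) => t ht.
  by rewrite Rplus_0_r; field; lra.
- have hr' : 0 < r < 1 by lra.
  have [hsum hprod hlm hl0 hlpos] := chi_facts hr hc.
  have hl := hlpos (proj2 hr').
  have [l [d [hd [a1 a2]]]] := fast_asymptotics hb hr' hh hc hF hslow.
  set la := chi_lambda r c in hl a1 a2 *.
  (* This translation turns the coefficient [exp l] of [exp (la * t)] into 1. *)
  pose s := - l / la.
  exists (fun t => phi (t + s)), (fun t => 1 - psi (t + c * h + s)).
  split; first exact: (monotone_wavefront_of_front s hnu hF).
  split=> [|_]; first by lra.
  have els : la * s = - l by rewrite /s; field; lra.
  have e1 t : exp l * exp (la * (t + s)) = exp (la * t).
    by rewrite -exp_plus; f_equal; rewrite Rmult_plus_distr_l els; ring.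
  exists d; split=> //; split.
  + apply: (bigO_ext _ (bigO_exp_shift (- s) a1)) => t.
    by rewrite -(e1 t) /Rminus Ropp_involutive.
  + apply: (bigO_ext _ (bigO_scal (- 1) (bigO_exp_shift (- (c * h + s)) a2))) => t.
    have -> : t - - (c * h + s) - c * h = t + s by ring.
    have -> : t - - (c * h + s) = t + c * h + s by ring.
    by rewrite -(e1 t); field; lra.
Qed.
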